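(* For every real $\nu>\eta>0$ and every $x>x^{@}_{\mu,\eta}$, with $\mu=\sqrt{\nu^2-\eta^2}$, we have $$\underline{\psi}_{\nu,\eta}(x)<\psi_{\nu,\eta}(x).$$
   Context: $J_\nu,Y_\nu$ are the standard Bessel functions of the first and second kind. For $\nu>\eta>0$ set $U_{\nu,\eta}(x):=x^{-\eta}J_\nu(x)$, $W_{\nu,\eta}(x):=x^{-\eta}Y_\nu(x)$ (ultraspherical Bessel functions). Define $L_{\nu,\eta},\psi_{\nu,\eta}:(0,+\infty)\to\mathbb{R}$ by $L_{\nu,\eta}(x)=\sqrt{U'_{\nu,\eta}(x)^2+W'_{\nu,\eta}(x)^2}$ and $U'_{\nu,\eta}(x)+\mathrm{i}W'_{\nu,\eta}(x)=L_{\nu,\eta}(x)\left(\cos\psi_{\nu,\eta}(x)+\mathrm{i}\sin\psi_{\nu,\eta}(x)\right)$, with $\psi_{\nu,\eta}$ the continuous branch such that $\lim_{x\to0^+}\psi_{\nu,\eta}(x)=\frac{\pi}{2}$. With $\mu:=\sqrt{\nu^2-\eta^2}$, define for $x>\mu$ $$\underline{\psi}_{\nu,\eta}(x):=\sqrt{x^2-\mu^2}-\left(\frac{\eta^2}{2\mu}+\mu\right)\arccos\frac{\mu}{x}+\frac{\eta}{\sqrt{x^2-\mu^2}}+\frac{\pi}{4}\left(\frac{\eta^2}{\mu}+2(\mu-\nu)+1\right).$$ Define, for $\mu\ge0$, $\eta>0$, the polynomial in $x$ $$\begin{aligned} r_{\mu,\eta}(x):={}&12x^{14}+x^{12}\left(-44\mu^2+4\eta(\eta^3+4\eta^2-5\eta-18)\right)\\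 &+x^{10}\left(40\mu^4+8(-3\eta^3-10\eta^2+6\eta+5)\eta\mu^2-\eta^2(\eta+2)^2(4\eta^2+8\eta-3)\right)\\ &+x^8\big(40\mu^6+4(15\eta^3+40\eta^2+2\eta+70)\eta\mu^4\\ &\qquad+(20\eta^4+96\eta^3+147\eta^2+96\eta+52)\eta^2\mu^2+(\eta+2)^4\eta^4\big)\\ &+x^6\big(-100\mu^8-8\eta(10\eta^3+20\eta^2+14\eta+45)\mu^6\\ &\qquad-\eta^2(40\eta^4+144\eta^3+171\eta^2+116\eta+80)\mu^4-4\eta^5(\eta+2)^3\mu^2\big)\\ &+x^4\big(68\mu^{10}+4(15\eta^3+20\eta^2+27\eta+20)\eta\mu^8\\ &\qquad+(40\eta^4+96\eta^3+81\eta^2+24\eta+16)\eta^2\mu^6+6(\eta+2)^2\eta^6\mu^4\big)\\ &+x^2\big(-16\mu^{12}-8\eta(3\eta^3+2\eta^2+4\eta-4)\mu^{10}\\ &\qquad-4\eta^3(5\eta^3+6\eta^2+3\eta-4)\mu^8-4\eta^7(\eta+2)\mu^6\big)\\ &+\left(4\eta^4\mu^{12}+4\eta^6\mu^{10}+\eta^8\mu^8\right), \end{aligned}$$ and let $x^{@}_{\mu,\eta}$ be its greatest positive real root (it exists, and $x^{@}_{\mu,\eta}>\mu$). *)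

(* Defs.v *)
From Stdlib Require Export Reals Factorial.
From Coquelicot Require Export Coquelicot.

Open Scope R_scope.

(** Gauss's formula: [1 / Gamma z] is the limit of
    [z (z + 1) ... (z + n) / (n! n^z)].  The limit exists for every real [z]
    and is [0] at the poles of [Gamma]. *)
Definition rGamma (z : R) : R :=
  real (Lim_seq (fun n : nat =>
    prod_f_R0 (fun k : nat => z + INR k) n
      / (INR (fact n) * Rpower (INR n) z))).

(** [(x/2)^nu * sum_k (-1)^k / (k! Gamma(nu + k + 1)) * (x/2)^(2k)],
    meaningful for [x > 0]. *)
Definition BesselJ (nu x : R) : R :=
  Rpower (x / 2) nu *
  PSeries (fun k : nat => (-1) ^ k / INR (fact k) * rGamma (nu + INR k + 1))
          ((x / 2) ^ 2).

Definition BesselY_quotient (nu x : R) : R :=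
  (BesselJ nu x * cos (nu * PI) - BesselJ (- nu) x) / sin (nu * PI).

(** [sin (nu * PI) = 0] means that [nu] is an integer; the order then tends
    to [nu]. *)
Definition BesselY (nu x : R) : R :=
  if Req_dec_T (sin (nu * PI)) 0
  then real (Lim (fun a : R => BesselY_quotient a x) nu)
  else BesselY_quotient nu x.

Definition U (nu eta x : R) : R := Rpower x (- eta) * BesselJ nu x.

Definition W (nu eta x : R) : R := Rpower x (- eta) * BesselY nu x.

Definition L (nu eta x : R) : R :=
  sqrt (Derive (U nu eta) x ^ 2 + Derive (W nu eta) x ^ 2).

(** [psi] is the phase of [U' + i W'] on the positive half-line; its
    values elsewhere are unconstrained.  The complex identity is split into
    real and imaginary parts. *)
Definition is_psi (nu eta : R) (psi : R -> R) : Prop :=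
  (forall x : R, 0 < x ->
     Derive (U nu eta) x = L nu eta x * cos (psi x) /\
     Derive (W nu eta) x = L nu eta x * sin (psi x)) /\
  (forall x : R, 0 < x -> continuous psi x) /\
  filterlim psi (at_right 0) (locally (PI / 2)).

Definition mu_of (nu eta : R) : R := sqrt (nu ^ 2 - eta ^ 2).

(** Meaningful for [x > mu_of nu eta]. *)
Definition psi_lower (nu eta x : R) : R :=
  let mu := mu_of nu eta in
  sqrt (x ^ 2 - mu ^ 2)
  - (eta ^ 2 / (2 * mu) + mu) * acos (mu / x)
  + eta / sqrt (x ^ 2 - mu ^ 2)
  + PI / 4 * (eta ^ 2 / mu + 2 * (mu - nu) + 1).

Definition r_poly (mu eta x : R) : R :=
  12 * x ^ 14
  + x ^ 12 * (- 44 * mu ^ 2 + 4 * eta * (eta ^ 3 + 4 * eta ^ 2 - 5 * eta - 18))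
  + x ^ 10 *
    (40 * mu ^ 4
     + 8 * (- 3 * eta ^ 3 - 10 * eta ^ 2 + 6 * eta + 5) * eta * mu ^ 2
     - eta ^ 2 * (eta + 2) ^ 2 * (4 * eta ^ 2 + 8 * eta - 3))
  + x ^ 8 *
    (40 * mu ^ 6
     + 4 * (15 * eta ^ 3 + 40 * eta ^ 2 + 2 * eta + 70) * eta * mu ^ 4
     + (20 * eta ^ 4 + 96 * eta ^ 3 + 147 * eta ^ 2 + 96 * eta + 52)
       * eta ^ 2 * mu ^ 2
     + (eta + 2) ^ 4 * eta ^ 4)
  + x ^ 6 *
    (- 100 * mu ^ 8
     - 8 * eta * (10 * eta ^ 3 + 20 * eta ^ 2 + 14 * eta + 45) * mu ^ 6
     - eta ^ 2 * (40 * eta ^ 4 + 144 * eta ^ 3 + 171 * eta ^ 2 + 116 * eta + 80)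
       * mu ^ 4
     - 4 * eta ^ 5 * (eta + 2) ^ 3 * mu ^ 2)
  + x ^ 4 *
    (68 * mu ^ 10
     + 4 * (15 * eta ^ 3 + 20 * eta ^ 2 + 27 * eta + 20) * eta * mu ^ 8
     + (40 * eta ^ 4 + 96 * eta ^ 3 + 81 * eta ^ 2 + 24 * eta + 16)
       * eta ^ 2 * mu ^ 6
     + 6 * (eta + 2) ^ 2 * eta ^ 6 * mu ^ 4)
  + x ^ 2 *
    (- 16 * mu ^ 12
     - 8 * eta * (3 * eta ^ 3 + 2 * eta ^ 2 + 4 * eta - 4) * mu ^ 10
     - 4 * eta ^ 3 * (5 * eta ^ 3 + 6 * eta ^ 2 + 3 * eta - 4) * mu ^ 8
     - 4 * eta ^ 7 * (eta + 2) * mu ^ 6)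
  + (4 * eta ^ 4 * mu ^ 12 + 4 * eta ^ 6 * mu ^ 10 + eta ^ 8 * mu ^ 8).

Definition is_greatest_positive_root (f : R -> R) (z : R) : Prop :=
  0 < z /\ f z = 0 /\ (forall y : R, 0 < y -> f y = 0 -> y <= z).

(* Main.v *)
Require Import Defs.
From Stdlib Require Import Lra Lia.

(** ** Why the bound holds

    Write [m] for [mu_of nu eta].  A function [g] with [g' > 0] is the phase of a
    basis of solutions of [v'' + q v = 0], where [q = g' ^ 2 + d' - d ^ 2] and
    [d = g'' / (2 g')]; this [q] is called [potential] below.  For [psi] it comes
    from the differential equation of [U'], and for [psi_lower] by differentiation.
    Their difference at [y] is
    [r_poly m eta y / (16 (qnum m eta y) ^ 2 y ^ 2 (y ^ 2 - m ^ 2) ^ 3)]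
    ([potential_low_sub]), where [qnum] is the numerator of [psi_lower'].  Beyond
    [x_at] the polynomial is positive, and [x_at] is not below the last zero of
    [qnum] ([qnum_pos_beyond]), so there [psi_lower] is increasing and has the
    larger potential.

    By a Sturm-type argument the phase with the larger potential gains on the
    other one ([comparison_lt]): if [psi <= psi_lower] held at [x], then
    [psi_lower - psi] would be bounded below by a positive constant near infinity.
    The asymptotics of [U'] and [W'] give [cos (psi_lower - psi) -> 1]
    ([is_lim_cos_gap]), which leaves a positive multiple of [2 PI] as the only
    possible limit of the difference.  The difference is eventually smaller
    than [2 PI], by a margin ([psi_gt_wkb]): the same comparison applies to a
    phase [theta] of [J + i Y] and the Liouville-Green phase [wkb], the initial
    value of [theta] being read off from the limit of [psi] at [0].

    The facts on Bessel functions, collected in [hankel_pair], are the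
    recurrences, the Wronskian and the asymptotics at infinity.  They come from
    Schlaefli's integral
    [PI (J + i Y) = int_0^PI exp (i (x sin s - nu s)) ds
      - i int_0^oo (exp (nu t) + exp (- nu t - i nu PI)) exp (- x sinh t) dt],
    whose right-hand side defines the family [cyl].  Integration by parts gives
    the recurrences.  The leading term of [exp (i nu PI / 2) (J + i Y)] at infinity
    does not depend on [nu] ([osc_sub_le]), and at [nu = 1 / 2] the recurrences
    can be solved explicitly ([cyl_half]); this yields the asymptotics up to one
    complex constant.

    It remains to recognise the ascending series in [cyl].  The Casoratian of
    [BesselJ] and [cyl 0] in the order is periodic and tends to [0] for large
    orders, so it vanishes and [BesselJ = kappa * cyl 0], with [kappa] periodic in
    the order.  As in the Bohr-Mollerup theorem, log-convexity of
    [int_0^oo exp (nu t - x sinh t) dt] in [nu], against Gauss's product for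
    [1 / Gamma], makes [kappa] constant ([kappa_constant]).  It is positive
    ([kappa_pos]), and a positive factor leaves the phase unchanged.  Reflection
    [nu -> - nu] then gives [BesselY] ([BesselY_eq]), by continuity in [nu] when
    [nu] is an integer. *)

(** * Calculus on the real line *)

(* Naming the structure on the real line spares unification the search for it. *)
Definition RInt_correct_R := @RInt_correct R_CompleteNormedModule.
Definition is_RInt_unique_R := @is_RInt_unique R_CompleteNormedModule.
Definition ex_RInt_continuous_R := @ex_RInt_continuous R_CompleteNormedModule.
Definition is_RInt_derive_R := @is_RInt_derive R_CompleteNormedModule.

Lemma continuous_of_is_derive (f : R -> R) (x l : R) :
  is_derive f x l -> continuous f x.
Proof. intros H; apply (@ex_derive_continuous R_AbsRing R_NormedModule); now exists l. Qed.

Lemma continuity_pt_of_is_derive (f : R -> R) (x l : R) :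
  is_derive f x l -> continuity_pt f x.
Proof.
  intros H; apply continuity_pt_filterlim; exact (continuous_of_is_derive f x l H).
Qed.

(** The mean value theorem without [Rmin] and [Rmax]. *)
Lemma mvt (f df : R -> R) (a b : R) :
  a <= b -> (forall y, a <= y <= b -> is_derive f y (df y)) ->
  exists z, a <= z <= b /\ f b - f a = df z * (b - a).
Proof.
  intros Hab D; destruct (MVT_gen f a b df) as [z Hz];
    rewrite Rmin_left, Rmax_right in * by exact Hab.
  - intros y Hy; apply D; lra.
  - intros y Hy; eapply continuity_pt_of_is_derive, D, Hy.
  - now exists z.
Qed.

Lemma lipschitz_of_derive (f df : R -> R) :
  (forall y, is_derive f y (df y)) -> (forall y, Rabs (df y) <= 1) ->
  forall a b, Rabs (f a - f b) <= Rabs (a - b).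
Proof.
  intros D B a b; destruct (MVT_gen f b a df) as [z [_ E]].
  - intros; apply D.
  - intros; eapply continuity_pt_of_is_derive, D.
  - rewrite E, Rabs_mult; assert (H := Rabs_pos (a - b)); assert (H' := B z); nra.
Qed.

Lemma abs_cos_le_1 (t : R) : Rabs (cos t) <= 1.
Proof. apply Rabs_le, COS_bound. Qed.

Lemma abs_sin_le_1 (t : R) : Rabs (sin t) <= 1.
Proof. apply Rabs_le, SIN_bound. Qed.

Lemma sin_cos_sq (t : R) : sin t * sin t + cos t * cos t = 1.
Proof. exact (sin2_cos2 t). Qed.

Lemma cos_lipschitz (a b : R) : Rabs (cos a - cos b) <= Rabs (a - b).
Proof.
  apply (lipschitz_of_derive cos (fun y => - sin y)); intros y; [apply is_derive_cos|].
  rewrite Rabs_Ropp; apply abs_sin_le_1.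
Qed.

Lemma sin_lipschitz (a b : R) : Rabs (sin a - sin b) <= Rabs (a - b).
Proof.
  apply (lipschitz_of_derive sin cos); [apply is_derive_sin|apply abs_cos_le_1].
Qed.

Ltac between :=
  repeat match goal with
  | H : Rabs _ <= _ |- _ => apply Rabs_le_between in H
  | H : Rabs _ < _ |- _ => apply Rabs_lt_between in H
  end.

Lemma is_derive_eq (f : R -> R) (x l l' : R) :
  is_derive f x l' -> l' = l -> is_derive f x l.
Proof. intros H <-; exact H. Qed.

Lemma taylor_quadratic (f f1 f2 : R -> R) (x r h C : R) :
  (forall y, Rabs (y - x) < r -> is_derive f y (f1 y)) ->
  (forall y, Rabs (y - x) < r -> is_derive f1 y (f2 y)) ->
  (forall y, Rabs (y - x) < r -> Rabs (f2 y) <= C) ->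
  Rabs h < r ->
  Rabs (f (x + h) - f x - h * f1 x) <= C * h ^ 2.
Proof.
  intros D1 D2 B Hh.
  assert (near : forall e y, Rabs e < r ->
            Rmin x (x + e) <= y <= Rmax x (x + e) -> Rabs (y - x) <= Rabs e).
  { intros e y _; unfold Rmin, Rmax; destruct (Rle_dec x (x + e)) as [Hle|Hle];
      unfold Rabs; destruct (Rcase_abs (y - x)), (Rcase_abs e); lra. }
  destruct (MVT_gen f x (x + h) f1) as [xi [Hxi E1]].
  { intros y Hy; apply D1; eapply Rle_lt_trans; [apply (near h)|]; auto; lra. }
  { intros y Hy; apply continuity_pt_filterlim.
    apply (continuous_of_is_derive f y (f1 y)), D1.
    eapply Rle_lt_trans; [apply (near h)|]; auto. }
  assert (Hxi' := near h xi Hh Hxi).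
  destruct (MVT_gen f1 x (x + (xi - x)) f2) as [zeta [Hz E2]].
  { intros y Hy; apply D2; eapply Rle_lt_trans; [apply (near (xi - x))|]; auto; lra. }
  { intros y Hy; apply continuity_pt_filterlim.
    apply (continuous_of_is_derive f1 y (f2 y)), D2.
    eapply Rle_lt_trans; [apply (near (xi - x))|]; auto; lra. }
  assert (Hz' := near (xi - x) zeta ltac:(lra) Hz).
  assert (HB := B zeta ltac:(lra)).
  replace (x + (xi - x)) with xi in E2 by ring.
  replace (f (x + h) - f x - h * f1 x) with (f2 zeta * ((xi - x) * h))
    by (replace (x + h - x) with h in E1 by ring; nra).
  rewrite Rabs_mult.
  apply Rmult_le_compat; try apply Rabs_pos; auto.
  rewrite Rabs_mult, <- (pow2_abs h).
  assert (H0 := Rabs_pos h). nra.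
Qed.

(** Differentiation under the integral sign.  A dominated second derivative
    makes the difference quotient converge uniformly, so one-variable
    integrability is enough. *)
Lemma is_derive_RInt_dominated (f f1 f2 : R -> R -> R) (C : R -> R) (a b x r : R) :
  a <= b -> 0 < r ->
  (forall y t, Rabs (y - x) < r -> a <= t <= b ->
     is_derive (fun z => f z t) y (f1 y t)) ->
  (forall y t, Rabs (y - x) < r -> a <= t <= b ->
     is_derive (fun z => f1 z t) y (f2 y t)) ->
  (forall y t, Rabs (y - x) < r -> a <= t <= b -> Rabs (f2 y t) <= C t) ->
  (forall y, Rabs (y - x) < r -> ex_RInt (f y) a b) ->
  ex_RInt (f1 x) a b -> ex_RInt C a b ->
  is_derive (fun y => RInt (f y) a b) x (RInt (f1 x) a b).
Proof.
  intros Hab Hr D1 D2 B If I1 IC.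
  apply is_derive_Reals; intros eps Heps.
  set (K := RInt C a b).
  assert (Hd : 0 < Rmin r (eps / (Rabs K + 1))).
  { apply Rmin_case; [assumption|].
    apply Rdiv_lt_0_compat; [assumption|]. assert (H := Rabs_pos K); lra. }
  exists (mkposreal _ Hd); intros h Hh0 Hh; simpl in Hh.
  assert (Hhr : Rabs h < r) by (eapply Rlt_le_trans; [exact Hh|apply Rmin_l]).
  assert (Hhe : Rabs h < eps / (Rabs K + 1))
    by (eapply Rlt_le_trans; [exact Hh|apply Rmin_r]).
  assert (Ix : ex_RInt (f x) a b)
    by (apply If; replace (x - x) with 0 by ring; rewrite Rabs_R0; exact Hr).
  assert (Ixh : ex_RInt (f (x + h)) a b)
    by (apply If; replace (x + h - x) with h by ring; exact Hhr).
  assert (Hrem : Rabs (RInt (f (x + h)) a b - RInt (f x) a b - h * RInt (f1 x) a b)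
           <= h ^ 2 * K).
  { apply (@norm_RInt_le R_NormedModule
      (fun t => minus (minus (f (x + h) t) (f x t)) (scal h (f1 x t)))
      (fun t => h ^ 2 * C t) a b
      (minus (minus (RInt (f (x + h)) a b) (RInt (f x) a b)) (scal h (RInt (f1 x) a b)))
      (h ^ 2 * K)).
    - exact Hab.
    - intros t Ht.
      change (Rabs ((f (x + h) t - f x t) - h * f1 x t) <= h ^ 2 * C t).
      rewrite (Rmult_comm _ (C t)).
      apply (taylor_quadratic (fun z => f z t) (fun z => f1 z t) (fun z => f2 z t) x r);
        auto.
    - apply @is_RInt_minus; [apply @is_RInt_minus|apply @is_RInt_scal];
        apply RInt_correct_R; assumption.
    - apply (@is_RInt_scal R_NormedModule), RInt_correct_R, IC. }
  replace ((RInt (f (x + h)) a b - RInt (f x) a b) / h - RInt (f1 x) a b)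
    with ((RInt (f (x + h)) a b - RInt (f x) a b - h * RInt (f1 x) a b) / h)
    by (field; exact Hh0).
  unfold Rdiv; rewrite Rabs_mult, Rabs_inv.
  assert (Hpos : 0 < Rabs h) by (apply Rabs_pos_lt; exact Hh0).
  apply (Rmult_lt_reg_r (Rabs h)); [exact Hpos|].
  rewrite Rmult_assoc, Rinv_l, Rmult_1_r by lra.
  eapply Rle_lt_trans; [exact Hrem|].
  rewrite <- (pow2_abs h).
  assert (HK := Rabs_pos K). assert (HK' := Rle_abs K).
  assert (Rabs h * (Rabs K + 1) < eps).
  { apply (Rmult_lt_compat_r (Rabs K + 1)) in Hhe; [|lra].
    unfold Rdiv in Hhe; rewrite Rmult_assoc, Rinv_l in Hhe by lra; lra. }
  nra.
Qed.

(** The generic rules for derivatives produce module operations; these produce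
    real ones, which [ring] and [field] understand. *)
Lemma der_mult (f g : R -> R) (x df dg : R) :
  is_derive f x df -> is_derive g x dg ->
  is_derive (fun y => f y * g y) x (df * g x + f x * dg).
Proof.
  intros Hf Hg; apply is_derive_Reals.
  apply (derivable_pt_lim_mult f g); now apply is_derive_Reals.
Qed.

Lemma der_plus (f g : R -> R) (x df dg : R) :
  is_derive f x df -> is_derive g x dg -> is_derive (fun y => f y + g y) x (df + dg).
Proof.
  intros Hf Hg; apply is_derive_Reals.
  apply (derivable_pt_lim_plus f g); now apply is_derive_Reals.
Qed.

Lemma der_minus (f g : R -> R) (x df dg : R) :
  is_derive f x df -> is_derive g x dg -> is_derive (fun y => f y - g y) x (df - dg).
Proof.
  intros Hf Hg; apply is_derive_Reals.
  apply (derivable_pt_lim_minus f g); now apply is_derive_Reals.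
Qed.

Lemma der_scal (f : R -> R) (c x df : R) :
  is_derive f x df -> is_derive (fun y => c * f y) x (c * df).
Proof.
  intros Hf; apply is_derive_Reals.
  apply (derivable_pt_lim_scal f); now apply is_derive_Reals.
Qed.

Lemma der_id (x : R) : is_derive (fun y => y) x 1.
Proof. apply is_derive_Reals, derivable_pt_lim_id. Qed.

Lemma der_div (f g : R -> R) (x df dg : R) :
  is_derive f x df -> is_derive g x dg -> g x <> 0 ->
  is_derive (fun y => f y / g y) x ((df * g x - dg * f x) / (g x) ^ 2).
Proof.
  intros Hf Hg H; apply is_derive_Reals.
  replace (g x ^ 2) with (Rsqr (g x)) by (unfold Rsqr; ring).
  apply (derivable_pt_lim_div f g); now try apply is_derive_Reals.
Qed.

Lemma der_comp (f g : R -> R) (x df dg : R) :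
  is_derive g x dg -> is_derive f (g x) df -> is_derive (fun y => f (g y)) x (df * dg).
Proof.
  intros Hg Hf; apply is_derive_Reals.
  apply (derivable_pt_lim_comp g f); now apply is_derive_Reals.
Qed.

(** * The exponential integral of Schlaefli's formula *)

(** The integrand of [int_0^oo exp (nu t - x sinh t) dt] in the variable
    [w = exp (- t)].  It vanishes to all orders at [w = 0], so it extends
    continuously by [0] and the integral becomes proper. *)
Definition kern (nu x w : R) : R :=
  if Rlt_dec 0 w then exp (- (nu + 1) * ln w - x / 2 * (/ w - w)) else 0.

Lemma kern_pos (nu x w : R) :
  0 < w -> kern nu x w = exp (- (nu + 1) * ln w - x / 2 * (/ w - w)).
Proof. intros H; unfold kern; destruct (Rlt_dec 0 w); [reflexivity|lra]. Qed.

Lemma kern_npos (nu x w : R) : w <= 0 -> kern nu x w = 0.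
Proof. intros H; unfold kern; destruct (Rlt_dec 0 w); [lra|reflexivity]. Qed.

Lemma kern_ge0 (nu x w : R) : 0 <= kern nu x w.
Proof.
  unfold kern; destruct (Rlt_dec 0 w); [left; apply exp_pos|lra].
Qed.

Lemma kern_shift (nu x w : R) : kern (nu - 1) x w = w * kern nu x w.
Proof.
  destruct (Rlt_dec 0 w) as [H|H].
  - rewrite !kern_pos by assumption.
    transitivity (exp (ln w) * exp (- (nu + 1) * ln w - x / 2 * (/ w - w)));
      [|now rewrite exp_ln].
    rewrite <- exp_plus; f_equal; ring.
  - rewrite !kern_npos by lra; ring.
Qed.

Lemma exp_le (a b : R) : a <= b -> exp a <= exp b.
Proof. intros [H| ->]; [left; now apply exp_increasing|right; reflexivity]. Qed.

Lemma ln_le_sub_1 (z : R) : 0 < z -> ln z <= z - 1.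
Proof. intros H. assert (E := exp_ineq1_le (ln z)). rewrite exp_ln in E; lra. Qed.

(** The factor [exp (- x / (2 w))] beats any power of [w]. *)
Lemma kern_le_linear (nu x : R) :
  0 < x -> exists C, forall w, 0 <= w <= 1 -> kern nu x w <= C * w.
Proof.
  intros Hx.
  set (p := Rabs (nu + 2)); set (e := x / (2 * (p + 1))).
  assert (Hp : 0 <= p) by apply Rabs_pos.
  assert (He : 0 < e) by (apply Rdiv_lt_0_compat; lra).
  exists (exp (x / 2 - p * ln e)); intros w [Hw0 Hw1].
  destruct (Rle_lt_or_eq_dec 0 w Hw0) as [Hw|<-];
    [|rewrite kern_npos by lra; lra].
  rewrite kern_pos by assumption.
  transitivity (exp (x / 2 - p * ln e) * exp (ln w)); [|rewrite exp_ln; lra].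
  rewrite <- exp_plus; apply exp_le.
  assert (Hz : 0 < / w) by now apply Rinv_0_lt_compat.
  assert (L0 : 0 <= - ln w).
  { rewrite <- ln_Rinv by assumption. rewrite <- ln_1.
    apply ln_le; [lra|]. rewrite <- Rinv_1; apply Rinv_le_contravar; lra. }
  assert (L1 : - ln w <= e * / w - 1 - ln e).
  { rewrite <- ln_Rinv by assumption.
    assert (E := ln_le_sub_1 (e * / w) ltac:(now apply Rmult_lt_0_compat)).
    rewrite ln_mult in E by assumption; lra. }
  assert (Q1 : (nu + 2) * - ln w <= p * - ln w)
    by (apply Rmult_le_compat_r; [assumption|apply Rle_abs]).
  assert (Q2 : p * - ln w <= p * (e * / w - 1 - ln e))
    by (apply Rmult_le_compat_l; assumption).
  assert (Q3 : p * e <= x / 2).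
  { unfold e; replace (p * (x / (2 * (p + 1)))) with (x / 2 * (p / (p + 1)))
      by (field; lra).
    assert (p / (p + 1) <= 1) by (apply Rle_div_l; lra). nra. }
  assert (Q4 : p * e * / w <= x / 2 * / w) by (apply Rmult_le_compat_r; lra).
  nra.
Qed.

Lemma locally_lt (a w : R) : a < w -> locally w (fun y => a < y).
Proof. intros H; apply (open_gt a w H). Qed.

Lemma continuous_kern (nu x w : R) : 0 < x -> continuous (kern nu x) w.
Proof.
  intros Hx; destruct (Rtotal_order w 0) as [H|[->|H]].
  - apply continuous_ext_loc with (fun _ => 0); [|apply continuous_const].
    apply (filter_imp (fun y => y < 0)); [|apply (open_lt 0 w H)].
    intros y Hy; now rewrite kern_npos by lra.
  - destruct (kern_le_linear nu x Hx) as [C HC].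
    apply continuity_pt_filterlim; intros eps Heps.
    assert (HK := Rabs_pos C). assert (HK' := Rle_abs C).
    assert (Hd : 0 < Rmin 1 (eps / (Rabs C + 1))).
    { apply Rmin_case; [lra|]; apply Rdiv_lt_0_compat; lra. }
    exists (Rmin 1 (eps / (Rabs C + 1))); split; [exact Hd|].
    intros y [_ Hy]; simpl in *; unfold R_dist in *.
    rewrite (kern_npos nu x 0) by lra; rewrite Rminus_0_r in *.
    rewrite (Rabs_pos_eq (kern nu x y)) by apply kern_ge0.
    destruct (Rle_dec y 0) as [Hy0|Hy0]; [rewrite kern_npos; lra|].
    rewrite Rabs_pos_eq in Hy by lra.
    assert (y < 1) by (eapply Rlt_le_trans; [exact Hy|apply Rmin_l]).
    assert (Hy2 : y < eps / (Rabs C + 1)) by (eapply Rlt_le_trans; [exact Hy|apply Rmin_r]).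
    assert (B := HC y ltac:(lra)).
    apply (Rmult_lt_compat_r (Rabs C + 1)) in Hy2; [|lra].
    unfold Rdiv in Hy2; rewrite Rmult_assoc, Rinv_l in Hy2 by lra. nra.
  - apply continuous_ext_loc
      with (fun y => exp (- (nu + 1) * ln y - x / 2 * (/ y - y))).
    { apply (filter_imp (fun y => 0 < y)); [|now apply locally_lt].
      intros y Hy; now rewrite kern_pos. }
    apply (@ex_derive_continuous R_AbsRing R_NormedModule).
    auto_derive; repeat split; lra.
Qed.

Lemma ex_RInt_kern (nu x a b : R) : 0 < x -> ex_RInt (kern nu x) a b.
Proof. intros H; apply ex_RInt_continuous_R; intros; now apply continuous_kern. Qed.

Lemma is_derive_kern_x (nu x w : R) :
  is_derive (fun z => kern nu z w) x (- (kern (nu + 1) x w - kern (nu - 1) x w) / 2).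
Proof.
  destruct (Rlt_dec 0 w) as [H|H].
  - apply is_derive_ext with (fun z => exp (- (nu + 1) * ln w - z / 2 * (/ w - w))).
    { intros z; now rewrite kern_pos. }
    rewrite kern_shift.
    replace (kern (nu + 1) x w) with (kern nu x w / w)
      by (replace nu with (nu + 1 - 1) at 1 by ring; rewrite kern_shift; field; lra).
    rewrite kern_pos by assumption.
    auto_derive; [trivial|unfold Rminus, Rdiv; field; lra].
  - apply is_derive_ext with (fun _ => 0).
    { intros z; now rewrite kern_npos by lra. }
    rewrite !kern_npos by lra. auto_derive; [trivial|lra].
Qed.

(** [kern (nu - 1) x w], which is [w * kern nu x w], is a primitive of the
    integrand of [F_recurrence]; its flatness covers the endpoint [0]. *)
Lemma is_derive_kern_w (nu x w : R) : 0 < x ->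
  is_derive (kern (nu - 1) x) w
    (x / 2 * (kern (nu + 1) x w + kern (nu - 1) x w) - nu * kern nu x w).
Proof.
  intros Hx; destruct (Rtotal_order w 0) as [H|[->|H]].
  - apply is_derive_ext_loc with (fun _ => 0).
    { apply (filter_imp (fun y => y < 0)); [|apply (open_lt 0 w H)].
      intros y Hy; now rewrite kern_npos by lra. }
    rewrite !kern_npos by lra. auto_derive; [trivial|lra].
  - rewrite !kern_npos by lra.
    apply is_derive_Reals; intros eps Heps.
    assert (Hc := continuous_kern nu x 0 Hx).
    apply continuity_pt_filterlim in Hc.
    destruct (Hc eps Heps) as [d [Hd Hlim]].
    exists (mkposreal d Hd); intros h Hh Hhd; simpl in Hhd.
    rewrite Rplus_0_l, !kern_shift, Rmult_0_l.
    replace ((h * kern nu x h - 0) / h - (x / 2 * (0 + 0) - nu * 0))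
      with (kern nu x h - kern nu x 0) by (rewrite (kern_npos _ _ 0) by lra; field; auto).
    apply Hlim; split.
    + split; [exact I|auto].
    + simpl; unfold R_dist; now rewrite Rminus_0_r.
  - apply is_derive_ext_loc
      with (fun y => exp (- nu * ln y - x / 2 * (/ y - y))).
    { apply (filter_imp (fun y => 0 < y)); [|now apply locally_lt].
      intros y Hy; rewrite kern_pos by assumption; do 2 f_equal; ring. }
    assert (E1 : kern nu x w = kern (nu - 1) x w / w)
      by (rewrite kern_shift; field; lra).
    assert (E2 : kern (nu + 1) x w = kern nu x w / w)
      by (replace nu with (nu + 1 - 1) at 2 by ring; rewrite kern_shift; field; lra).
    rewrite E2, E1, kern_pos by assumption.
    replace (- (nu - 1 + 1)) with (- nu) by ring.
    auto_derive; [repeat split; lra|].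
    unfold Rminus, Rdiv; field; lra.
Qed.

(** Equal to [int_0^oo exp (nu t - x sinh t) dt]. *)
Definition F (nu x : R) : R := RInt (kern nu x) 0 1.

Lemma F_ge0 (nu x : R) : 0 < x -> 0 <= F nu x.
Proof.
  intros H; apply RInt_ge_0; [lra|now apply ex_RInt_kern|].
  intros; apply kern_ge0.
Qed.

Lemma kern_antitone_x (nu x y w : R) :
  w <= 1 -> x <= y -> kern nu y w <= kern nu x w.
Proof.
  intros Hw Hxy; destruct (Rlt_dec 0 w) as [H|H];
    [|rewrite !kern_npos by lra; lra].
  rewrite !kern_pos by assumption; apply exp_le.
  assert (1 <= / w) by (rewrite <- Rinv_1; apply Rinv_le_contravar; lra).
  nra.
Qed.

Lemma F_antitone_x (nu x y : R) : 0 < x -> x <= y -> F nu y <= F nu x.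
Proof.
  intros Hx Hxy; apply RInt_le; try apply ex_RInt_kern; try lra.
  intros; apply kern_antitone_x; lra.
Qed.

Lemma F_monotone_nu (nu x : R) : 0 < x -> F (nu - 1) x <= F nu x.
Proof.
  intros Hx; apply RInt_le; try apply ex_RInt_kern; try lra.
  intros w Hw; rewrite kern_shift.
  assert (H := kern_ge0 nu x w). nra.
Qed.

Lemma F_recurrence (nu x : R) : 0 < x ->
  x / 2 * (F (nu + 1) x + F (nu - 1) x) = 1 + nu * F nu x.
Proof.
  intros Hx.
  assert (I1 : is_RInt (fun w => x / 2 * (kern (nu + 1) x w + kern (nu - 1) x w)
                                 - nu * kern nu x w) 0 1
                 (x / 2 * (F (nu + 1) x + F (nu - 1) x) - nu * F nu x)).
  { apply @is_RInt_minus; apply @is_RInt_scal; [apply @is_RInt_plus|];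
      apply RInt_correct_R; now apply ex_RInt_kern. }
  assert (I2 : is_RInt (fun w => x / 2 * (kern (nu + 1) x w + kern (nu - 1) x w)
                                 - nu * kern nu x w) 0 1
                 (minus (kern (nu - 1) x 1) (kern (nu - 1) x 0))).
  { apply is_RInt_derive_R.
    - intros w _; now apply is_derive_kern_w.
    - intros w _. apply (@continuous_minus R_UniformSpace R_AbsRing R_NormedModule);
        apply (@continuous_scal_r R_UniformSpace R_AbsRing R_NormedModule);
        [apply (@continuous_plus R_UniformSpace R_AbsRing R_NormedModule)|];
        now apply continuous_kern. }
  apply is_RInt_unique_R in I1.
  apply is_RInt_unique_R in I2.
  rewrite I1 in I2.
  assert (E : minus (kern (nu - 1) x 1) (kern (nu - 1) x 0) = 1).
  { rewrite (kern_npos _ _ 0), kern_pos by lra.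
    unfold minus, plus, opp; simpl. rewrite ln_1, Rinv_1.
    replace (- (nu - 1 + 1) * 0 - x / 2 * (1 - 1)) with 0 by ring.
    rewrite exp_0; ring. }
  rewrite E in I2; lra.
Qed.

Lemma is_derive_F (nu x : R) : 0 < x ->
  is_derive (F nu) x (- (F (nu + 1) x - F (nu - 1) x) / 2).
Proof.
  intros Hx.
  set (k1 := fun y w => - (kern (nu + 1) y w - kern (nu - 1) y w) / 2).
  set (k2 := fun y w => - (- (kern (nu + 1 + 1) y w - kern (nu + 1 - 1) y w) / 2
                         - - (kern (nu - 1 + 1) y w - kern (nu - 1 - 1) y w) / 2) / 2).
  assert (I1 : is_RInt (k1 x) 0 1 (- (F (nu + 1) x - F (nu - 1) x) / 2)).
  { apply is_RInt_ext with (fun w => (- / 2) * (kern (nu + 1) x w - kern (nu - 1) x w)).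
    { intros w _; unfold k1; simpl; field. }
    replace (- (F (nu + 1) x - F (nu - 1) x) / 2)
      with ((- / 2) * (F (nu + 1) x - F (nu - 1) x)) by field.
    apply @is_RInt_scal, @is_RInt_minus;
      apply RInt_correct_R; now apply ex_RInt_kern. }
  rewrite <- (is_RInt_unique_R _ _ _ _ I1).
  apply (is_derive_RInt_dominated (kern nu) k1 k2
    (fun w => (kern (nu + 1 + 1) (x / 2) w + kern (nu + 1 - 1) (x / 2) w)
              + (kern (nu - 1 + 1) (x / 2) w + kern (nu - 1 - 1) (x / 2) w)) 0 1 x (x / 2));
    try lra.
  - intros; apply is_derive_kern_x.
  - intros y w _ _; unfold k1, k2.
    apply is_derive_ext with (fun z => (- / 2) * (kern (nu + 1) z w - kern (nu - 1) z w)).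
    { intros z; simpl; field. }
    eapply is_derive_eq.
    + apply @is_derive_scal, @is_derive_minus; apply is_derive_kern_x.
    + unfold minus, plus, opp, scal; simpl; unfold mult; simpl; field.
  - intros y w Hy Hw; unfold k2.
    assert (Hy' : x / 2 <= y) by (apply Rabs_lt_between in Hy; lra).
    assert (P := fun n => kern_ge0 n y w).
    assert (Q := fun n => kern_antitone_x n (x / 2) y w ltac:(lra) Hy').
    assert (P1 := P (nu + 1 + 1)). assert (P2 := P (nu + 1 - 1)).
    assert (P3 := P (nu - 1 + 1)). assert (P4 := P (nu - 1 - 1)).
    assert (Q1 := Q (nu + 1 + 1)). assert (Q2 := Q (nu + 1 - 1)).
    assert (Q3 := Q (nu - 1 + 1)). assert (Q4 := Q (nu - 1 - 1)).
    apply Rabs_le; lra.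
  - intros y Hy; apply ex_RInt_kern; apply Rabs_lt_between in Hy; lra.
  - now exists (- (F (nu + 1) x - F (nu - 1) x) / 2).
  - apply @ex_RInt_plus; apply @ex_RInt_plus; apply ex_RInt_kern; lra.
Qed.

(** * Schlaefli's integral as a family of cylinder functions *)

(** The oscillatory integral over [[0, PI]], centred at its stationary point;
    the odd part of the integrand has been dropped, whence the factor [2]. *)
Definition osc (a nu x : R) : R :=
  2 * RInt (fun t => cos (x * cos t - a) * cos (nu * t)) 0 (PI / 2).

Ltac cont_auto :=
  intros; apply (@ex_derive_continuous R_AbsRing R_NormedModule); auto_derive; trivial.

Lemma ex_RInt_osc (a nu x : R) :
  ex_RInt (fun t => cos (x * cos t - a) * cos (nu * t)) 0 (PI / 2).
Proof. apply ex_RInt_continuous_R; cont_auto. Qed.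

Lemma osc_lin (a b nu x : R) :
  osc (a + b) nu x = cos b * osc a nu x + sin b * osc (a + PI / 2) nu x.
Proof.
  unfold osc.
  assert (I : is_RInt (fun t => cos b * (cos (x * cos t - a) * cos (nu * t))
                + sin b * (cos (x * cos t - (a + PI / 2)) * cos (nu * t))) 0 (PI / 2)
     (cos b * RInt (fun t => cos (x * cos t - a) * cos (nu * t)) 0 (PI / 2)
      + sin b * RInt (fun t => cos (x * cos t - (a + PI / 2)) * cos (nu * t)) 0 (PI / 2))).
  { apply @is_RInt_plus; apply @is_RInt_scal;
      apply RInt_correct_R, ex_RInt_osc. }
  apply is_RInt_unique_R in I.
  assert (E : RInt (fun t => cos (x * cos t - (a + b)) * cos (nu * t)) 0 (PI / 2)
     = cos b * RInt (fun t => cos (x * cos t - a) * cos (nu * t)) 0 (PI / 2)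
      + sin b * RInt (fun t => cos (x * cos t - (a + PI / 2)) * cos (nu * t)) 0 (PI / 2)).
  { rewrite <- I; apply RInt_ext; intros t _.
    replace (x * cos t - (a + b)) with (x * cos t - a - b) by ring.
    replace (x * cos t - (a + PI / 2)) with (x * cos t - a - PI / 2) by ring.
    rewrite (cos_minus _ b), (cos_minus _ (PI / 2)), cos_PI2, sin_PI2; simpl; ring. }
  rewrite E; ring.
Qed.

Lemma osc_PI (a nu x : R) : osc (a + PI) nu x = - osc a nu x.
Proof. rewrite osc_lin, cos_PI, sin_PI; ring. Qed.

Lemma osc_even (a nu x : R) : osc a (- nu) x = osc a nu x.
Proof.
  unfold osc; f_equal; apply RInt_ext; intros t _.
  replace (- nu * t) with (- (nu * t)) by ring; now rewrite cos_neg.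
Qed.

Lemma is_derive_osc (a nu x : R) :
  is_derive (osc a nu) x ((osc (a - PI / 2) (nu + 1) x + osc (a - PI / 2) (nu - 1) x) / 2).
Proof.
  assert (HPI := PI_RGT_0).
  set (f := fun y t => cos (y * cos t - a) * cos (nu * t)).
  set (f1 := fun y t => - cos t * sin (y * cos t - a) * cos (nu * t)).
  set (f2 := fun y t => - cos t * cos t * cos (y * cos t - a) * cos (nu * t)).
  assert (D : is_derive (fun y => RInt (f y) 0 (PI / 2)) x (RInt (f1 x) 0 (PI / 2))).
  { apply (is_derive_RInt_dominated f f1 f2 (fun _ => 1) 0 (PI / 2) x 1); try lra.
    - intros; unfold f, f1; auto_derive; [trivial|unfold Rminus; ring].
    - intros; unfold f1, f2; auto_derive; [trivial|unfold Rminus; ring].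
    - intros y t _ _; unfold f2.
      rewrite !Rabs_mult, Rabs_Ropp.
      assert (B : forall u, 0 <= Rabs (cos u) <= 1)
        by (intros u; split; [apply Rabs_pos|apply Rabs_le, COS_bound]).
      assert (B1 := B t). assert (B2 := B (y * cos t - a)). assert (B3 := B (nu * t)).
      rewrite <- (Rmult_1_r 1); apply Rmult_le_compat; try lra.
      + repeat apply Rmult_le_pos; lra.
      + rewrite <- (Rmult_1_r 1); apply Rmult_le_compat; try lra; [nra|nra].
    - intros; apply ex_RInt_osc.
    - apply ex_RInt_continuous_R; unfold f1; cont_auto.
    - apply @ex_RInt_const. }
  unfold osc at 1.
  eapply is_derive_eq; [apply @is_derive_scal; exact D|].
  unfold scal; simpl; unfold mult; simpl.
  assert (I : is_RInt (f1 x) 0 (PI / 2)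
    (/ 2 * (RInt (fun t => cos (x * cos t - (a - PI / 2)) * cos ((nu + 1) * t)) 0 (PI / 2)
     + RInt (fun t => cos (x * cos t - (a - PI / 2)) * cos ((nu - 1) * t)) 0 (PI / 2)))).
  { apply is_RInt_ext with (fun t => / 2 * (cos (x * cos t - (a - PI / 2)) * cos ((nu + 1) * t)
       + cos (x * cos t - (a - PI / 2)) * cos ((nu - 1) * t))).
    { intros t _; unfold f1.
      replace (x * cos t - (a - PI / 2)) with (x * cos t - a + PI / 2) by ring.
      replace ((nu + 1) * t) with (nu * t + t) by ring.
      replace ((nu - 1) * t) with (nu * t - t) by ring.
      rewrite (cos_plus (x * cos t - a)), cos_PI2, sin_PI2, (cos_plus (nu * t)), (cos_minus (nu * t)).
      simpl; field. }
    apply @is_RInt_scal, @is_RInt_plus;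
      apply RInt_correct_R, ex_RInt_osc. }
  rewrite (is_RInt_unique_R _ _ _ _ I).
  unfold osc; field.
Qed.

(** From the derivative of [sin (x * cos t - a) * sin (nu * t)], whose boundary
    term at [PI / 2] cancels the constants of [F_recurrence] in [cyl_recurrence]. *)
Lemma osc_recurrence (a nu x : R) :
  x * (osc a (nu - 1) x - osc a (nu + 1) x)
  = 4 * sin a * sin (nu * (PI / 2)) + 2 * nu * osc (a + PI / 2) nu x.
Proof.
  set (S1 := RInt (fun t => cos (x * cos t - a) * cos ((nu - 1) * t)) 0 (PI / 2)).
  set (S2 := RInt (fun t => cos (x * cos t - a) * cos ((nu + 1) * t)) 0 (PI / 2)).
  set (S3 := RInt (fun t => cos (x * cos t - (a + PI / 2)) * cos (nu * t)) 0 (PI / 2)).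
  set (h := fun t => (- (x / 2)) * (cos (x * cos t - a) * cos ((nu - 1) * t)
                          - cos (x * cos t - a) * cos ((nu + 1) * t))
            + nu * (cos (x * cos t - (a + PI / 2)) * cos (nu * t))).
  assert (I1 : is_RInt h 0 (PI / 2) (- (x / 2) * (S1 - S2) + nu * S3)).
  { apply @is_RInt_plus; apply @is_RInt_scal; [apply @is_RInt_minus|];
      apply RInt_correct_R, ex_RInt_osc. }
  assert (I2 : is_RInt h 0 (PI / 2)
     (minus (sin (x * cos (PI / 2) - a) * sin (nu * (PI / 2)))
            (sin (x * cos 0 - a) * sin (nu * 0)))).
  { apply (@is_RInt_derive R_CompleteNormedModule
             (fun t => sin (x * cos t - a) * sin (nu * t))).
    - intros t _; auto_derive; [trivial|]; unfold h.
      replace (x * cos t - (a + PI / 2)) with (x * cos t - a - PI / 2) by ring.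
      replace ((nu + 1) * t) with (nu * t + t) by ring.
      replace ((nu - 1) * t) with (nu * t - t) by ring.
      rewrite (cos_minus (x * cos t - a) (PI / 2)), cos_PI2, sin_PI2, (cos_plus (nu * t)), (cos_minus (nu * t)).
      unfold Rminus; field.
    - unfold h; cont_auto. }
  apply is_RInt_unique_R in I1.
  apply is_RInt_unique_R in I2.
  rewrite I1 in I2.
  unfold minus, plus, opp in I2; simpl in I2.
  rewrite cos_PI2, Rmult_0_r, Rmult_0_r, sin_0, Rmult_0_r in I2.
  replace (0 - a) with (- a) in I2 by ring; rewrite sin_neg in I2.
  unfold osc; fold S1 S2 S3. lra.
Qed.

(** [PI] times the real part of [exp (- i b) (J + i Y)]: the angle [b] treats
    [J] (for [b = 0]) and [Y] (for [b = PI / 2]) at once. *)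
Definition cyl (b nu x : R) : R :=
  osc (b + nu * (PI / 2)) nu x - sin b * F nu x - sin (nu * PI + b) * F (- nu) x.

Lemma cyl_recurrence (b nu x : R) : 0 < x ->
  cyl b (nu - 1) x + cyl b (nu + 1) x = 2 * nu / x * cyl b nu x.
Proof.
  intros Hx; unfold cyl.
  set (a := b + nu * (PI / 2)).
  replace (b + (nu + 1) * (PI / 2)) with (a - PI / 2 + PI) by (unfold a; field).
  replace (b + (nu - 1) * (PI / 2)) with (a - PI / 2) by (unfold a; field).
  rewrite osc_PI.
  replace ((nu - 1) * PI + b) with (nu * PI + b - PI) by ring.
  replace ((nu + 1) * PI + b) with (nu * PI + b + PI) by ring.
  rewrite (sin_minus (nu * PI + b) PI), (sin_plus (nu * PI + b) PI), cos_PI, sin_PI.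
  replace (- (nu - 1)) with (- nu + 1) by ring.
  replace (- (nu + 1)) with (- nu - 1) by ring.
  assert (E1 := osc_recurrence (a - PI / 2) nu x).
  replace (a - PI / 2 + PI / 2) with a in E1 by ring.
  assert (E2 := F_recurrence nu x Hx). assert (E3 := F_recurrence (- nu) x Hx).
  assert (T : 4 * sin (a - PI / 2) * sin (nu * (PI / 2)) - 2 * sin b + 2 * sin (nu * PI + b) = 0).
  { replace (a - PI / 2) with (- (PI / 2 - a)) by ring; rewrite sin_neg, sin_shift.
    replace (nu * PI + b) with (a + nu * (PI / 2)) by (unfold a; field).
    replace (sin b) with (sin (a - nu * (PI / 2))) by (f_equal; unfold a; ring).
    rewrite sin_plus, sin_minus; ring. }
  apply (Rmult_eq_reg_l x); [|lra].
  set (o1 := osc (a - PI / 2) (nu - 1) x) in *.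
  set (o2 := osc (a - PI / 2) (nu + 1) x) in *.
  transitivity (x * (o1 - o2) - 2 * sin b * (x / 2 * (F (nu + 1) x + F (nu - 1) x))
     + 2 * sin (nu * PI + b) * (x / 2 * (F (- nu + 1) x + F (- nu - 1) x))); [field|].
  rewrite E1, E2, E3.
  transitivity ((4 * sin (a - PI / 2) * sin (nu * (PI / 2)) - 2 * sin b + 2 * sin (nu * PI + b))
    + 2 * nu * (osc a nu x - sin b * F nu x - sin (nu * PI + b) * F (- nu) x)); [ring|].
  rewrite T; field; lra.
Qed.

Lemma is_derive_cyl_half (b nu x : R) : 0 < x ->
  is_derive (cyl b nu) x ((cyl b (nu - 1) x - cyl b (nu + 1) x) / 2).
Proof.
  intros Hx; unfold cyl at 1.
  set (a := b + nu * (PI / 2)).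
  eapply is_derive_eq.
  - apply @is_derive_minus; [apply @is_derive_minus|].
    + apply is_derive_osc.
    + apply @is_derive_scal, is_derive_F, Hx.
    + apply @is_derive_scal, is_derive_F, Hx.
  - unfold cyl.
    replace (b + (nu + 1) * (PI / 2)) with (a - PI / 2 + PI) by (unfold a; field).
    replace (b + (nu - 1) * (PI / 2)) with (a - PI / 2) by (unfold a; field).
    rewrite osc_PI.
    replace ((nu - 1) * PI + b) with (nu * PI + b - PI) by ring.
    replace ((nu + 1) * PI + b) with (nu * PI + b + PI) by ring.
    rewrite (sin_minus (nu * PI + b) PI), (sin_plus (nu * PI + b) PI), cos_PI, sin_PI.
    replace (- (nu - 1)) with (- nu + 1) by ring.
    replace (- (nu + 1)) with (- nu - 1) by ring.
    unfold minus, plus, opp, scal; simpl; unfold mult; simpl; field.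
Qed.

Lemma cyl_lin (b nu x : R) :
  cyl b nu x = cos b * cyl 0 nu x + sin b * cyl (PI / 2) nu x.
Proof.
  unfold cyl.
  replace (b + nu * (PI / 2)) with (0 + nu * (PI / 2) + b) by ring.
  replace (PI / 2 + nu * (PI / 2)) with (0 + nu * (PI / 2) + PI / 2) by ring.
  rewrite osc_lin, !(sin_plus (nu * PI)), sin_0, sin_PI2, cos_0, cos_PI2; ring.
Qed.

Lemma cyl_reflection (b nu x : R) : cyl b (- nu) x = cyl (b - nu * PI) nu x.
Proof.
  unfold cyl; rewrite osc_even, Ropp_involutive.
  replace (b + - nu * (PI / 2)) with (b - nu * PI + nu * (PI / 2)) by field.
  replace (- nu * PI + b) with (b - nu * PI) by ring.
  replace (nu * PI + (b - nu * PI)) with b by ring. ring.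
Qed.

(** * Limits at infinity *)

Lemma is_lim_eventually (f : R -> R) (l e : R) :
  is_lim f p_infty l -> 0 < e -> exists X, forall y, X < y -> Rabs (f y - l) < e.
Proof.
  intros H He; apply is_lim_spec in H; exact (H (mkposreal e He)).
Qed.

Lemma is_lim_0_of_le (f g : R -> R) :
  Rbar_locally p_infty (fun y => Rabs (f y) <= g y) -> is_lim g p_infty 0 -> is_lim f p_infty 0.
Proof.
  intros H Hg.
  apply (is_lim_le_le_loc (fun y => - g y) g f p_infty 0).
  - apply (filter_imp (fun y => Rabs (f y) <= g y)); [|exact H].
    intros y Hy; now apply Rabs_le_between.
  - assert (L := is_lim_opp g p_infty 0 Hg); simpl in L; now rewrite Ropp_0 in L.
  - exact Hg.
Qed.

Lemma is_lim_bounded_mult (b f : R -> R) (M : R) :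
  (forall y, Rabs (b y) <= M) -> is_lim f p_infty 0 -> is_lim (fun y => b y * f y) p_infty 0.
Proof.
  intros Hb Hf.
  apply is_lim_0_of_le with (fun y => M * Rabs (f y)).
  - exists 0; intros y _; rewrite Rabs_mult; apply Rmult_le_compat_r; [apply Rabs_pos|apply Hb].
  - assert (L := is_lim_comp_continuous f Rabs p_infty 0 Hf (continuous_Rabs 0)); rewrite Rabs_R0 in L.
    assert (L' := is_lim_scal_l _ M p_infty 0 L); simpl in L'; now rewrite Rmult_0_r in L'.
Qed.

Lemma is_lim_mult_fin (f g : R -> R) (a b : R) :
  is_lim f p_infty a -> is_lim g p_infty b -> is_lim (fun y => f y * g y) p_infty (a * b).
Proof. intros Hf Hg; exact (is_lim_mult f g p_infty a b Hf Hg I). Qed.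

Lemma is_lim_div_fin (f g : R -> R) (a b : R) : b <> 0 ->
  is_lim f p_infty a -> is_lim g p_infty b -> is_lim (fun y => f y / g y) p_infty (a / b).
Proof.
  intros Hb Hf Hg; apply is_lim_mult_fin; [exact Hf|].
  apply (is_lim_inv g p_infty b Hg); intros E; apply Hb; exact (f_equal real E).
Qed.

Lemma is_lim_inv_infty : is_lim (fun y => / y) p_infty 0.
Proof. apply (is_lim_inv (fun y => y) p_infty p_infty); [apply is_lim_id|discriminate]. Qed.

(** A limit at infinity is a value at [0] in the variable [/ y]. *)
Lemma is_lim_of_inv (f Phi : R -> R) (X : R) :
  continuity_pt Phi 0 -> (forall y, X < y -> f y = Phi (/ y)) -> is_lim f p_infty (Phi 0).
Proof.
  intros Hc E.
  apply is_lim_ext_loc with (fun y => Phi (/ y)).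
  - exists X; intros y Hy; symmetry; now apply E.
  - apply (is_lim_comp_continuous (fun y => / y) Phi p_infty 0); [apply is_lim_inv_infty|].
    now apply continuity_pt_filterlim.
Qed.

Lemma is_lim_0_mult (f g : R -> R) :
  is_lim f p_infty 0 -> is_lim g p_infty 0 -> is_lim (fun y => f y * g y) p_infty 0.
Proof. intros Hf Hg; rewrite <- (Rmult_0_r 0); now apply is_lim_mult_fin. Qed.

Lemma is_lim_0_plus (f g : R -> R) :
  is_lim f p_infty 0 -> is_lim g p_infty 0 -> is_lim (fun y => f y + g y) p_infty 0.
Proof. intros Hf Hg; rewrite <- (Rplus_0_r 0); now apply is_lim_plus'. Qed.

Lemma is_lim_0_scal (c : R) (f : R -> R) :
  is_lim f p_infty 0 -> is_lim (fun y => c * f y) p_infty 0.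
Proof. intros Hf; apply (is_lim_bounded_mult (fun _ => c) f (Rabs c)); [intros; lra|exact Hf]. Qed.

Lemma eq_of_lim (c l : R) (f : R -> R) :
  (forall y, 0 < y -> c = f y) -> is_lim f p_infty l -> c = l.
Proof.
  intros E H.
  assert (H' : is_lim (fun _ => c) p_infty l).
  { apply (is_lim_ext_loc f); [|exact H]. exists 0; intros y Hy; symmetry; now apply E. }
  apply is_lim_unique in H'; rewrite Lim_const in H'. exact (f_equal real H').
Qed.

Lemma is_lim_inv_sqrt (K : R) : is_lim (fun y => K / sqrt y) p_infty 0.
Proof.
  apply is_lim_0_scal, (is_lim_inv sqrt p_infty p_infty); [|discriminate].
  apply is_lim_spec; intros M; exists (Rmax 0 M * Rmax 0 M); intros y Hy.
  assert (H0 := Rmax_l 0 M). assert (H1 := Rmax_r 0 M).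
  apply Rle_lt_trans with (Rmax 0 M); [exact H1|].
  rewrite <- (sqrt_square (Rmax 0 M)) at 1 by exact H0.
  apply sqrt_lt_1; nra.
Qed.

(** * Stationary phase *)
Lemma abs_sin_le (y : R) : Rabs (sin y) <= Rabs y.
Proof. assert (H := sin_lipschitz y 0); now rewrite sin_0, !Rminus_0_r in H. Qed.

Lemma mul_cos_le_sin (u : R) : 0 <= u <= PI -> u * cos u <= sin u.
Proof.
  intros Hu.
  destruct (mvt (fun t => sin t - t * cos t) (fun t => t * sin t) 0 u) as [z [Hz E]]; [lra| |].
  - intros; auto_derive; [trivial|ring].
  - rewrite sin_0 in E.
    assert (0 <= sin z) by (apply sin_ge_0; lra).
    assert (0 <= z * sin z * (u - 0)) by (repeat apply Rmult_le_pos; lra). lra.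
Qed.

(** From [sin t = 2 sin (t / 2) cos (t / 2) >= t * cos (t / 2) ^ 2]. *)
Lemma half_le_sin (t : R) : 0 <= t <= PI / 2 -> t / 2 <= sin t.
Proof.
  intros Ht; assert (HPI := PI_RGT_0).
  assert (H := mul_cos_le_sin (t / 2) ltac:(lra)).
  assert (C1 : 0 <= cos (t / 2)) by (apply cos_ge_0; lra).
  assert (C2 : 0 <= cos t) by (apply cos_ge_0; lra).
  assert (E1 : sin t = 2 * sin (t / 2) * cos (t / 2))
    by (rewrite <- sin_2a; f_equal; field).
  assert (E2 : cos t = 2 * (cos (t / 2) * cos (t / 2)) - 1)
    by (replace t with (2 * (t / 2)) at 1 by field; rewrite cos_2a_cos; ring).
  nra.
Qed.

Lemma abs_cos_sub_le (p q t : R) : 0 <= t <= PI / 2 ->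
  Rabs (cos (p * t) - cos (q * t)) <= 4 * (p ^ 2 + q ^ 2) * sin t ^ 2.
Proof.
  intros Ht; assert (H := half_le_sin t Ht).
  rewrite form2, Rabs_mult, Rabs_mult, (Rabs_left (-2)) by lra.
  assert (B1 := abs_sin_le ((p * t - q * t) / 2)).
  assert (B2 := abs_sin_le ((p * t + q * t) / 2)).
  assert (E : Rabs ((p * t - q * t) / 2) * Rabs ((p * t + q * t) / 2) <= (p ^ 2 + q ^ 2) * (t / 2) ^ 2).
  { rewrite <- Rabs_mult; apply Rabs_le; nra. }
  assert (P1 := Rabs_pos (sin ((p * t - q * t) / 2))).
  assert (P2 := Rabs_pos (sin ((p * t + q * t) / 2))).
  assert (M := Rmult_le_compat _ _ _ _ P1 P2 B1 B2).
  assert (Q : (t / 2) ^ 2 <= sin t ^ 2) by (apply pow_incr; lra).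
  assert (0 <= p ^ 2 + q ^ 2) by nra. nra.
Qed.

Lemma abs_sin_sub_le (p q t : R) : 0 <= t <= PI / 2 ->
  Rabs (- p * sin (p * t) + q * sin (q * t)) <= 4 * (p ^ 2 + q ^ 2) * sin t.
Proof.
  intros Ht; assert (H := half_le_sin t Ht).
  eapply Rle_trans; [apply Rabs_triang|].
  rewrite !Rabs_mult, Rabs_Ropp.
  assert (B : forall m, Rabs m * Rabs (sin (m * t)) <= 2 * m ^ 2 * sin t).
  { intros m; assert (B := abs_sin_le (m * t)); rewrite Rabs_mult, (Rabs_pos_eq t) in B by lra.
    assert (P := Rabs_pos m). rewrite <- (pow2_abs m).
    assert (Rabs m * Rabs (sin (m * t)) <= Rabs m * (Rabs m * t))
      by (apply Rmult_le_compat_l; assumption).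
    assert (Rabs m ^ 2 * t <= Rabs m ^ 2 * (2 * sin t))
      by (apply Rmult_le_compat_l; [apply pow2_ge_0|lra]). nra. }
  assert (B1 := B p). assert (B2 := B q). assert (0 <= sin t) by lra.
  assert (0 <= (p ^ 2 + q ^ 2) * sin t) by (apply Rmult_le_pos; nra). nra.
Qed.

(** The stationary point [t = 0] contributes the same amount for every order,
    because [cos (p t) - cos (q t)] vanishes there to second order.  The
    division by [sin t] that integration by parts calls for is smoothed to
    [sin t / (sin t ^ 2 + 1 / x)]. *)
Lemma osc_sub_le (a p q x : R) : 0 < x ->
  Rabs (osc a p x - osc a q x) <= 4 * (1 + 3 * PI) * (4 * (p ^ 2 + q ^ 2)) / x.
Proof.
  intros Hx; assert (HPI := PI_RGT_0).
  set (K := 4 * (p ^ 2 + q ^ 2)).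
  assert (HK : 0 <= K) by (unfold K; nra).
  set (e := / x). assert (He : 0 < e) by now apply Rinv_0_lt_compat.
  set (h := fun t => cos (p * t) - cos (q * t)).
  set (h' := fun t => - p * sin (p * t) + q * sin (q * t)).
  set (D := fun t => sin t ^ 2 + e).
  assert (HD : forall t, 0 < D t) by (intros t; unfold D; assert (B := pow2_ge_0 (sin t)); lra).
  set (g := fun t => h t * sin t / D t).
  set (g' := fun t => h' t * sin t / D t + h t * cos t * (e - sin t ^ 2) / D t ^ 2).
  set (G := fun t => - (e * sin (x * cos t - a) * g t)).
  set (T := fun t => cos (x * cos t - a) * h t * e / D t + e * sin (x * cos t - a) * g' t).
  assert (Ic : forall m, is_RInt (fun t => cos (x * cos t - a) * cos (m * t)) 0 (PI / 2)
                 (RInt (fun t => cos (x * cos t - a) * cos (m * t)) 0 (PI / 2)))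
    by (intros m; apply RInt_correct_R, ex_RInt_osc).
  assert (dG : forall t, is_derive G t (cos (x * cos t - a) * h t - T t)).
  { intros t; unfold G, g, h, T, g', h'.
    assert (HDt := HD t); unfold D in *.
    auto_derive; [simpl in HDt; lra|].
    assert (Ex : x * e = 1) by (unfold e; field; lra).
    unfold h, Rminus.
    set (A := sin (x * cos t + - a)). set (B := cos (x * cos t + - a)).
    replace (e * (x * (1 * - sin t) * B)) with (x * e * (- sin t * B)) by ring.
    rewrite Ex; field; simpl in HDt; lra. }
  assert (cT : forall t, continuous T t).
  { intros t; unfold T, g', h, h'; apply (@ex_derive_continuous R_AbsRing R_NormedModule).
    assert (HDt := HD t); unfold D in *; simpl in HDt.
    auto_derive; repeat split; simpl; try lra. apply Rmult_integral_contrapositive_currified; lra. }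
  assert (IG : is_RInt (fun t => cos (x * cos t - a) * h t - T t) 0 (PI / 2)
                 (minus (G (PI / 2)) (G 0))).
  { apply is_RInt_derive_R.
    - intros t _; apply dG.
    - intros t _.
      apply (@continuous_minus R_UniformSpace R_AbsRing R_NormedModule); [|apply cT].
      unfold h; cont_auto. }
  assert (IT : ex_RInt T 0 (PI / 2))
    by (apply ex_RInt_continuous_R; intros; apply cT).
  set (VT := RInt T 0 (PI / 2)).
  assert (E : osc a p x - osc a q x = 2 * (G (PI / 2) - G 0 + VT)).
  { unfold osc; rewrite <- Rmult_minus_distr_l; f_equal.
    assert (I1 := @is_RInt_minus R_NormedModule _ _ _ _ _ _ (Ic p) (Ic q)).
    assert (I2 := @is_RInt_plus R_NormedModule _ _ _ _ _ _ IG
                    (RInt_correct_R _ _ _ IT)).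
    apply is_RInt_unique_R in I1.
    apply is_RInt_unique_R in I2.
    change (minus (RInt (fun t => cos (x * cos t - a) * cos (p * t)) 0 (PI / 2))
       (RInt (fun t => cos (x * cos t - a) * cos (q * t)) 0 (PI / 2))
       = plus (minus (G (PI / 2)) (G 0)) VT).
    eapply eq_trans; [symmetry; exact I1|]; eapply eq_trans; [|exact I2].
    apply RInt_ext; intros t _; unfold h, minus, plus, opp; simpl; ring. }
  assert (Hsin : forall t, 0 <= t <= PI / 2 -> 0 <= sin t <= 1).
  { intros t Ht; split; [apply sin_ge_0; lra|apply SIN_bound]. }
  assert (Hh : forall t, 0 <= t <= PI / 2 -> Rabs (h t) <= K * sin t ^ 2)
    by (intros; now apply abs_cos_sub_le).
  assert (Hh' : forall t, 0 <= t <= PI / 2 -> Rabs (h' t) <= K * sin t)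
    by (intros; now apply abs_sin_sub_le).
  assert (frac : forall t, 0 <= sin t ^ 2 / D t <= 1).
  { intros t; assert (P := HD t); assert (Q := pow2_ge_0 (sin t)); split.
    - apply Rdiv_le_0_compat; assumption.
    - apply Rle_div_l; unfold D in *; lra. }
  assert (BG : forall t, 0 <= t <= PI / 2 -> Rabs (G t) <= K * e).
  { intros t Ht; unfold G, g; rewrite Rabs_Ropp, !Rabs_mult, (Rabs_pos_eq e) by lra.
    unfold Rdiv; rewrite !Rabs_mult, Rabs_inv, (Rabs_pos_eq (D t)) by (left; apply HD).
    destruct (Hsin t Ht) as [s0 s1]; rewrite (Rabs_pos_eq (sin t)) by exact s0.
    assert (P1 := abs_sin_le_1 (x * cos t - a)).
    assert (P1' := Rabs_pos (sin (x * cos t - a))).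
    assert (P2 := Hh t Ht). assert (P2' := Rabs_pos (h t)).
    destruct (frac t) as [f0 f1]; unfold Rdiv in f0, f1.
    assert (P3 : 0 < / D t) by (apply Rinv_0_lt_compat, HD).
    assert (P4 : Rabs (h t) * sin t * / D t <= K).
    { assert (Rabs (h t) * (sin t * / D t) <= K * sin t ^ 2 * (sin t * / D t)).
      { apply Rmult_le_compat_r; [apply Rmult_le_pos; lra|assumption]. }
      assert (K * sin t ^ 2 * (sin t * / D t) = K * (sin t * (sin t ^ 2 * / D t))) by ring.
      assert (sin t * (sin t ^ 2 * / D t) <= 1 * 1) by (apply Rmult_le_compat; lra).
      nra. }
    assert (0 <= Rabs (h t) * sin t * / D t) by (repeat apply Rmult_le_pos; lra).
    assert (Rabs (sin (x * cos t - a)) * (Rabs (h t) * sin t * / D t) <= 1 * K)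
      by (apply Rmult_le_compat; assumption).
    nra. }
  assert (BT : forall t, 0 <= t <= PI / 2 -> Rabs (T t) <= 3 * K * e).
  { intros t Ht.
    destruct (Hsin t Ht) as [s0 s1].
    destruct (frac t) as [f0 f1].
    assert (P := HD t).
    assert (c1 := abs_cos_le_1 (x * cos t - a)).
    assert (c2 := abs_sin_le_1 (x * cos t - a)).
    assert (c3 := abs_cos_le_1 t).
    assert (c1' := Rabs_pos (cos (x * cos t - a))).
    assert (c2' := Rabs_pos (sin (x * cos t - a))).
    assert (c3' := Rabs_pos (cos t)).
    assert (div : forall u, Rabs u <= K * sin t ^ 2 -> Rabs (u / D t) <= K).
    { intros u Hu; unfold Rdiv; rewrite Rabs_mult, Rabs_inv, (Rabs_pos_eq (D t)) by lra.
      apply Rle_trans with (K * sin t ^ 2 * / D t).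
      - apply Rmult_le_compat_r; [left; now apply Rinv_0_lt_compat|exact Hu].
      - unfold Rdiv in f1; rewrite Rmult_assoc; nra. }
    assert (b1 : Rabs (h t / D t) <= K) by (apply div, Hh, Ht).
    assert (b2 : Rabs (h' t * sin t / D t) <= K).
    { apply div; rewrite Rabs_mult, (Rabs_pos_eq (sin t)) by exact s0.
      assert (B := Hh' t Ht). nra. }
    assert (b3 : Rabs ((e - sin t ^ 2) / D t) <= 1).
    { unfold Rdiv; rewrite Rabs_mult, Rabs_inv, (Rabs_pos_eq (D t)) by lra.
      apply Rle_div_l; [exact P|]. rewrite Rmult_1_l.
      assert (Q := pow2_ge_0 (sin t)). apply Rabs_le; unfold D; lra. }
    assert (b3' := Rabs_pos ((e - sin t ^ 2) / D t)).
    assert (b1' := Rabs_pos (h t / D t)).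
    assert (b4 : Rabs (h t * cos t * (e - sin t ^ 2) / D t ^ 2) <= K).
    { replace (h t * cos t * (e - sin t ^ 2) / D t ^ 2)
        with (h t / D t * (cos t * ((e - sin t ^ 2) / D t))) by (field; lra).
      rewrite !Rabs_mult.
      assert (Rabs (cos t) * Rabs ((e - sin t ^ 2) / D t) <= 1 * 1)
        by (apply Rmult_le_compat; assumption).
      assert (0 <= Rabs (cos t) * Rabs ((e - sin t ^ 2) / D t)) by now apply Rmult_le_pos.
      rewrite <- (Rmult_1_r K); apply Rmult_le_compat; lra. }
    assert (b5 : Rabs (g' t) <= 2 * K).
    { unfold g'; eapply Rle_trans; [apply Rabs_triang|]; lra. }
    unfold T; eapply Rle_trans; [apply Rabs_triang|].
    replace (cos (x * cos t - a) * h t * e / D t)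
      with (e * (cos (x * cos t - a) * (h t / D t))) by (field; lra).
    rewrite !Rabs_mult, (Rabs_pos_eq e) by lra.
    assert (Rabs (cos (x * cos t - a)) * Rabs (h t / D t) <= 1 * K)
      by (apply Rmult_le_compat; assumption).
    assert (Rabs (sin (x * cos t - a)) * Rabs (g' t) <= 1 * (2 * K))
      by (apply Rmult_le_compat; try assumption; apply Rabs_pos).
    nra. }
  assert (BV : Rabs VT <= (PI / 2 - 0) * (3 * K * e))
    by (apply abs_RInt_le_const; [lra|exact IT|exact BT]).
  assert (B1 := BG (PI / 2) ltac:(lra)). assert (B2 := BG 0 ltac:(lra)).
  rewrite E, Rabs_mult, (Rabs_pos_eq 2) by lra.
  between.
  assert (B : Rabs (G (PI / 2) - G 0 + VT) <= 2 * K * e + PI / 2 * (3 * K * e))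
    by (apply Rabs_le; lra).
  unfold Rdiv; fold e. nra.
Qed.

(** * Recurrences, asymptotics and Casoratian of cylinder functions *)
Definition cylinder (C : R -> R -> R) : Prop :=
  forall nu x, 0 < x ->
    is_derive (C nu) x (C (nu - 1) x - nu / x * C nu x) /\
    C (nu - 1) x + C (nu + 1) x = 2 * nu / x * C nu x.

Lemma cylinder_cyl (b : R) : cylinder (cyl b).
Proof.
  intros nu x Hx; assert (E := cyl_recurrence b nu x Hx); split; [|exact E].
  eapply is_derive_eq; [now apply is_derive_cyl_half|].
  replace (cyl b (nu + 1) x) with (2 * nu / x * cyl b nu x - cyl b (nu - 1) x) by lra.
  field; lra.
Qed.

Lemma cylinder_derive_up (C : R -> R -> R) (nu x : R) :
  cylinder C -> 0 < x -> is_derive (C nu) x (nu / x * C nu x - C (nu + 1) x).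
Proof.
  intros HC Hx; destruct (HC nu x Hx) as [D E].
  eapply is_derive_eq; [exact D|].
  replace (C (nu - 1) x) with (2 * nu / x * C nu x - C (nu + 1) x) by lra.
  field; lra.
Qed.

Lemma cylinder_derive_down (C : R -> R -> R) (nu x : R) :
  cylinder C -> 0 < x -> is_derive (C (nu + 1)) x (C nu x - (nu + 1) / x * C (nu + 1) x).
Proof.
  intros HC Hx; destruct (HC (nu + 1) x Hx) as [D _].
  now replace (nu + 1 - 1) with nu in D by ring.
Qed.

Lemma constant_of_derive_0 (f : R -> R) :
  (forall x, 0 < x -> is_derive f x 0) -> forall x y, 0 < x -> 0 < y -> f x = f y.
Proof.
  intros D x y Hx Hy.
  assert (P : forall z, Rmin x y <= z -> 0 < z)
    by (intros z Hz; assert (0 < Rmin x y) by (apply Rmin_case; assumption); lra).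
  destruct (MVT_gen f x y (fun _ => 0)) as [z [_ E]].
  - intros z Hz; apply D, P; lra.
  - intros z Hz; eapply continuity_pt_of_is_derive, D, P, Hz.
  - lra.
Qed.

(** By the recurrences the Casoratian equals the Wronskian [A B' - A' B], which for
    solutions of Bessel's equation is [constant / x]. *)
Lemma is_derive_casoratian (A B : R -> R -> R) (nu x : R) :
  cylinder A -> cylinder B -> 0 < x ->
  is_derive (fun y => y * (A (nu + 1) y * B nu y - A nu y * B (nu + 1) y)) x 0.
Proof.
  intros HA HB Hx.
  assert (A1 := cylinder_derive_down A nu x HA Hx).
  assert (B1 := cylinder_derive_down B nu x HB Hx).
  assert (A0 := cylinder_derive_up A nu x HA Hx).
  assert (B0 := cylinder_derive_up B nu x HB Hx).
  eapply is_derive_eq.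
  - apply der_mult; [apply der_id|apply der_minus; apply der_mult; eassumption].
  - cbv beta; field; lra.
Qed.

(** For [y = sqrt x * cyl 0 (1 / 2)] and [z = sqrt x * cyl 0 (- 1 / 2)] the
    recurrences are the system [y' = z], [z' = - y]. *)
Lemma cyl_half : exists p q, forall b x, 0 < x ->
  sqrt x * cyl b (1 / 2) x = p * cos (x - b) + q * sin (x - b).
Proof.
  set (y := fun x => sqrt x * cyl 0 (1 / 2) x).
  set (z := fun x => sqrt x * cyl 0 (- (1 / 2)) x).
  assert (Dy : forall x, 0 < x -> is_derive y x (z x)).
  { intros x Hx.
    assert (D := cylinder_derive_down _ (- (1 / 2)) x (cylinder_cyl 0) Hx).
    replace (- (1 / 2) + 1) with (1 / 2) in D by field.
    eapply is_derive_eq.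
    - apply der_mult; [apply is_derive_Reals, derivable_pt_lim_sqrt; exact Hx|exact D].
    - assert (Hs := sqrt_lt_R0 x Hx); assert (E := sqrt_sqrt x ltac:(lra)).
      unfold y, z.
      set (r := sqrt x) in *; rewrite <- E; field; lra. }
  assert (Dz : forall x, 0 < x -> is_derive z x (- y x)).
  { intros x Hx.
    assert (D := cylinder_derive_up _ (- (1 / 2)) x (cylinder_cyl 0) Hx).
    replace (- (1 / 2) + 1) with (1 / 2) in D by field.
    eapply is_derive_eq.
    - apply der_mult; [apply is_derive_Reals, derivable_pt_lim_sqrt; exact Hx|exact D].
    - assert (Hs := sqrt_lt_R0 x Hx); assert (E := sqrt_sqrt x ltac:(lra)).
      unfold y, z.
      set (r := sqrt x) in *; rewrite <- E; field; lra. }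
  set (P := fun x => y x * cos x - z x * sin x).
  set (Q := fun x => y x * sin x + z x * cos x).
  assert (DP : forall x, 0 < x -> is_derive P x 0).
  { intros x Hx; eapply is_derive_eq.
    - apply der_minus; apply der_mult;
        [now apply Dy|apply is_derive_cos|now apply Dz|apply is_derive_sin].
    - cbv beta; ring. }
  assert (DQ : forall x, 0 < x -> is_derive Q x 0).
  { intros x Hx; eapply is_derive_eq.
    - apply der_plus; apply der_mult;
        [now apply Dy|apply is_derive_sin|now apply Dz|apply is_derive_cos].
    - cbv beta; ring. }
  exists (P 1), (Q 1); intros b x Hx.
  rewrite (constant_of_derive_0 P DP 1 x), (constant_of_derive_0 Q DQ 1 x) by lra.
  rewrite cyl_lin.
  assert (E : cyl (PI / 2) (1 / 2) x = - cyl 0 (- (1 / 2)) x).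
  { rewrite cyl_reflection, (cyl_lin (0 - _)).
    replace (0 - 1 / 2 * PI) with (- (PI / 2)) by field.
    rewrite cos_neg, sin_neg, cos_PI2, sin_PI2; ring. }
  rewrite E, cos_minus, sin_minus; unfold P, Q, y, z.
  assert (T := sin_cos_sq x).
  transitivity ((sin x * sin x + cos x * cos x)
    * (sqrt x * (cos b * cyl 0 (1 / 2) x - sin b * cyl 0 (- (1 / 2)) x)));
    [rewrite T|]; ring.
Qed.

Lemma F_le_inv (nu : R) : exists K, 0 <= K /\ forall x, 1 <= x -> F nu x <= K / x.
Proof.
  exists (2 * (1 + Rabs (nu - 1) * F (nu - 1) 1)); split.
  - assert (H := F_ge0 (nu - 1) 1 ltac:(lra)). assert (H' := Rabs_pos (nu - 1)). nra.
  - intros x Hx.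
    assert (E := F_recurrence (nu - 1) x ltac:(lra)).
    replace (nu - 1 + 1) with nu in E by ring.
    assert (H0 := F_ge0 (nu - 1 - 1) x ltac:(lra)).
    assert (H1 := F_ge0 (nu - 1) x ltac:(lra)).
    assert (H2 := F_antitone_x (nu - 1) 1 x ltac:(lra) Hx).
    assert (H3 : (nu - 1) * F (nu - 1) x <= Rabs (nu - 1) * F (nu - 1) 1).
    { apply Rle_trans with (Rabs (nu - 1) * F (nu - 1) x).
      - apply Rmult_le_compat_r; [exact H1|apply Rle_abs].
      - apply Rmult_le_compat_l; [apply Rabs_pos|exact H2]. }
    apply Rle_div_r; nra.
Qed.

Definition wave (p q t : R) : R := p * cos t + q * sin t.

(** Rotating by [nu * PI / 2] leaves an integral whose leading term does not
    depend on the order, so order one half settles all of them. *)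
Lemma cyl_asymptotic (p q b nu : R) :
  (forall b x, 0 < x -> sqrt x * cyl b (1 / 2) x = wave p q (x - b)) ->
  is_lim (fun x => sqrt x * cyl b nu x - wave p q (x - (b + (nu - 1 / 2) * (PI / 2)))) p_infty 0.
Proof.
  intros Hhalf.
  destruct (F_le_inv nu) as [K1 [P1 B1]]. destruct (F_le_inv (- nu)) as [K2 [P2 B2]].
  destruct (F_le_inv (1 / 2)) as [K3 [P3 B3]].
  destruct (F_le_inv (- (1 / 2))) as [K4 [P4 B4]].
  set (K0 := 4 * (1 + 3 * PI) * (4 * (nu ^ 2 + (1 / 2) ^ 2))).
  apply is_lim_0_of_le with (2 := is_lim_inv_sqrt (K0 + K1 + K2 + K3 + K4)).
  exists 1; intros x Hx1. assert (Hx : 1 <= x) by lra.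
  set (b' := b + (nu - 1 / 2) * (PI / 2)).
  rewrite <- Hhalf by lra.
  assert (Hs : 1 <= sqrt x) by (rewrite <- sqrt_1; apply sqrt_le_1; lra).
  assert (Ess := sqrt_sqrt x ltac:(lra)).
  assert (O := osc_sub_le (b + nu * (PI / 2)) nu (1 / 2) x ltac:(lra)); fold K0 in O.
  assert (prod_le : forall u v K, Rabs u <= 1 -> 0 <= v <= K / x -> Rabs (u * v) <= K / x).
  { intros u v K Hu Hv; rewrite Rabs_mult, (Rabs_pos_eq v) by lra.
    assert (0 <= Rabs u) by apply Rabs_pos. nra. }
  assert (R1 := prod_le (sin b) (F nu x) K1 (abs_sin_le_1 _)
     (conj (F_ge0 nu x ltac:(lra)) (B1 x Hx))).
  assert (R2 := prod_le (sin (nu * PI + b)) (F (- nu) x) K2 (abs_sin_le_1 _)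
     (conj (F_ge0 (- nu) x ltac:(lra)) (B2 x Hx))).
  assert (R3 := prod_le (sin b') (F (1 / 2) x) K3 (abs_sin_le_1 _)
     (conj (F_ge0 (1 / 2) x ltac:(lra)) (B3 x Hx))).
  assert (R4 := prod_le (sin (1 / 2 * PI + b')) (F (- (1 / 2)) x) K4 (abs_sin_le_1 _)
     (conj (F_ge0 (- (1 / 2)) x ltac:(lra)) (B4 x Hx))).
  assert (B : Rabs (cyl b nu x - cyl b' (1 / 2) x) <= (K0 + K1 + K2 + K3 + K4) / x).
  { unfold cyl.
    replace (b' + 1 / 2 * (PI / 2)) with (b + nu * (PI / 2)) by (unfold b'; field).
    between.
    unfold Rdiv in *; apply Rabs_le; lra. }
  rewrite <- Rmult_minus_distr_l, Rabs_mult, (Rabs_pos_eq (sqrt x)) by lra.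
  apply Rle_trans with (sqrt x * ((K0 + K1 + K2 + K3 + K4) / x)).
  - apply Rmult_le_compat_l; lra.
  - right; set (r := sqrt x) in *; rewrite <- Ess; field; lra.
Qed.

Lemma wave_shift (p q t : R) : wave p q (t - PI / 2) = wave (- q) p t.
Proof. unfold wave; rewrite cos_minus, sin_minus, cos_PI2, sin_PI2; ring. Qed.

Lemma abs_wave_le (p q t : R) : Rabs (wave p q t) <= Rabs p + Rabs q.
Proof.
  unfold wave; eapply Rle_trans; [apply Rabs_triang|]; rewrite !Rabs_mult.
  assert (H1 := abs_cos_le_1 t).
  assert (H2 := abs_sin_le_1 t).
  assert (H3 := Rabs_pos p). assert (H4 := Rabs_pos q). nra.
Qed.

Lemma is_lim_wave_mult (p q : R) (s f : R -> R) :
  is_lim f p_infty 0 -> is_lim (fun y => wave p q (s y) * f y) p_infty 0.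
Proof. apply is_lim_bounded_mult with (Rabs p + Rabs q); intros; apply abs_wave_le. Qed.

Lemma cyl_casoratian (p q nu x : R) :
  (forall b x, 0 < x -> sqrt x * cyl b (1 / 2) x = wave p q (x - b)) -> 0 < x ->
  x * (cyl 0 (nu + 1) x * cyl (PI / 2) nu x - cyl 0 nu x * cyl (PI / 2) (nu + 1) x)
  = p ^ 2 + q ^ 2.
Proof.
  intros Hhalf Hx.
  assert (L1 := cyl_asymptotic p q 0 (nu + 1) Hhalf).
  assert (L2 := cyl_asymptotic p q (PI / 2) nu Hhalf).
  assert (L3 := cyl_asymptotic p q 0 nu Hhalf).
  assert (L4 := cyl_asymptotic p q (PI / 2) (nu + 1) Hhalf).
  set (e1 := fun x => _) in L1. set (e2 := fun x => _) in L2.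
  set (e3 := fun x => _) in L3. set (e4 := fun x => _) in L4.
  set (t := fun y => y - (nu - 1 / 2) * (PI / 2)).
  apply eq_of_lim with (fun y => p ^ 2 + q ^ 2
    + (wave (- q) p (t y) * (e1 y + e2 y) + e1 y * e2 y
       + -1 * (wave p q (t y) * (e4 y + -1 * e3 y) + e3 y * e4 y))).
  - intros y Hy.
    rewrite (constant_of_derive_0 (fun y => y * (cyl 0 (nu + 1) y * cyl (PI / 2) nu y
       - cyl 0 nu y * cyl (PI / 2) (nu + 1) y))) with (y := y); [|intros z Hz|exact Hx|exact Hy].
    2: { apply is_derive_casoratian; auto using cylinder_cyl. }
    unfold e1, e2, e3, e4.
    replace (y - (0 + (nu + 1 - 1 / 2) * (PI / 2))) with (t y - PI / 2) by (unfold t; field).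
    replace (y - (PI / 2 + (nu - 1 / 2) * (PI / 2))) with (t y - PI / 2) by (unfold t; field).
    replace (y - (0 + (nu - 1 / 2) * (PI / 2))) with (t y) by (unfold t; field).
    replace (y - (PI / 2 + (nu + 1 - 1 / 2) * (PI / 2))) with (t y - PI / 2 - PI / 2)
      by (unfold t; field).
    rewrite !wave_shift.
    assert (W : p ^ 2 + q ^ 2 = wave (- q) p (t y) ^ 2 + wave p q (t y) ^ 2).
    { unfold wave; transitivity ((p ^ 2 + q ^ 2) * (sin (t y) * sin (t y) + cos (t y) * cos (t y)));
        [rewrite sin_cos_sq|]; ring. }
    assert (N : wave (- p) (- q) (t y) = - wave p q (t y)) by (unfold wave; ring).
    assert (Es := sqrt_sqrt y ltac:(lra)).
    cbv beta; rewrite W, N; set (r := sqrt y) in *.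
    transitivity (r * r * (cyl 0 (nu + 1) y * cyl (PI / 2) nu y - cyl 0 nu y * cyl (PI / 2) (nu + 1) y));
      [now rewrite Es|ring].
  - replace (Finite (p ^ 2 + q ^ 2)) with (Finite (p ^ 2 + q ^ 2 + 0)) by (f_equal; ring).
    apply is_lim_plus'; [apply is_lim_const|].
    apply is_lim_0_plus; [|apply is_lim_0_scal]; apply is_lim_0_plus;
      try (apply is_lim_0_mult; assumption); apply is_lim_wave_mult, is_lim_0_plus;
      try apply is_lim_0_scal; assumption.
Qed.

Lemma abs_osc_le (a nu x : R) : Rabs (osc a nu x) <= PI.
Proof.
  assert (HPI := PI_RGT_0).
  unfold osc; rewrite Rabs_mult, (Rabs_pos_eq 2) by lra.
  assert (B : Rabs (RInt (fun t => cos (x * cos t - a) * cos (nu * t)) 0 (PI / 2))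
              <= (PI / 2 - 0) * 1).
  { apply abs_RInt_le_const; [lra|apply ex_RInt_osc|].
    intros t _; rewrite Rabs_mult.
    assert (B1 := abs_cos_le_1 (x * cos t - a)).
    assert (B2 := abs_cos_le_1 (nu * t)).
    assert (P1 := Rabs_pos (cos (x * cos t - a))). assert (P2 := Rabs_pos (cos (nu * t))).
    nra. }
  lra.
Qed.

Lemma F_ge_inv (nu x : R) : 0 < x -> 0 <= nu -> / x <= F (nu + 1) x.
Proof.
  intros Hx Hnu; assert (E := F_recurrence nu x Hx).
  assert (M1 := F_monotone_nu nu x Hx). assert (M2 := F_monotone_nu (nu + 1) x Hx).
  replace (nu + 1 - 1) with nu in M2 by ring.
  assert (P := F_ge0 nu x Hx).
  assert (0 <= nu * F nu x) by now apply Rmult_le_pos.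
  apply (Rmult_le_reg_l x); [exact Hx|]. rewrite Rinv_r by lra. nra.
Qed.

(** Otherwise all functions of half-integral order would vanish, while [F] is
    unbounded near [0] and [osc] is not. *)
Lemma wave_amplitude_pos (p q : R) :
  (forall b x, 0 < x -> sqrt x * cyl b (1 / 2) x = wave p q (x - b)) -> 0 < p ^ 2 + q ^ 2.
Proof.
  intros Hhalf.
  assert (Hp := pow2_ge_0 p). assert (Hq := pow2_ge_0 q).
  destruct (Rle_lt_or_eq_dec 0 (p ^ 2 + q ^ 2) ltac:(lra)) as [H|H]; [exact H|exfalso].
  assert (p = 0) by nra. assert (q = 0) by nra. subst p q.
  set (x := / 5). assert (Hx : 0 < x) by (unfold x; lra).
  assert (Z : forall b, cyl b (1 / 2) x = 0).
  { intros b; assert (E := Hhalf b x Hx); unfold wave in E.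
    assert (Hs := sqrt_lt_R0 x Hx).
    apply (Rmult_eq_reg_l (sqrt x)); lra. }
  assert (Z' : cyl (PI / 2) (- (1 / 2)) x = 0) by (rewrite cyl_reflection; apply Z).
  assert (E := cyl_recurrence (PI / 2) (1 / 2) x Hx).
  replace (1 / 2 - 1) with (- (1 / 2)) in E by field.
  replace (1 / 2 + 1) with (3 / 2) in E by field.
  rewrite Z, Z' in E.
  assert (E' : cyl (PI / 2) (3 / 2) x = 0) by lra.
  unfold cyl in E'. replace (3 / 2 * PI + PI / 2) with (2 * PI) in E' by field.
  rewrite sin_PI2, sin_2PI in E'.
  assert (B := F_ge_inv (1 / 2) x Hx ltac:(lra)).
  replace (1 / 2 + 1) with (3 / 2) in B by field.
  unfold x in B at 1; rewrite Rinv_inv in B.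
  assert (O := abs_osc_le (PI / 2 + 3 / 2 * (PI / 2)) (3 / 2) x).
  apply Rabs_le_between in O. assert (H4 := PI_4). lra.
Qed.

(** * The reciprocal Gamma function *)

(** Bernoulli's inequality for exponents in [[0, 1]]. *)
Lemma Rpower_le_affine (y u : R) : 0 < y -> 0 <= u <= 1 -> Rpower y u <= 1 - u + u * y.
Proof.
  intros Hy Hu; unfold Rpower.
  set (s := 1 - u + u * y).
  assert (Hs : 0 < s).
  { unfold s; destruct (Req_dec u 1) as [->|]; [lra|].
    assert (0 <= u * y) by (apply Rmult_le_pos; lra). lra. }
  assert (L1 := ln_le_sub_1 (y / s) ltac:(now apply Rdiv_lt_0_compat)).
  assert (L2 := ln_le_sub_1 (/ s) ltac:(now apply Rinv_0_lt_compat)).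
  rewrite ln_Rinv in L2 by exact Hs. rewrite ln_div in L1 by assumption.
  rewrite <- (exp_ln s) by exact Hs. apply exp_le.
  assert (E : u * (y / s - 1) + (1 - u) * (/ s - 1) = 0) by (unfold s in *; field; lra).
  assert (u * (ln y - ln s) <= u * (y / s - 1)) by (apply Rmult_le_compat_l; lra).
  assert ((1 - u) * - ln s <= (1 - u) * (/ s - 1)) by (apply Rmult_le_compat_l; lra).
  lra.
Qed.

Definition rising (z : R) (n : nat) : R := prod_f_R0 (fun k => z + INR k) n.

Definition gauss (z : R) (n : nat) : R :=
  rising z n / (INR (fact n) * Rpower (INR n) z).

Lemma rising_S (z : R) (n : nat) : rising z (S n) = rising z n * (z + INR (S n)).
Proof. reflexivity. Qed.

Lemma rising_pos (z : R) (n : nat) : 0 < z -> 0 < rising z n.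
Proof.
  intros Hz; induction n as [|n IH]; [unfold rising; simpl; lra|].
  rewrite rising_S; apply Rmult_lt_0_compat; [exact IH|].
  assert (H := pos_INR (S n)); lra.
Qed.

Lemma rising_shift (z : R) (n : nat) : rising z n * (z + 1 + INR n) = z * rising (z + 1) n.
Proof.
  induction n as [|n IH]; [unfold rising; simpl; ring|].
  rewrite !rising_S, <- Rmult_assoc, <- IH, S_INR; ring.
Qed.

Lemma Rpower_pos (a b : R) : 0 < Rpower a b.
Proof. apply exp_pos. Qed.

Lemma gauss_pos (z : R) (n : nat) : 0 < z -> 0 < gauss z n.
Proof.
  intros Hz; apply Rdiv_lt_0_compat; [now apply rising_pos|].
  apply Rmult_lt_0_compat; [apply INR_fact_lt_0|apply Rpower_pos].
Qed.

Lemma fact_S_INR (n : nat) : INR (fact (S n)) = INR (S n) * INR (fact n).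
Proof. rewrite <- mult_INR; reflexivity. Qed.

(** The ratio of consecutive terms is [(1 + z / m) (1 - 1 / m) ^ z] with
    [m = n + 1], at most [exp (z / m) exp (- z / m)]. *)
Lemma gauss_decr (z : R) (n : nat) : 0 < z -> (1 <= n)%nat -> gauss z (S n) <= gauss z n.
Proof.
  intros Hz Hn.
  assert (Pn : 0 < INR n) by (apply lt_0_INR; lia).
  assert (Pm : 0 < INR (S n)) by (apply lt_0_INR; lia).
  assert (Pf := INR_fact_lt_0 n).
  assert (Pr := rising_pos z n Hz).
  assert (P1 := Rpower_pos (INR n) z). assert (P2 := Rpower_pos (INR (S n)) z).
  unfold gauss; rewrite rising_S, fact_S_INR.
  replace (rising z n * (z + INR (S n)) / (INR (S n) * INR (fact n) * Rpower (INR (S n)) z))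
    with (rising z n / (INR (fact n) * Rpower (INR n) z)
          * ((1 + z / INR (S n)) * (Rpower (INR n) z / Rpower (INR (S n)) z)))
    by (field; lra).
  rewrite <- (Rmult_1_r (rising z n / _)) at 2.
  apply Rmult_le_compat_l.
  { left; apply Rdiv_lt_0_compat; [exact Pr|now apply Rmult_lt_0_compat]. }
  set (m := INR (S n)) in *.
  assert (E : Rpower (INR n) z / Rpower m z = exp (z * ln (INR n / m))).
  { unfold Rpower, Rdiv; rewrite <- exp_Ropp, <- exp_plus; f_equal.
    fold (INR n / m); rewrite ln_div by assumption; ring. }
  rewrite E.
  assert (L := ln_le_sub_1 (INR n / m) ltac:(now apply Rdiv_lt_0_compat)).
  assert (En : INR n = m - 1) by (unfold m; rewrite S_INR; ring).
  replace (INR n / m - 1) with (- / m) in L by (rewrite En; field; lra).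
  assert (H1 : exp (z * ln (INR n / m)) <= exp (- (z / m))).
  { apply exp_le. unfold Rdiv at 2; nra. }
  assert (H2 := exp_ineq1_le (z / m)).
  rewrite exp_Ropp in H1.
  assert (P3 := exp_pos (z / m)). assert (P4 := exp_pos (z * ln (INR n / m))).
  apply Rle_trans with (exp (z / m) * / exp (z / m)); [|right; field; lra].
  apply Rmult_le_compat; [|lra|lra|exact H1].
  assert (0 < z / m) by (now apply Rdiv_lt_0_compat). lra.
Qed.

Lemma gauss_shift (z : R) (n : nat) : (1 <= n)%nat -> z + 1 + INR n <> 0 ->
  gauss z n = z * gauss (z + 1) n * (INR n / (z + 1 + INR n)).
Proof.
  intros Hn H; assert (Pn : 0 < INR n) by (apply lt_0_INR; lia).
  assert (E := rising_shift z n).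
  assert (Pf := INR_fact_lt_0 n). assert (P1 := Rpower_pos (INR n) z).
  unfold gauss; rewrite Rpower_plus, Rpower_1 by exact Pn.
  replace (rising z n) with (z * rising (z + 1) n / (z + 1 + INR n))
    by (rewrite <- E; field; exact H).
  field; lra.
Qed.

Lemma is_lim_seq_shift_ratio (c : R) : is_lim_seq (fun n => INR n / (c + INR n)) 1.
Proof.
  apply is_lim_seq_ext_loc with (fun n => 1 - c * / (c + INR n)).
  - destruct (INR_unbounded (Rabs c)) as [N HN]; exists N; intros n Hn.
    apply le_INR in Hn. assert (H := Rabs_maj2 c). field; lra.
  - assert (H : is_lim_seq (fun n => c + INR n) p_infty).
    { apply is_lim_seq_plus with (Finite c) p_infty;
        [apply is_lim_seq_const|apply is_lim_seq_INR|reflexivity]. }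
    assert (H1 : is_lim_seq (fun n => / (c + INR n)) 0).
    { apply (is_lim_seq_inv _ p_infty); [exact H|discriminate]. }
    apply (is_lim_seq_scal_l _ c) in H1. simpl in H1. rewrite Rmult_0_r in H1.
    assert (H2 := is_lim_seq_minus' _ _ _ _ (is_lim_seq_const 1) H1).
    now rewrite Rminus_0_r in H2.
Qed.

Lemma gauss_lim_down (z l : R) :
  is_lim_seq (gauss (z + 1)) l -> is_lim_seq (gauss z) (z * l).
Proof.
  intros H.
  apply is_lim_seq_ext_loc with (fun n => z * gauss (z + 1) n * (INR n / (z + 1 + INR n))).
  - destruct (INR_unbounded (Rabs (z + 1))) as [N HN]; exists (S N); intros n Hn.
    symmetry; apply gauss_shift; [lia|].
    assert (Hn' : (N <= n)%nat) by lia; apply le_INR in Hn'.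
    assert (A := Rabs_maj2 (z + 1)). lra.
  - replace (z * l) with (z * l * 1) by ring.
    apply is_lim_seq_mult'; [|apply is_lim_seq_shift_ratio].
    apply (is_lim_seq_scal_l _ z l), H.
Qed.

(** Monotone convergence for positive [z]; the functional equation carries the
    limit down to all real [z]. *)
Lemma ex_finite_lim_gauss (z : R) : ex_finite_lim_seq (gauss z).
Proof.
  assert (base : forall z, 0 < z -> ex_finite_lim_seq (gauss z)).
  { intros y Hy; destruct (ex_finite_lim_seq_decr (fun n => gauss y (S n)) 0) as [l Hl].
    - intros n; apply gauss_decr; [exact Hy|lia].
    - intros n; left; now apply gauss_pos.
    - exists l; now apply is_lim_seq_incr_1. }
  assert (step : forall N y, 0 < y + INR N -> ex_finite_lim_seq (gauss y)).
  { induction N as [|N IH]; intros y Hy.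
    - apply base; simpl in Hy; lra.
    - destruct (IH (y + 1)) as [l Hl]; [rewrite S_INR in Hy; lra|].
      exists (y * l); now apply gauss_lim_down. }
  destruct (INR_unbounded (Rabs z)) as [N HN].
  apply (step N); assert (A := Rabs_maj2 z). lra.
Qed.

Lemma is_lim_gauss (z : R) : is_lim_seq (gauss z) (rGamma z).
Proof. apply Lim_seq_correct', ex_finite_lim_gauss. Qed.

Lemma rGamma_succ (z : R) : rGamma z = z * rGamma (z + 1).
Proof.
  assert (H := is_lim_seq_unique _ _ (gauss_lim_down z _ (is_lim_gauss (z + 1)))).
  assert (H' := is_lim_seq_unique _ _ (is_lim_gauss z)).
  rewrite H in H'; now inversion H'.
Qed.

(** On [(0, 1]] Bernoulli's inequality bounds Gauss's terms below by [z]. *)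
Lemma rGamma_pos (z : R) : 0 < z -> 0 < rGamma z.
Proof.
  assert (base : forall z, 0 < z <= 1 -> 0 < rGamma z).
  { intros y Hy.
    assert (B : forall n, y * INR (fact n) * Rpower (INR (S n)) y <= rising y n).
    { induction n as [|n IH].
      - unfold rising; simpl; unfold Rpower; rewrite ln_1, Rmult_0_r, exp_0; lra.
      - rewrite rising_S, fact_S_INR.
        set (m := INR (S n)) in *.
        assert (Pm : 0 < m) by (apply lt_0_INR; lia).
        assert (Pf := INR_fact_lt_0 n).
        assert (A := Rpower_le_affine (1 + / m) y
           ltac:(assert (0 < / m) by (now apply Rinv_0_lt_compat); lra) ltac:(lra)).
        assert (E : INR (S (S n)) = m * (1 + / m)) by (rewrite S_INR; fold m; field; lra).
        rewrite E, <- Rpower_mult_distr;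
          [|exact Pm|assert (0 < / m) by (now apply Rinv_0_lt_compat); lra].
        assert (P1 := Rpower_pos m y). assert (P2 := Rpower_pos (1 + / m) y).
        replace (y * (m * INR (fact n)) * (Rpower m y * Rpower (1 + / m) y))
          with (y * INR (fact n) * Rpower m y * (m * Rpower (1 + / m) y)) by ring.
        apply Rmult_le_compat.
        + repeat apply Rmult_le_pos; lra.
        + apply Rmult_le_pos; lra.
        + exact IH.
        + replace (y + m) with (m * (1 - y + y * (1 + / m))) by (field; lra).
          apply Rmult_le_compat_l; lra. }
    apply Rlt_le_trans with y; [lra|].
    apply (is_lim_seq_le_loc (fun _ => y) (gauss y) y (rGamma y));
      [|apply is_lim_seq_const|apply is_lim_gauss].
    exists 1%nat; intros n Hn.
    assert (Pn : 0 < INR n) by (apply lt_0_INR; lia).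
    assert (Pf := INR_fact_lt_0 n). assert (P1 := Rpower_pos (INR n) y).
    apply Rle_div_r; [now apply Rmult_lt_0_compat|].
    eapply Rle_trans; [|apply B]. rewrite Rmult_assoc.
    apply Rmult_le_compat_l; [lra|]. apply Rmult_le_compat_l; [lra|].
    apply Rle_Rpower_l; [lra|]. split; [exact Pn|]. rewrite S_INR; lra. }
  assert (step : forall N z, 0 < z <= INR (S N) -> 0 < rGamma z).
  { induction N as [|N IH]; intros y Hy; [apply base; simpl in Hy; lra|].
    destruct (Rle_dec y 1) as [H1|H1]; [apply base; lra|].
    assert (P := IH (y - 1) ltac:(rewrite S_INR in Hy; lra)).
    rewrite rGamma_succ in P. replace (y - 1 + 1) with y in P by ring.
    apply (Rmult_lt_reg_l (y - 1)); lra. }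
  intros Hz; destruct (INR_unbounded z) as [N HN].
  apply (step N); rewrite S_INR; lra.
Qed.

Lemma rGamma_rising (z : R) (n : nat) : rGamma z = rising z n * rGamma (z + INR n + 1).
Proof.
  induction n as [|n IH].
  - unfold rising; simpl. rewrite (rGamma_succ z) at 1. do 2 f_equal; ring.
  - rewrite rising_S, IH, (rGamma_succ (z + INR n + 1)), S_INR.
    replace (z + (INR n + 1) + 1) with (z + INR n + 1 + 1) by ring. ring.
Qed.

Lemma rGamma_stirling_ratio (z : R) : 0 < z ->
  is_lim_seq (fun n => INR (fact n) * Rpower (INR n) z * rGamma (z + INR n + 1)) 1.
Proof.
  intros Hz; assert (P := rGamma_pos z Hz).
  apply is_lim_seq_ext with (fun n => rGamma z / gauss z n).
  { intros n; rewrite (rGamma_rising z n); unfold gauss.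
    assert (Pr := rising_pos z n Hz). assert (Pf := INR_fact_lt_0 n).
    assert (P1 := Rpower_pos (INR n) z). field; lra. }
  replace 1 with (rGamma z / rGamma z) by (field; lra).
  apply is_lim_seq_div'; [apply is_lim_seq_const|apply is_lim_gauss|lra].
Qed.

Lemma rGamma_decr (z : R) (k : nat) : 1 <= z -> rGamma (z + INR k) <= rGamma z.
Proof.
  intros Hz; induction k as [|k IH]; [simpl; rewrite Rplus_0_r; lra|].
  eapply Rle_trans; [|exact IH].
  rewrite (rGamma_succ (z + INR k)), S_INR.
  assert (Hk := pos_INR k).
  assert (P := rGamma_pos (z + INR k + 1) ltac:(lra)).
  replace (z + (INR k + 1)) with (z + INR k + 1) by ring. nra.
Qed.

Lemma rGamma_bounded (z : R) : exists M, forall k, Rabs (rGamma (z + INR k)) <= M.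
Proof.
  assert (step : forall N z, 1 <= z + INR N -> exists M, forall k, Rabs (rGamma (z + INR k)) <= M).
  { induction N as [|N IH]; intros y Hy.
    - simpl in Hy; exists (rGamma y); intros k.
      assert (Hk := pos_INR k).
      rewrite Rabs_pos_eq by (left; apply rGamma_pos; lra). apply rGamma_decr; lra.
    - destruct (IH (y + 1)) as [M HM]; [rewrite S_INR in Hy; lra|].
      exists (Rmax (Rabs (rGamma y)) M); intros [|k].
      + simpl; rewrite Rplus_0_r; apply Rmax_l.
      + rewrite S_INR; replace (y + (INR k + 1)) with (y + 1 + INR k) by ring.
        eapply Rle_trans; [apply HM|apply Rmax_r]. }
  destruct (INR_unbounded (Rabs z + 1)) as [N HN].
  apply (step N); assert (A := Rabs_maj2 z). lra.
Qed.

(** * The ascending series *)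
Definition coefJ (nu : R) (k : nat) : R :=
  (-1) ^ k / INR (fact k) * rGamma (nu + INR k + 1).

Lemma abs_pow_m1 (k : nat) : Rabs ((-1) ^ k) = 1.
Proof.
  rewrite <- RPow_abs, Rabs_left by lra; replace (- (-1)) with 1 by ring; apply pow1.
Qed.

Lemma coefJ_abs (nu M : R) (k : nat) :
  Rabs (rGamma (nu + INR k + 1)) <= M -> Rabs (coefJ nu k) <= M * / INR (fact k).
Proof.
  intros H; assert (Pf := INR_fact_lt_0 k).
  unfold coefJ, Rdiv; rewrite !Rabs_mult, abs_pow_m1, Rabs_inv, (Rabs_pos_eq (INR _)) by lra.
  assert (P := Rinv_0_lt_compat _ Pf). nra.
Qed.

Lemma CV_radius_coefJ (nu : R) : CV_radius (coefJ nu) = p_infty.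
Proof.
  assert (all : forall r : R, Rbar_le r (CV_radius (coefJ nu))).
  { intros r.
    destruct (rGamma_bounded (nu + 1)) as [M HM].
    assert (B : exists M', forall n, Rabs (coefJ nu n * r ^ n) <= M').
    { assert (C := cv_speed_pow_fact (Rabs r)).
      destruct (maj_by_pos (fun n => Rabs r ^ n / INR (fact n))) as [M' [_ HM']].
      { exists 0; exact C. }
      assert (PM : 0 <= M) by (eapply Rle_trans; [apply Rabs_pos|apply (HM 0%nat)]).
      exists (M * M'); intros n; rewrite Rabs_mult, <- RPow_abs.
      assert (Pf := INR_fact_lt_0 n).
      assert (Pr : 0 <= Rabs r ^ n) by (apply pow_le, Rabs_pos).
      assert (E : Rabs r ^ n / INR (fact n) <= M').
      { eapply Rle_trans; [apply Rle_abs|apply HM']. }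
      assert (A := coefJ_abs nu M n).
      replace (nu + INR n + 1) with (nu + 1 + INR n) in A by ring. specialize (A (HM n)).
      apply Rle_trans with (M * / INR (fact n) * Rabs r ^ n).
      - apply Rmult_le_compat_r; assumption.
      - replace (M * / INR (fact n) * Rabs r ^ n) with (M * (Rabs r ^ n / INR (fact n)))
          by (unfold Rdiv; ring).
        apply Rmult_le_compat_l; assumption. }
    apply (proj1 (CV_radius_bounded (coefJ nu))), B. }
  destruct (CV_radius (coefJ nu)) as [c| |]; [|reflexivity|].
  - assert (H := all (c + 1)); simpl in H; lra.
  - destruct (all 0).
Qed.

Definition serJ (nu y : R) : R := PSeries (coefJ nu) y.

Lemma is_derive_serJ (nu y : R) : is_derive (serJ nu) y (- serJ (nu + 1) y).
Proof.
  eapply is_derive_eq.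
  - apply is_derive_PSeries; rewrite CV_radius_coefJ; exact I.
  - unfold serJ; rewrite <- PSeries_opp; apply PSeries_ext; intros n.
    unfold PS_derive, PS_opp, coefJ; simpl opp.
    rewrite fact_S_INR, S_INR.
    assert (Pf := INR_fact_lt_0 n). assert (Pn := pos_INR n).
    replace (nu + (INR n + 1) + 1) with (nu + 1 + INR n + 1) by ring.
    unfold opp; simpl; field; lra.
Qed.

Lemma ex_pseries_coefJ (nu y : R) : ex_pseries (coefJ nu) y.
Proof. apply CV_radius_inside; rewrite CV_radius_coefJ; exact I. Qed.

(** Termwise this is [(nu + k) / Gamma (nu + k + 1) = 1 / Gamma (nu + k)]. *)
Lemma serJ_recurrence (nu y : R) :
  serJ (nu - 1) y = nu * serJ nu y - y * serJ (nu + 1) y.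
Proof.
  assert (Hy : Rbar_lt (Rabs y) (CV_radius (coefJ nu))) by (rewrite CV_radius_coefJ; exact I).
  assert (E : - serJ (nu + 1) y = PSeries (PS_derive (coefJ nu)) y).
  { rewrite <- (is_derive_unique _ _ _ (is_derive_serJ nu y)).
    apply is_derive_unique, is_derive_PSeries, Hy. }
  replace (nu * serJ nu y - y * serJ (nu + 1) y)
    with (nu * serJ nu y + y * - serJ (nu + 1) y) by ring.
  rewrite E; unfold serJ.
  rewrite <- PSeries_incr_1, <- PSeries_scal, <- PSeries_plus.
  - apply PSeries_ext; intros n; unfold PS_plus, PS_scal, PS_incr_1, coefJ.
    unfold plus, scal, mult; simpl; unfold mult; simpl.
    destruct n as [|n].
    + simpl; replace (nu - 1 + 0 + 1) with nu by ring.
      rewrite (rGamma_succ nu) at 1; replace (nu + 0 + 1) with (nu + 1) by ring.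
      unfold zero; simpl; ring.
    + unfold PS_derive, coefJ.
      replace (nu - 1 + INR (S n) + 1) with (nu + INR (S n)) by ring.
      rewrite (rGamma_succ (nu + INR (S n))).
      change (match n with | 0%nat => 1 | S _ => INR n + 1 end) with (INR (S n)).
      ring.
  - apply ex_pseries_scal; [apply Rmult_comm|apply ex_pseries_coefJ].
  - apply ex_pseries_incr_1, CV_radius_inside; rewrite CV_radius_derive; exact Hy.
Qed.

Lemma BesselJ_serJ (nu x : R) : BesselJ nu x = Rpower (x / 2) nu * serJ nu ((x / 2) ^ 2).
Proof. reflexivity. Qed.

Lemma BesselJ_recurrence (nu x : R) : 0 < x ->
  BesselJ (nu - 1) x + BesselJ (nu + 1) x = 2 * nu / x * BesselJ nu x.
Proof.
  intros Hx; rewrite !BesselJ_serJ, serJ_recurrence.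
  assert (H2 : 0 < x / 2) by lra.
  replace (Rpower (x / 2) (nu + 1)) with (Rpower (x / 2) nu * (x / 2))
    by (rewrite Rpower_plus, Rpower_1 by exact H2; reflexivity).
  replace (Rpower (x / 2) nu) with (Rpower (x / 2) (nu - 1) * (x / 2)) at 1 2.
  2: { rewrite <- (Rpower_1 (x / 2)) at 2 by exact H2.
       rewrite <- Rpower_plus; f_equal; ring. }
  field; lra.
Qed.

Lemma is_derive_BesselJ (nu x : R) : 0 < x ->
  is_derive (BesselJ nu) x (nu / x * BesselJ nu x - BesselJ (nu + 1) x).
Proof.
  intros Hx; assert (H2 : 0 < x / 2) by lra.
  apply is_derive_ext with (fun y => Rpower (y / 2) nu * serJ nu ((y / 2) ^ 2)).
  { intros y; now rewrite BesselJ_serJ. }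
  eapply is_derive_eq.
  - apply der_mult.
    + assert (D : is_derive (fun y => Rpower (y / 2) nu) x (nu / x * Rpower (x / 2) nu)).
      { unfold Rpower; auto_derive; [lra|]. unfold Rdiv; field; lra. }
      exact D.
    + apply (der_comp (serJ nu) (fun y => (y / 2) ^ 2)); [|apply is_derive_serJ].
      assert (D : is_derive (fun y => (y / 2) ^ 2) x (x / 2)) by (auto_derive; [trivial|field]).
      exact D.
  - cbv beta; rewrite !BesselJ_serJ, Rpower_plus, Rpower_1 by exact H2. field; lra.
Qed.

Lemma cylinder_BesselJ : cylinder BesselJ.
Proof.
  intros nu x Hx; assert (E := BesselJ_recurrence nu x Hx); split; [|exact E].
  eapply is_derive_eq; [now apply is_derive_BesselJ|].
  replace (BesselJ (nu + 1) x) with (2 * nu / x * BesselJ nu x - BesselJ (nu - 1) x) by lra.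
  field; lra.
Qed.

Lemma abs_serJ_le (nu y : R) : 0 <= nu -> 0 <= y ->
  Rabs (serJ nu y) <= rGamma (nu + 1) * exp y.
Proof.
  intros Hnu Hy.
  assert (Pr : 0 < rGamma (nu + 1)) by (apply rGamma_pos; lra).
  assert (Ex := is_exp_Reals y).
  apply is_pseries_R in Ex.
  assert (B : forall n, Rabs (coefJ nu n * y ^ n) <= rGamma (nu + 1) * (/ INR (fact n) * y ^ n)).
  { intros n; rewrite Rabs_mult, (Rabs_pos_eq (y ^ n)) by (now apply pow_le).
    rewrite <- Rmult_assoc; apply Rmult_le_compat_r; [now apply pow_le|].
    apply coefJ_abs.
    assert (Pn := pos_INR n).
    replace (nu + INR n + 1) with (nu + 1 + INR n) by ring.
    rewrite Rabs_pos_eq by (left; apply rGamma_pos; lra). apply rGamma_decr; lra. }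
  assert (Es : is_series (fun n => rGamma (nu + 1) * (/ INR (fact n) * y ^ n))
                 (rGamma (nu + 1) * exp y)).
  { apply (is_series_scal_l (rGamma (nu + 1))) in Ex. exact Ex. }
  unfold serJ, PSeries.
  assert (Ea : ex_series (fun n => Rabs (coefJ nu n * y ^ n))).
  { apply (@ex_series_le R_AbsRing R_CompleteNormedModule) with
      (fun n => rGamma (nu + 1) * (/ INR (fact n) * y ^ n)); [|eexists; exact Es].
    intros n; unfold norm; simpl; unfold abs; simpl. rewrite Rabs_Rabsolu; apply B. }
  eapply Rle_trans; [apply Series_Rabs, Ea|].
  rewrite <- (is_series_unique _ _ Es).
  apply Series_le; [|eexists; exact Es].
  intros n; split; [apply Rabs_pos|apply B].
Qed.

Lemma serJ_0 (nu : R) : serJ nu 0 = rGamma (nu + 1).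
Proof.
  unfold serJ; rewrite PSeries_0; unfold coefJ; simpl.
  rewrite Rplus_0_r; field.
Qed.

(** The mean value theorem between [0] and [y], the derivative being the series
    of order [nu + 1]. *)
Lemma serJ_near (nu y : R) : 0 <= nu -> 0 <= y ->
  Rabs (serJ nu y - rGamma (nu + 1)) <= rGamma (nu + 1) * (y * exp y / (nu + 1)).
Proof.
  intros Hnu Hy; rewrite <- (serJ_0 nu) at 1.
  destruct (mvt (serJ nu) (fun t => - serJ (nu + 1) t) 0 y) as [z [Hz E]]; [exact Hy| |].
  - intros; apply is_derive_serJ.
  - rewrite E, Rabs_mult, Rabs_Ropp, Rminus_0_r, (Rabs_pos_eq y) by lra.
    assert (B := abs_serJ_le (nu + 1) z ltac:(lra) ltac:(lra)).
    assert (Pr : 0 < rGamma (nu + 1 + 1)) by (apply rGamma_pos; lra).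
    rewrite (rGamma_succ (nu + 1)).
    assert (Ez : exp z <= exp y) by (apply exp_le; lra).
    replace ((nu + 1) * rGamma (nu + 1 + 1) * (y * exp y / (nu + 1)))
      with (rGamma (nu + 1 + 1) * exp y * y) by (field; lra).
    apply Rmult_le_compat_r; [lra|]. eapply Rle_trans; [exact B|].
    apply Rmult_le_compat_l; lra.
Qed.

(** The ascending series is dominated by its first term for large orders. *)
Lemma BesselJ_large_order (nu x : R) : 0 < nu -> 0 < x ->
  is_lim_seq (fun n => BesselJ (nu + INR n) x / Rpower (x / 2) (nu + INR n)
                       * (INR (fact n) * Rpower (INR n) nu)) 1.
Proof.
  intros Hnu Hx; set (y := (x / 2) ^ 2).
  assert (Hy : 0 <= y) by (unfold y; apply pow2_ge_0).
  assert (Pr : forall n, 0 < rGamma (nu + INR n + 1))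
    by (intros n; apply rGamma_pos; assert (H := pos_INR n); lra).
  apply is_lim_seq_ext with (fun n => serJ (nu + INR n) y / rGamma (nu + INR n + 1)
     * (INR (fact n) * Rpower (INR n) nu * rGamma (nu + INR n + 1))).
  { intros n; rewrite BesselJ_serJ; fold y.
    assert (P1 := Rpower_pos (x / 2) (nu + INR n)). assert (P2 := Pr n). field; lra. }
  replace (Finite 1) with (Finite (1 * 1)) by (f_equal; ring).
  apply is_lim_seq_mult'; [|now apply rGamma_stirling_ratio].
  set (C := y * exp y).
  assert (HC : 0 <= C) by (apply Rmult_le_pos; [exact Hy|left; apply exp_pos]).
  assert (H0 : is_lim_seq (fun n => C * / (nu + 1 + INR n)) 0).
  { assert (H : is_lim_seq (fun n => nu + 1 + INR n) p_infty).
    { apply is_lim_seq_plus with (Finite (nu + 1)) p_infty;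
        [apply is_lim_seq_const|apply is_lim_seq_INR|reflexivity]. }
    assert (H1 : is_lim_seq (fun n => / (nu + 1 + INR n)) 0)
      by (apply (is_lim_seq_inv _ p_infty); [exact H|discriminate]).
    apply (is_lim_seq_scal_l _ C) in H1; simpl in H1; now rewrite Rmult_0_r in H1. }
  assert (Hlo := is_lim_seq_minus' _ _ _ _ (is_lim_seq_const 1) H0).
  assert (Hhi := is_lim_seq_plus' _ _ _ _ (is_lim_seq_const 1) H0).
  rewrite Rminus_0_r in Hlo; rewrite Rplus_0_r in Hhi.
  apply (is_lim_seq_le_le _ _ _ 1 ) with (2 := Hlo) (3 := Hhi).
  intros n; assert (P := Pr n). assert (Pn := pos_INR n).
  assert (B := serJ_near (nu + INR n) y ltac:(lra) Hy); fold C in B.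
  replace (C / (nu + INR n + 1)) with (C * / (nu + 1 + INR n)) in B
    by (unfold Rdiv; do 2 f_equal; ring).
  apply Rabs_le_between in B.
  split; [apply Rle_div_r|apply Rle_div_l]; lra.
Qed.

(** * Identification of the series with Schlaefli's integral *)
Lemma kern_interpolation (m x u l w : R) : 0 < l -> 0 <= u <= 1 ->
  kern (m + u) x w <= (1 - u) * Rpower l u * kern m x w + u * Rpower l (u - 1) * kern (m + 1) x w.
Proof.
  intros Hl Hu; destruct (Rlt_dec 0 w) as [Hw|Hw]; [|rewrite !kern_npos by lra; lra].
  assert (Hwl : 0 < / (w * l)) by (apply Rinv_0_lt_compat; now apply Rmult_lt_0_compat).
  assert (B := Rpower_le_affine (/ (w * l)) u Hwl Hu).
  assert (E1 : kern (m + u) x w = Rpower l u * Rpower (/ (w * l)) u * kern m x w).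
  { rewrite !kern_pos by assumption. unfold Rpower.
    rewrite <- !exp_plus; f_equal.
    rewrite ln_Rinv, ln_mult by (try apply Rmult_lt_0_compat; assumption). ring. }
  assert (E2 : kern (m + 1) x w = kern m x w / w).
  { replace m with (m + 1 - 1) at 2 by ring; rewrite kern_shift; field; lra. }
  assert (E3 : Rpower l (u - 1) = Rpower l u / l).
  { unfold Rminus, Rdiv; rewrite Rpower_plus, Rpower_Ropp, Rpower_1 by exact Hl; reflexivity. }
  rewrite E1, E2, E3.
  replace ((1 - u) * Rpower l u * kern m x w + u * (Rpower l u / l) * (kern m x w / w))
    with (Rpower l u * (1 - u + u * / (w * l)) * kern m x w) by (field; lra).
  apply Rmult_le_compat_r; [apply kern_ge0|].
  apply Rmult_le_compat_l; [left; apply Rpower_pos|exact B].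
Qed.

(** Log-convexity of [F] in the order, in the form of the weighted
    arithmetic-geometric inequality. *)
Lemma F_interpolation (m x u l : R) : 0 < x -> 0 < l -> 0 <= u <= 1 ->
  F (m + u) x <= (1 - u) * Rpower l u * F m x + u * Rpower l (u - 1) * F (m + 1) x.
Proof.
  intros Hx Hl Hu.
  assert (I : is_RInt (fun w => (1 - u) * Rpower l u * kern m x w
                 + u * Rpower l (u - 1) * kern (m + 1) x w) 0 1
      ((1 - u) * Rpower l u * F m x + u * Rpower l (u - 1) * F (m + 1) x)).
  { apply @is_RInt_plus; apply @is_RInt_scal;
      apply RInt_correct_R, ex_RInt_kern, Hx. }
  rewrite <- (is_RInt_unique_R _ _ _ _ I).
  apply RInt_le; [lra|now apply ex_RInt_kern|eexists; exact I|].
  intros w _; now apply kern_interpolation.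
Qed.

Lemma F_monotone (m x u : R) : 0 < x -> 0 <= u -> F m x <= F (m + u) x.
Proof.
  intros Hx Hu; apply RInt_le; try apply ex_RInt_kern; try lra.
  intros w Hw; rewrite !kern_pos by lra; apply exp_le.
  assert (ln w <= 0) by (assert (L := ln_le_sub_1 w ltac:(lra)); lra). nra.
Qed.

Lemma F_monotone_nat (m x : R) (n : nat) : 0 < x -> F (m - INR n) x <= F m x.
Proof.
  intros Hx; replace m with (m - INR n + INR n) at 2 by ring.
  apply F_monotone; [exact Hx|apply pos_INR].
Qed.

Definition casoratian (A B : R -> R -> R) (nu x : R) : R :=
  A (nu + 1) x * B nu x - A nu x * B (nu + 1) x.

(** Both families satisfy the same three-term recurrence in the order. *)
Lemma casoratian_periodic (A B : R -> R -> R) (nu x : R) (n : nat) :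
  cylinder A -> cylinder B -> 0 < x -> casoratian A B (nu + INR n) x = casoratian A B nu x.
Proof.
  intros HA HB Hx; induction n as [|n IH]; [simpl; now rewrite Rplus_0_r|].
  rewrite S_INR, <- IH; unfold casoratian.
  destruct (HA (nu + INR n + 1) x Hx) as [_ EA]. destruct (HB (nu + INR n + 1) x Hx) as [_ EB].
  replace (nu + (INR n + 1)) with (nu + INR n + 1) by ring.
  replace (nu + INR n + 1 - 1) with (nu + INR n) in EA, EB by ring.
  set (r := 2 * (nu + INR n + 1) / x) in *.
  replace (A (nu + INR n + 1 + 1) x) with (r * A (nu + INR n + 1) x - A (nu + INR n) x) by lra.
  replace (B (nu + INR n + 1 + 1) x) with (r * B (nu + INR n + 1) x - B (nu + INR n) x) by lra.
  ring.
Qed.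

Lemma is_lim_seq_0_of_le (u v : nat -> R) :
  (forall n, Rabs (u n) <= v n) -> is_lim_seq v 0 -> is_lim_seq u 0.
Proof.
  intros H Hv; apply is_lim_seq_abs_0.
  apply (is_lim_seq_le_le (fun _ => 0) _ v 0); [|apply is_lim_seq_const|exact Hv].
  intros n; split; [apply Rabs_pos|apply H].
Qed.

Lemma is_lim_inv_INR : is_lim_seq (fun n => / INR n) 0.
Proof. apply (is_lim_seq_inv _ p_infty); [apply is_lim_seq_INR|discriminate]. Qed.

Section FixedArgument.

Variables (x c : R).
Hypothesis Hx : 0 < x.
Hypothesis Hc : 0 < c.
Hypothesis cyl_cas : forall nu, x * casoratian (cyl 0) (cyl (PI / 2)) nu x = c.

(** [2 n / x] is the growth rate of the orders: raising the order by [u] near [n]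
    divides [BesselJ] by about [(2 n / x) ^ u]. *)
Lemma BesselJ_ratio_lim (nu u : R) : 0 < nu -> 0 <= u ->
  is_lim_seq (fun n => Rpower (2 * INR n / x) u
     * (BesselJ (nu + u + INR n) x / BesselJ (nu + INR n) x)) 1.
Proof.
  intros Hnu Hu.
  assert (L1 := BesselJ_large_order (nu + u) x ltac:(lra) Hx).
  assert (L2 := BesselJ_large_order nu x Hnu Hx).
  assert (L := is_lim_seq_div' _ _ _ _ L1 L2 ltac:(lra)).
  replace (1 / 1) with 1 in L by field.
  assert (NZ : exists N, forall n, (N <= n)%nat -> BesselJ (nu + INR n) x <> 0).
  { assert (L' := L2); apply is_lim_seq_spec in L'.
    destruct (L' (mkposreal 1 Rlt_0_1)) as [N HN]; exists N; intros n Hn E.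
    specialize (HN n Hn); simpl in HN; rewrite E in HN.
    unfold Rdiv in HN; rewrite !Rmult_0_l, Rminus_0_l, Rabs_Ropp, Rabs_R1 in HN; lra. }
  destruct NZ as [N NZ].
  refine (is_lim_seq_ext_loc _ _ _ _ L).
  exists (S N); intros n Hn.
  assert (Pn : 0 < INR n) by (apply lt_0_INR; lia).
  assert (J0 := NZ n ltac:(lia)).
  assert (Pf := INR_fact_lt_0 n). assert (P1 := Rpower_pos (INR n) nu).
  assert (P2 := Rpower_pos (x / 2) (nu + INR n)).
  assert (P3 := Rpower_pos (x / 2) u). assert (P4 := Rpower_pos (INR n) u).
  replace (nu + u + INR n) with (nu + INR n + u) by ring.
  rewrite (Rpower_plus (nu + INR n) u), (Rpower_plus nu u (INR n)).
  assert (E : Rpower (2 * INR n / x) u = Rpower (INR n) u / Rpower (x / 2) u).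
  { replace (2 * INR n / x) with (INR n * / (x / 2)) by (field; lra).
    rewrite <- Rpower_mult_distr by (try apply Rinv_0_lt_compat; lra).
    unfold Rdiv; f_equal. unfold Rpower; rewrite ln_Rinv, <- exp_Ropp by lra. f_equal; ring. }
  rewrite E; field; repeat split; lra.
Qed.

Lemma BesselJ_eventually_pos (nu : R) : 0 < nu ->
  exists N, forall n, (N <= n)%nat -> 0 < BesselJ (nu + INR n) x.
Proof.
  intros Hnu; assert (L := BesselJ_large_order nu x Hnu Hx).
  apply is_lim_seq_spec in L.
  destruct (L (mkposreal 1 Rlt_0_1)) as [N HN]; exists (S N); intros n Hn.
  specialize (HN n ltac:(lia)); simpl in HN; apply Rabs_lt_between in HN.
  assert (Pf := INR_fact_lt_0 n). assert (P1 := Rpower_pos (INR n) nu).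
  assert (P2 := Rpower_pos (x / 2) (nu + INR n)).
  assert (P3 : 0 < INR (fact n) * Rpower (INR n) nu / Rpower (x / 2) (nu + INR n))
    by (apply Rdiv_lt_0_compat; [now apply Rmult_lt_0_compat|exact P2]).
  assert (P : 0 < BesselJ (nu + INR n) x
     * (INR (fact n) * Rpower (INR n) nu / Rpower (x / 2) (nu + INR n))) by (unfold Rdiv in *; lra).
  destruct (Rle_lt_dec (BesselJ (nu + INR n) x) 0) as [H|H]; [nra|exact H].
Qed.

Lemma BesselJ_lim_0 (nu : R) : 0 < nu -> is_lim_seq (fun n => BesselJ (nu + INR n) x) 0.
Proof.
  intros Hnu.
  assert (L := BesselJ_large_order nu x Hnu Hx).
  assert (G : is_lim_seq (fun n => Rpower (x / 2) nu * ((x / 2) ^ n / INR (fact n))) 0).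
  { assert (C : is_lim_seq (fun n => (x / 2) ^ n / INR (fact n)) 0)
      by (apply is_lim_seq_Reals, cv_speed_pow_fact).
    apply (is_lim_seq_scal_l _ (Rpower (x / 2) nu)) in C; simpl in C; now rewrite Rmult_0_r in C. }
  assert (G' : is_lim_seq (fun n => Rpower (x / 2) nu * ((x / 2) ^ n / INR (fact n))
                                    / Rpower (INR n) nu) 0).
  { apply is_lim_seq_incr_1. apply is_lim_seq_incr_1 in G.
    refine (is_lim_seq_0_of_le _ _ _ G).
    intros n; set (v := Rpower (x / 2) nu * _).
    assert (Pv : 0 <= v).
    { unfold v; apply Rmult_le_pos; [left; apply Rpower_pos|].
      apply Rdiv_le_0_compat; [apply pow_le; lra|apply INR_fact_lt_0]. }
    assert (P : 1 <= Rpower (INR (S n)) nu).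
    { rewrite <- (Rpower_O (INR (S n))) by (apply lt_0_INR; lia).
      apply Rle_Rpower; [|lra]. rewrite S_INR; assert (H := pos_INR n); lra. }
    rewrite Rabs_pos_eq by (apply Rdiv_le_0_compat; lra).
    apply Rle_div_l; nra. }
  assert (M := is_lim_seq_mult' _ _ _ _ L G'). rewrite Rmult_0_r in M.
  refine (is_lim_seq_ext _ _ _ _ M); intros n.
  assert (Pf := INR_fact_lt_0 n). assert (P1 := Rpower_pos (INR n) nu).
  assert (P2 := Rpower_pos (x / 2) nu).
  assert (P3 : 0 < (x / 2) ^ n) by (apply pow_lt; lra).
  rewrite Rpower_plus, Rpower_pow by lra. field; lra.
Qed.

(** For large orders [cyl 0] stays bounded, while [cyl (PI / 2)] is [- F] up to a
    bounded term. *)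
Lemma cyl_bounded_order (nu : R) : exists M, 0 <= M /\
  forall n, Rabs (cyl 0 (nu + INR n) x) <= M /\
            Rabs (cyl (PI / 2) (nu + INR n) x + F (nu + INR n) x) <= M.
Proof.
  exists (PI + F (- nu) x); split.
  { assert (H := F_ge0 (- nu) x Hx). assert (H' := PI_RGT_0). lra. }
  intros n; unfold cyl; rewrite sin_0, sin_PI2.
  assert (B : F (- (nu + INR n)) x <= F (- nu) x).
  { replace (- (nu + INR n)) with (- nu - INR n) by ring; now apply F_monotone_nat. }
  assert (P := F_ge0 (- (nu + INR n)) x Hx).
  assert (S : forall t, - (F (- nu) x) <= sin t * F (- (nu + INR n)) x <= F (- nu) x).
  { intros t; assert (T := SIN_bound t). split; nra. }
  assert (S1 := S ((nu + INR n) * PI + 0)). assert (S2 := S ((nu + INR n) * PI + PI / 2)).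
  assert (O1 := abs_osc_le (0 + (nu + INR n) * (PI / 2)) (nu + INR n) x).
  assert (O2 := abs_osc_le (PI / 2 + (nu + INR n) * (PI / 2)) (nu + INR n) x).
  between.
  split; apply Rabs_le; lra.
Qed.

(** Both families stay bounded and [BesselJ] tends to [0] for large orders, so
    their Casoratian, which is periodic in the order, vanishes. *)
Lemma casoratian_BesselJ_cyl (nu : R) : casoratian BesselJ (cyl 0) nu x = 0.
Proof.
  destruct (INR_unbounded (Rabs nu)) as [N HN].
  set (mu := nu + INR N).
  assert (Hmu : 0 < mu) by (unfold mu; assert (A := Rabs_maj2 nu); lra).
  rewrite <- (casoratian_periodic _ _ nu x N cylinder_BesselJ (cylinder_cyl 0) Hx).
  fold mu.
  destruct (cyl_bounded_order mu) as [M [PM HM]].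
  assert (L0 := BesselJ_lim_0 mu Hmu).
  assert (L1 := BesselJ_lim_0 (mu + 1) ltac:(lra)).
  apply is_lim_seq_abs in L0. apply is_lim_seq_abs in L1.
  assert (Z : is_lim_seq (fun n => M * (Rabs (BesselJ (mu + 1 + INR n) x)
                                 + Rabs (BesselJ (mu + INR n) x))) 0).
  { assert (P := is_lim_seq_plus' _ _ _ _ L1 L0).
    simpl in P; rewrite Rabs_R0 in P.
    apply (is_lim_seq_scal_l _ M) in P; simpl in P. now rewrite Rplus_0_r, Rmult_0_r in P. }
  assert (C : is_lim_seq (fun _ => casoratian BesselJ (cyl 0) mu x) 0).
  { refine (is_lim_seq_0_of_le _ _ _ Z); intros n.
    rewrite <- (casoratian_periodic _ _ mu x n cylinder_BesselJ (cylinder_cyl 0) Hx).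
    unfold casoratian.
    destruct (HM n) as [B0 _]. destruct (HM (S n)) as [B1 _].
    rewrite S_INR in B1; replace (mu + (INR n + 1)) with (mu + INR n + 1) in B1 by ring.
    replace (mu + 1 + INR n) with (mu + INR n + 1) by ring.
    unfold Rminus; eapply Rle_trans; [apply Rabs_triang|].
    rewrite Rabs_Ropp, !Rabs_mult.
    assert (A0 := Rabs_pos (BesselJ (mu + INR n) x)).
    assert (A1 := Rabs_pos (BesselJ (mu + INR n + 1) x)). nra. }
  apply is_lim_seq_unique in C. rewrite Lim_seq_const in C.
  exact (f_equal real C).
Qed.

(** Cramer's rule for [BesselJ = kappa * cyl 0], the coefficient of [cyl (PI / 2)]
    being [0] by [casoratian_BesselJ_cyl]. *)
Definition kappa (nu : R) : R := x / c * casoratian BesselJ (cyl (PI / 2)) nu x.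

Lemma BesselJ_eq_kappa (nu : R) : BesselJ nu x = kappa nu * cyl 0 nu x.
Proof.
  unfold kappa; assert (Z := casoratian_BesselJ_cyl nu). assert (E := cyl_cas nu).
  unfold casoratian in *.
  apply (Rmult_eq_reg_l c); [|lra].
  rewrite <- E at 1.
  transitivity (x * (BesselJ (nu + 1) x * cyl 0 nu x * cyl (PI / 2) nu x
      - BesselJ nu x * cyl 0 nu x * cyl (PI / 2) (nu + 1) x)).
  - replace (BesselJ (nu + 1) x * cyl 0 nu x) with (BesselJ nu x * cyl 0 (nu + 1) x) by lra. ring.
  - field; lra.
Qed.

Lemma kappa_periodic (nu : R) (n : nat) : kappa (nu + INR n) = kappa nu.
Proof.
  unfold kappa; f_equal; apply casoratian_periodic;
    [exact cylinder_BesselJ|apply cylinder_cyl|exact Hx].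
Qed.

(** For large orders only the product of the decaying [BesselJ] with the growing
    [F] of the next order survives in the Casoratian. *)
Lemma kappa_lim (nu : R) : 0 < nu ->
  is_lim_seq (fun n => BesselJ (nu + INR n) x * F (nu + INR n + 1) x) (c / x * kappa nu).
Proof.
  intros Hnu.
  destruct (cyl_bounded_order nu) as [M [PM HM]].
  assert (L0 := BesselJ_lim_0 nu Hnu).
  assert (L1 := BesselJ_lim_0 (nu + 1) ltac:(lra)).
  set (P := fun n => BesselJ (nu + INR n) x * F (nu + INR n + 1) x).
  set (r := fun n => BesselJ (nu + 1 + INR n) x / BesselJ (nu + INR n) x
                     * (F (nu + INR n) x / F (nu + INR n + 1) x)).
  assert (Fpos : forall n, 0 < F (nu + INR n + 1) x).
  { intros n; assert (B := F_ge_inv (nu + INR n) x Hx ltac:(assert (H := pos_INR n); lra)).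
    assert (0 < / x) by now apply Rinv_0_lt_compat. lra. }
  assert (Hr : is_lim_seq r 0).
  { assert (R1 := BesselJ_ratio_lim nu 1 Hnu ltac:(lra)).
    apply is_lim_seq_abs in R1; simpl in R1; rewrite Rabs_R1 in R1.
    assert (R2 := is_lim_seq_mult' _ _ _ _ R1 is_lim_inv_INR); rewrite Rmult_0_r in R2.
    apply (is_lim_seq_scal_l _ (x / 2)) in R2; simpl in R2; rewrite Rmult_0_r in R2.
    apply is_lim_seq_incr_1 in R2. apply is_lim_seq_incr_1.
    refine (is_lim_seq_0_of_le _ _ _ R2); intros n.
    set (m := S n). assert (Pm : 0 < INR m) by (apply lt_0_INR; lia).
    rewrite Rpower_1 by (apply Rdiv_lt_0_compat; lra).
    rewrite Rabs_mult, (Rabs_pos_eq (2 * INR m / x))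
      by (apply Rdiv_le_0_compat; lra).
    unfold r; rewrite Rabs_mult.
    assert (Q := Fpos m).
    assert (Q' := F_monotone (nu + INR m) x 1 Hx ltac:(lra)).
    assert (Q0 := F_ge0 (nu + INR m) x Hx).
    rewrite (Rabs_pos_eq (F _ _ / _)) by (apply Rdiv_le_0_compat; lra).
    set (a := Rabs (BesselJ (nu + 1 + INR m) x / BesselJ (nu + INR m) x)).
    assert (Pa : 0 <= a) by apply Rabs_pos.
    replace (x / 2 * (2 * INR m / x * a * / INR m)) with (a * 1) by (field; lra).
    apply Rmult_le_compat_l; [exact Pa|]. apply Rle_div_l; lra. }
  assert (Hm : is_lim_seq (fun n => P n * (1 - r n)) (c / x * kappa nu)).
  { set (e := fun n => BesselJ (nu + INR n) x * (cyl (PI / 2) (nu + INR (S n)) x + F (nu + INR (S n)) x)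
                - BesselJ (nu + 1 + INR n) x * (cyl (PI / 2) (nu + INR n) x + F (nu + INR n) x)).
    assert (He : is_lim_seq e 0).
    { apply is_lim_seq_abs in L0. apply is_lim_seq_abs in L1.
      assert (Q := is_lim_seq_plus' _ _ _ _ L1 L0).
      simpl in Q; rewrite Rabs_R0 in Q.
      apply (is_lim_seq_scal_l _ M) in Q; simpl in Q; rewrite Rplus_0_r, Rmult_0_r in Q.
      refine (is_lim_seq_0_of_le _ _ _ Q); intros n; unfold e.
      unfold Rminus; eapply Rle_trans; [apply Rabs_triang|].
      rewrite Rabs_Ropp, !Rabs_mult.
      destruct (HM n) as [_ B0]. destruct (HM (S n)) as [_ B1].
      assert (A0 := Rabs_pos (BesselJ (nu + INR n) x)).
      assert (A1 := Rabs_pos (BesselJ (nu + 1 + INR n) x)). nra. }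
    assert (Hs := is_lim_seq_plus' _ _ _ _ (is_lim_seq_const (c / x * kappa nu)) He).
    rewrite Rplus_0_r in Hs.
    destruct (BesselJ_eventually_pos nu Hnu) as [N HN].
    refine (is_lim_seq_ext_loc _ _ _ _ Hs); exists N; intros n Hn.
    rewrite <- (kappa_periodic nu n); unfold kappa, casoratian, e, P, r.
    assert (J0 := HN n Hn). assert (F0 := Fpos n).
    rewrite S_INR; replace (nu + (INR n + 1)) with (nu + INR n + 1) by ring.
    replace (nu + 1 + INR n) with (nu + INR n + 1) by ring.
    field; repeat split; lra. }
  assert (H1 := is_lim_seq_minus' _ _ _ _ (is_lim_seq_const 1) Hr); rewrite Rminus_0_r in H1.
  assert (H : is_lim_seq (fun n => P n * (1 - r n) / (1 - r n)) (c / x * kappa nu / 1)).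
  { apply is_lim_seq_div'. exact Hm. exact H1. lra. }
  rewrite Rdiv_1_r in H.
  refine (is_lim_seq_ext_loc _ _ _ _ H).
  apply is_lim_seq_spec in Hr. destruct (Hr (mkposreal 1 Rlt_0_1)) as [N HN].
  exists N; intros n Hn; specialize (HN n Hn); simpl in HN.
  rewrite Rminus_0_r in HN; apply Rabs_lt_between in HN.
  change (P n * (1 - r n) / (1 - r n) = P n). field; lra.
Qed.

(** [F_interpolation] with [l = 2 n / x] bounds [BesselJ * F] at order
    [nu + u + n] by a convex combination of its values at orders [nu + n] and
    [nu + n + 1], up to factors that tend to [1]. *)
Lemma kappa_le (nu u : R) : 0 < nu -> 0 <= u <= 1 -> kappa (nu + u) <= kappa nu.
Proof.
  intros Hnu Hu.
  assert (Lu := kappa_lim (nu + u) ltac:(lra)).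
  assert (L := kappa_lim nu Hnu).
  assert (L' := proj1 (is_lim_seq_incr_1 _ _) L).
  assert (Ru := BesselJ_ratio_lim nu u Hnu (proj1 Hu)).
  assert (R1 := BesselJ_ratio_lim nu 1 Hnu ltac:(lra)).
  destruct (BesselJ_eventually_pos nu Hnu) as [N1 HN1].
  destruct (BesselJ_eventually_pos (nu + u) ltac:(lra)) as [N2 HN2].
  set (P := fun n => BesselJ (nu + INR n) x * F (nu + INR n + 1) x) in *.
  set (ru := fun n => Rpower (2 * INR n / x) u
     * (BesselJ (nu + u + INR n) x / BesselJ (nu + INR n) x)) in *.
  set (r1 := fun n => Rpower (2 * INR n / x) 1
     * (BesselJ (nu + 1 + INR n) x / BesselJ (nu + INR n) x)) in *.
  assert (Rhs : is_lim_seq (fun n => (1 - u) * (ru n * P n) + u * (ru n / r1 n * P (S n)))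
            ((1 - u) * (1 * (c / x * kappa nu)) + u * (1 / 1 * (c / x * kappa nu)))).
  { apply is_lim_seq_plus'.
    - apply (is_lim_seq_scal_l _ (1 - u) (Finite _)), is_lim_seq_mult'; assumption.
    - apply (is_lim_seq_scal_l _ u (Finite _)), is_lim_seq_mult'; [|exact L'].
      apply is_lim_seq_div'; auto; lra. }
  replace ((1 - u) * (1 * (c / x * kappa nu)) + u * (1 / 1 * (c / x * kappa nu)))
    with (c / x * kappa nu) in Rhs by (field; lra).
  assert (B : c / x * kappa (nu + u) <= c / x * kappa nu).
  { refine (is_lim_seq_le_loc _ _ (Finite _) (Finite _) _ Lu Rhs).
    exists (S (N1 + N2)); intros n Hn.
    assert (Pn : 0 < INR n) by (apply lt_0_INR; lia).
    assert (Hl : 0 < 2 * INR n / x) by (apply Rdiv_lt_0_compat; lra).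
    assert (J0 := HN1 n ltac:(lia)). assert (J1 := HN1 (S n) ltac:(lia)).
    assert (J2 := HN2 n ltac:(lia)).
    assert (I := F_interpolation (nu + INR n + 1) x u (2 * INR n / x) Hx Hl Hu).
    unfold ru, r1, P.
    rewrite S_INR in *.
    replace (nu + (INR n + 1)) with (nu + INR n + 1) in * by ring.
    replace (nu + 1 + INR n) with (nu + INR n + 1) by ring.
    replace (nu + u + INR n + 1) with (nu + INR n + 1 + u) by ring.
    assert (Pl := Rpower_pos (2 * INR n / x) u).
    assert (E3 : Rpower (2 * INR n / x) (u - 1) = Rpower (2 * INR n / x) u / (2 * INR n / x)).
    { unfold Rminus, Rdiv at 2; rewrite Rpower_plus, Rpower_Ropp, Rpower_1 by exact Hl; reflexivity. }
    rewrite E3 in I. rewrite (Rpower_1 (2 * INR n / x)) by exact Hl.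
    set (l := Rpower (2 * INR n / x) u) in *.
    apply (Rmult_le_compat_l (BesselJ (nu + u + INR n) x)) in I; [|lra].
    eapply Rle_trans; [exact I|]. right. field. repeat split; lra. }
  assert (0 < c / x) by (now apply Rdiv_lt_0_compat).
  apply (Rmult_le_reg_l (c / x)); assumption.
Qed.

(** Periodicity turns the inequality [kappa_le] around. *)
Lemma kappa_constant (nu : R) : kappa nu = kappa 1.
Proof.
  assert (unit : forall m u, 0 < m -> 0 <= u <= 1 -> kappa (m + u) = kappa m).
  { intros m u Hm Hu; apply Rle_antisym; [now apply kappa_le|].
    assert (B := kappa_le (m + u) (1 - u) ltac:(lra) ltac:(lra)).
    replace (m + u + (1 - u)) with (m + INR 1) in B by (simpl; ring).
    now rewrite kappa_periodic in B. }
  assert (step : forall N t, 0 <= t <= INR (S N) -> kappa (1 + t) = kappa 1).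
  { induction N as [|N IH]; intros t Ht; [apply unit; simpl in Ht; lra|].
    destruct (Rle_dec t 1) as [H|H]; [apply unit; lra|].
    rewrite <- (IH (t - 1)) by (rewrite S_INR in Ht; lra).
    replace (1 + t) with (1 + (t - 1) + INR 1) by (simpl; ring). apply kappa_periodic. }
  destruct (INR_unbounded (Rabs nu + 1)) as [N HN].
  assert (A := Rabs_maj2 nu). assert (A' := Rle_abs nu).
  rewrite <- (kappa_periodic nu N).
  destruct (INR_unbounded (nu + INR N)) as [N' HN'].
  replace (nu + INR N) with (1 + (nu + INR N - 1)) by ring.
  apply (step N'); rewrite S_INR; lra.
Qed.

Lemma kappa_pos (nu : R) : 0 < kappa nu.
Proof.
  rewrite kappa_constant.
  destruct (BesselJ_eventually_pos 1 Rlt_0_1) as [N HN].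
  assert (H0 : 0 <= c / x * kappa 1).
  { refine (is_lim_seq_le_loc (fun _ => 0) _ (Finite 0) (Finite _) _ (is_lim_seq_const 0)
              (kappa_lim 1 Rlt_0_1)).
    exists N; intros n Hn; apply Rmult_le_pos; [left; now apply HN|now apply F_ge0]. }
  assert (Hcx : 0 < c / x) by (now apply Rdiv_lt_0_compat).
  destruct (Rle_lt_or_eq_dec 0 (kappa 1)) as [H|H]; [nra|exact H|exfalso].
  assert (J := HN N (le_n N)). rewrite BesselJ_eq_kappa, kappa_periodic, <- H in J. lra.
Qed.

End FixedArgument.

(** * The Bessel function of the second kind *)
Lemma F_lipschitz (nu h x : R) : 0 < x -> Rabs h <= 1 ->
  Rabs (F (nu + h) x - F nu x) <= Rabs h * F (nu + 1) x.
Proof.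
  intros Hx Hh.
  assert (main : forall m u, 0 <= u <= 1 -> 0 <= F (m + u) x - F m x <= u * F (m + 1) x).
  { intros m u Hu; assert (M := F_monotone m x u Hx ltac:(lra)).
    assert (I := F_interpolation m x u 1 Hx ltac:(lra) Hu).
    assert (E : forall v, Rpower 1 v = 1)
      by (intros v; unfold Rpower; now rewrite ln_1, Rmult_0_r, exp_0).
    rewrite !E in I. assert (P := F_ge0 m x Hx). nra. }
  destruct (Rle_dec 0 h) as [H|H].
  - rewrite (Rabs_pos_eq h) in * by lra.
    destruct (main nu h ltac:(lra)). rewrite Rabs_pos_eq; lra.
  - rewrite (Rabs_left h) in * by lra.
    destruct (main (nu + h) (- h) ltac:(lra)) as [A B].
    replace (nu + h + - h) with nu in A, B by ring.
    assert (M := F_monotone (nu + h + 1) x (- h) Hx ltac:(lra)).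
    replace (nu + h + 1 + - h) with (nu + 1) in M by ring.
    rewrite Rabs_minus_sym, Rabs_pos_eq by lra. nra.
Qed.

Lemma osc_lipschitz (a b nu mu x : R) :
  Rabs (osc a nu x - osc b mu x) <= 4 * (Rabs (a - b) + 2 * Rabs (nu - mu)).
Proof.
  assert (HPI := PI_RGT_0). assert (HPI4 := PI_4).
  set (C := Rabs (a - b) + 2 * Rabs (nu - mu)).
  assert (PC : 0 <= C).
  { unfold C; assert (A := Rabs_pos (a - b)); assert (B := Rabs_pos (nu - mu)); lra. }
  assert (I : is_RInt (fun t => cos (x * cos t - a) * cos (nu * t)
                               - cos (x * cos t - b) * cos (mu * t)) 0 (PI / 2)
     (RInt (fun t => cos (x * cos t - a) * cos (nu * t)) 0 (PI / 2)
      - RInt (fun t => cos (x * cos t - b) * cos (mu * t)) 0 (PI / 2))).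
  { apply @is_RInt_minus; apply RInt_correct_R, ex_RInt_osc. }
  assert (B : Rabs (RInt (fun t => cos (x * cos t - a) * cos (nu * t)
                               - cos (x * cos t - b) * cos (mu * t)) 0 (PI / 2))
              <= (PI / 2 - 0) * C).
  { apply abs_RInt_le_const; [lra|eexists; exact I|]; intros t Ht.
    replace (cos (x * cos t - a) * cos (nu * t) - cos (x * cos t - b) * cos (mu * t))
      with ((cos (x * cos t - a) - cos (x * cos t - b)) * cos (nu * t)
            + cos (x * cos t - b) * (cos (nu * t) - cos (mu * t))) by ring.
    eapply Rle_trans; [apply Rabs_triang|]; rewrite !Rabs_mult.
    assert (B1 := cos_lipschitz (x * cos t - a) (x * cos t - b)).
    assert (B2 := cos_lipschitz (nu * t) (mu * t)).
    replace (x * cos t - a - (x * cos t - b)) with (- (a - b)) in B1 by ring.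
    replace (nu * t - mu * t) with ((nu - mu) * t) in B2 by ring.
    rewrite Rabs_Ropp in B1. rewrite Rabs_mult, (Rabs_pos_eq t) in B2 by lra.
    assert (B3 := abs_cos_le_1 (nu * t)).
    assert (B4 := abs_cos_le_1 (x * cos t - b)).
    assert (P1 := Rabs_pos (cos (nu * t))). assert (P2 := Rabs_pos (cos (x * cos t - b))).
    assert (P3 := Rabs_pos (cos (x * cos t - a) - cos (x * cos t - b))).
    assert (P4 := Rabs_pos (cos (nu * t) - cos (mu * t))).
    assert (P5 := Rabs_pos (nu - mu)).
    assert (Rabs (nu - mu) * t <= Rabs (nu - mu) * 2) by (apply Rmult_le_compat_l; lra).
    unfold C; nra. }
  rewrite (is_RInt_unique_R _ _ _ _ I) in B.
  unfold osc; rewrite <- Rmult_minus_distr_l, Rabs_mult, (Rabs_pos_eq 2) by lra.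
  assert (PI / 2 * C <= 2 * C) by (apply Rmult_le_compat_r; lra).
  fold C; lra.
Qed.

Lemma is_lim_cyl_order (nu x : R) : 0 < x ->
  is_lim (fun m => cyl (PI / 2) m x) nu (cyl (PI / 2) nu x).
Proof.
  intros Hx; assert (HPI := PI_RGT_0). assert (HPI4 := PI_4).
  set (K := 4 * (PI / 2 + 2) + F (nu + 1) x + (PI * (F (- nu + 1) x + F (- nu) x) + F (- nu + 1) x)).
  assert (P1 := F_ge0 (nu + 1) x Hx). assert (P2 := F_ge0 (- nu + 1) x Hx).
  assert (P3 := F_ge0 (- nu) x Hx).
  assert (PK : 0 < K).
  { assert (0 <= PI * (F (- nu + 1) x + F (- nu) x)) by (apply Rmult_le_pos; lra).
    unfold K; lra. }
  assert (lip : forall m, Rabs (m - nu) <= 1 ->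
     Rabs (cyl (PI / 2) m x - cyl (PI / 2) nu x) <= K * Rabs (m - nu)).
  { intros m Hm; set (h := m - nu) in *.
    replace m with (nu + h) by (unfold h; ring).
    unfold cyl; rewrite sin_PI2.
    assert (O := osc_lipschitz (PI / 2 + (nu + h) * (PI / 2)) (PI / 2 + nu * (PI / 2)) (nu + h) nu x).
    replace (PI / 2 + (nu + h) * (PI / 2) - (PI / 2 + nu * (PI / 2))) with (h * (PI / 2)) in O by ring.
    replace (nu + h - nu) with h in O by ring.
    rewrite Rabs_mult, (Rabs_pos_eq (PI / 2)) in O by lra.
    assert (L1 := F_lipschitz nu h x Hx Hm).
    assert (L2 := F_lipschitz (- nu) (- h) x Hx ltac:(now rewrite Rabs_Ropp)).
    rewrite Rabs_Ropp in L2. replace (- nu + - h) with (- (nu + h)) in L2 by ring.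
    assert (S := sin_lipschitz ((nu + h) * PI + PI / 2) (nu * PI + PI / 2)).
    replace ((nu + h) * PI + PI / 2 - (nu * PI + PI / 2)) with (h * PI) in S by ring.
    rewrite Rabs_mult, (Rabs_pos_eq PI) in S by lra.
    assert (Ph := Rabs_pos h).
    assert (S1 := abs_sin_le_1 ((nu + h) * PI + PI / 2)).
    assert (S2 := abs_sin_le_1 (nu * PI + PI / 2)).
    set (s := sin ((nu + h) * PI + PI / 2)) in *. set (s0 := sin (nu * PI + PI / 2)) in *.
    set (f := F (- (nu + h)) x) in *. set (f0 := F (- nu) x) in *.
    assert (T : Rabs (s * f - s0 * f0) <= Rabs h * (PI * (F (- nu + 1) x + f0) + F (- nu + 1) x)).
    { replace (s * f - s0 * f0) with ((s - s0) * f0 + s * (f - f0)) by ring.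
      eapply Rle_trans; [apply Rabs_triang|]; rewrite !Rabs_mult, (Rabs_pos_eq f0) by exact P3.
      assert (Q1 := Rabs_pos (f - f0)). assert (Q2 := Rabs_pos s).
      assert (Rabs (s - s0) * f0 <= Rabs h * PI * f0) by (apply Rmult_le_compat_r; assumption).
      assert (Rabs s * Rabs (f - f0) <= 1 * (Rabs h * F (- nu + 1) x))
        by (apply Rmult_le_compat; assumption).
      assert (0 <= Rabs h * PI * F (- nu + 1) x) by (apply Rmult_le_pos; [apply Rmult_le_pos|]; lra). lra. }
    between.
    apply Rabs_le; unfold K; fold f0; lra. }
  apply is_lim_spec; intros eps; simpl.
  assert (Hd : 0 < Rmin 1 (eps / K)).
  { apply Rmin_case; [lra|]; apply Rdiv_lt_0_compat; [apply cond_pos|exact PK]. }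
  exists (mkposreal _ Hd); intros m Hm _.
  change (Rabs (m - nu) < Rmin 1 (eps / K)) in Hm.
  assert (H1 := Rmin_l 1 (eps / K)). assert (H2 := Rmin_r 1 (eps / K)).
  eapply Rle_lt_trans; [apply lip; lra|].
  rewrite Rmult_comm; apply Rlt_div_r; lra.
Qed.

Lemma locally'_sin_neq_0 (nu : R) : sin (nu * PI) = 0 ->
  Rbar_locally' nu (fun m => sin (m * PI) <> 0).
Proof.
  intros Hs; exists (mkposreal 1 Rlt_0_1); intros m Hm Hne.
  change (Rabs (m - nu) < 1) in Hm.
  assert (HPI := PI_RGT_0).
  replace (m * PI) with (nu * PI + (m - nu) * PI) by ring.
  rewrite sin_plus, Hs, Rmult_0_l, Rplus_0_l.
  assert (Hc : cos (nu * PI) <> 0).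
  { intros Hc; assert (T := sin2_cos2 (nu * PI)); rewrite Hs, Hc in T; unfold Rsqr in T; lra. }
  apply Rmult_integral_contrapositive_currified; [exact Hc|].
  apply Rabs_lt_between in Hm.
  destruct (Rlt_dec 0 (m - nu)) as [H|H].
  - assert (0 < sin ((m - nu) * PI)) by (apply sin_gt_0; nra). lra.
  - assert (H' : m - nu < 0) by lra.
    replace ((m - nu) * PI) with (- ((nu - m) * PI)) by ring; rewrite sin_neg.
    assert (0 < sin ((nu - m) * PI)) by (apply sin_gt_0; nra). lra.
Qed.

(** The definition of [BesselY] undoes the rotation by [- nu * PI] that
    [cyl_reflection] performs. *)
Lemma BesselY_eq (k nu x : R) : 0 < x -> (forall m, BesselJ m x = k * cyl 0 m x) ->
  BesselY nu x = k * cyl (PI / 2) nu x.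
Proof.
  intros Hx HJ.
  assert (Q : forall m, sin (m * PI) <> 0 -> BesselY_quotient m x = k * cyl (PI / 2) m x).
  { intros m Hm; unfold BesselY_quotient; rewrite !HJ, cyl_reflection, (cyl_lin (0 - m * PI)).
    replace (0 - m * PI) with (- (m * PI)) by ring. rewrite cos_neg, sin_neg. field; exact Hm. }
  unfold BesselY; destruct (Req_dec_T (sin (nu * PI)) 0) as [Hs|Hs]; [|now apply Q].
  assert (L : is_lim (fun a => BesselY_quotient a x) nu (k * cyl (PI / 2) nu x)).
  { apply (is_lim_ext_loc (fun m => k * cyl (PI / 2) m x)).
    - apply (filter_imp (fun m => sin (m * PI) <> 0)); [|now apply locally'_sin_neq_0].
      intros m Hm; symmetry; now apply Q.
    - apply (is_lim_scal_l _ k nu (Finite _)), is_lim_cyl_order, Hx. }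
  now rewrite (is_lim_unique _ _ _ L).
Qed.

Lemma cylinder_ext_scal (A C : R -> R -> R) (k : R) :
  cylinder C -> (forall nu x, 0 < x -> A nu x = k * C nu x) -> cylinder A.
Proof.
  intros HC E nu x Hx; destruct (HC nu x Hx) as [D R0]; split.
  - apply is_derive_ext_loc with (fun y => k * C nu y).
    { apply (filter_imp (fun y => 0 < y)); [intros y Hy; symmetry; now apply E|].
      now apply locally_lt. }
    rewrite !E by exact Hx.
    eapply is_derive_eq; [apply der_scal, D|ring].
  - rewrite !E by exact Hx. rewrite <- Rmult_plus_distr_l, R0; ring.
Qed.

Lemma eq_0_of_continuous (f : R -> R) :
  continuity_pt f 0 -> (forall x, 0 < x < 1 -> f x = 0) -> f 0 = 0.
Proof.
  intros Hc Hf; destruct (Req_dec (f 0) 0) as [H|H]; [exact H|exfalso].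
  destruct (Hc (Rabs (f 0)) (Rabs_pos_lt _ H)) as [d [Hd Hlim]].
  assert (Hm : 0 < Rmin (d / 2) (1 / 2)) by (apply Rmin_case; lra).
  assert (M1 := Rmin_l (d / 2) (1 / 2)). assert (M2 := Rmin_r (d / 2) (1 / 2)).
  set (y := Rmin (d / 2) (1 / 2)) in *.
  assert (B : R_dist (f y) (f 0) < Rabs (f 0)).
  { apply Hlim; split; [split; [exact I|lra]|].
    simpl; unfold R_dist; rewrite Rminus_0_r, Rabs_pos_eq; lra. }
  unfold R_dist in B; rewrite (Hf y) in B by lra.
  rewrite Rminus_0_l, Rabs_Ropp in B. lra.
Qed.

(** [A] is the common amplitude of [sqrt x * J] and [sqrt x * Y] at infinity; by
    [hankel_wronskian] it also normalises the Wronskian. *)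
Record hankel_pair (A : R) : Prop := {
  hankel_amplitude : 0 < A;
  hankel_J : cylinder BesselJ;
  hankel_Y : cylinder BesselY;
  hankel_wronskian : forall nu x, 0 < x -> x * casoratian BesselJ BesselY nu x = A ^ 2;
  hankel_limJ : forall nu,
    is_lim (fun x => sqrt x * BesselJ nu x - A * cos (x - nu * (PI / 2) - PI / 4)) p_infty 0;
  hankel_limY : forall nu,
    is_lim (fun x => sqrt x * BesselY nu x - A * sin (x - nu * (PI / 2) - PI / 4)) p_infty 0 }.

(** With [J = k * cyl 0] and [Y = k * cyl (PI / 2)], the complex constant in the
    asymptotics has components [k * p] and [k * q]; the behaviour at [0] of
    [sqrt x * BesselJ (1 / 2) x = k * wave p q x] shows [p = 0] and [0 < q]. *)
Theorem ex_hankel_pair : exists A, hankel_pair A.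
Proof.
  destruct cyl_half as [p [q Hhalf]]; fold (wave p q) in Hhalf.
  change (forall b x, 0 < x -> sqrt x * cyl b (1 / 2) x = wave p q (x - b)) in Hhalf.
  assert (Hc := wave_amplitude_pos p q Hhalf).
  set (c := p ^ 2 + q ^ 2) in *.
  assert (cas : forall x, 0 < x -> forall nu, x * casoratian (cyl 0) (cyl (PI / 2)) nu x = c)
    by (intros x Hx nu; now apply cyl_casoratian).
  set (k := kappa 1 c 1).
  assert (Hk : 0 < k) by (apply kappa_pos; [lra|exact Hc|apply cas; lra]).
  assert (Ek : forall x nu, 0 < x -> kappa x c nu = k).
  { intros x nu Hx; rewrite (kappa_constant x c) by auto.
    unfold k; apply (constant_of_derive_0 (fun x => kappa x c 1)); [|exact Hx|lra].
    intros y Hy; unfold kappa.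
    apply is_derive_ext with (fun z => / c * (z * casoratian BesselJ (cyl (PI / 2)) 1 z)).
    { intros z; unfold Rdiv; simpl; ring. }
    eapply is_derive_eq.
    - apply der_scal, is_derive_casoratian;
        [exact cylinder_BesselJ|apply cylinder_cyl|exact Hy].
    - cbv beta; ring. }
  assert (EJ : forall nu x, 0 < x -> BesselJ nu x = k * cyl 0 nu x).
  { intros nu x Hx; rewrite (BesselJ_eq_kappa x c) by auto. now rewrite Ek. }
  assert (EY : forall nu x, 0 < x -> BesselY nu x = k * cyl (PI / 2) nu x)
    by (intros nu x Hx; apply BesselY_eq; auto).
  assert (half : forall x, 0 < x -> k * wave p q x = x * (/ sqrt 2 * serJ (1 / 2) ((x / 2) ^ 2))).
  { intros x Hx; rewrite <- (Rminus_0_r x) at 1; rewrite <- Hhalf by exact Hx.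
    transitivity (sqrt x * BesselJ (1 / 2) x); [rewrite EJ by exact Hx; ring|].
    rewrite BesselJ_serJ. replace (1 / 2) with (/ 2) at 1 by field.
    rewrite Rpower_sqrt, sqrt_div by lra.
    assert (E := sqrt_sqrt x ltac:(lra)). assert (H2 := sqrt_lt_R0 2 ltac:(lra)).
    rewrite <- E at 4. field; lra. }
  assert (cser : continuity_pt (fun x => serJ (1 / 2) ((x / 2) ^ 2)) 0).
  { eapply continuity_pt_of_is_derive.
    apply (der_comp (serJ (1 / 2)) (fun x => (x / 2) ^ 2)); [|apply is_derive_serJ].
    apply (is_derive_eq _ _ _ (2 * (0 / 2) * / 2)); [auto_derive; [trivial|field]|reflexivity]. }
  assert (Hp : p = 0).
  { assert (Z : k * wave p q 0 - 0 * (/ sqrt 2 * serJ (1 / 2) ((0 / 2) ^ 2)) = 0).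
    { apply (eq_0_of_continuous
        (fun x => k * wave p q x - x * (/ sqrt 2 * serJ (1 / 2) ((x / 2) ^ 2)))).
      - apply continuity_pt_minus.
        + unfold wave; eapply continuity_pt_of_is_derive; auto_derive; [trivial|reflexivity].
        + apply continuity_pt_mult; [apply continuity_pt_id|].
          apply continuity_pt_mult; [now apply continuity_pt_const|exact cser].
      - intros x Hx; rewrite half by lra; ring. }
    unfold wave in Z; rewrite cos_0, sin_0 in Z. nra. }
  assert (Hq : 0 < q).
  { assert (P : 0 < rGamma (1 / 2 + 1)) by (apply rGamma_pos; lra).
    destruct (cser _ P) as [d [Hd Hlim]].
    assert (Hm : 0 < Rmin (d / 2) (1 / 2)) by (apply Rmin_case; lra).
    assert (M1 := Rmin_l (d / 2) (1 / 2)). assert (M2 := Rmin_r (d / 2) (1 / 2)).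
    set (y := Rmin (d / 2) (1 / 2)) in *.
    assert (B : R_dist (serJ (1 / 2) ((y / 2) ^ 2)) (serJ (1 / 2) ((0 / 2) ^ 2)) < rGamma (1 / 2 + 1)).
    { apply Hlim; split; [split; [exact I|lra]|].
      simpl; unfold R_dist; rewrite Rminus_0_r, Rabs_pos_eq; lra. }
    replace ((0 / 2) ^ 2) with 0 in B by field. rewrite serJ_0 in B.
    unfold R_dist in B; apply Rabs_lt_between in B.
    assert (E := half y Hm). unfold wave in E; rewrite Hp, Rmult_0_l, Rplus_0_l in E.
    assert (H2 := Rinv_0_lt_compat _ (sqrt_lt_R0 2 ltac:(lra))).
    assert (Hs : 0 < sin y) by (apply sin_gt_0; [exact Hm|]; assert (A := PI2_3_2); lra).
    assert (R1 : 0 < y * (/ sqrt 2 * serJ (1 / 2) ((y / 2) ^ 2)))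
      by (repeat apply Rmult_lt_0_compat; lra).
    rewrite <- E in R1.
    destruct (Rle_lt_dec q 0) as [Hq|Hq]; [|exact Hq].
    assert (0 <= k * (- q * sin y)) by (apply Rmult_le_pos; [|apply Rmult_le_pos]; lra). lra. }
  exists (k * q); constructor.
  - now apply Rmult_lt_0_compat.
  - exact cylinder_BesselJ.
  - now apply (cylinder_ext_scal _ (cyl (PI / 2)) k); [apply cylinder_cyl|].
  - intros nu x Hx; unfold casoratian; rewrite !EJ, !EY by exact Hx.
    assert (E := cas x Hx nu); unfold casoratian, c in E; rewrite Hp in E.
    transitivity (k ^ 2 * (x * (cyl 0 (nu + 1) x * cyl (PI / 2) nu x
       - cyl 0 nu x * cyl (PI / 2) (nu + 1) x))); [ring|rewrite E; ring].
  - intros nu; assert (H := is_lim_0_scal k _ (cyl_asymptotic p q 0 nu Hhalf)).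
    refine (is_lim_ext_loc _ _ _ _ _ H); exists 0; intros x Hx.
    rewrite EJ by exact Hx; unfold wave; rewrite Hp.
    replace (x - (0 + (nu - 1 / 2) * (PI / 2))) with (PI / 2 + (x - nu * (PI / 2) - PI / 4)) by field.
    rewrite <- cos_sin; ring.
  - intros nu; assert (H := is_lim_0_scal k _ (cyl_asymptotic p q (PI / 2) nu Hhalf)).
    refine (is_lim_ext_loc _ _ _ _ _ H); exists 0; intros x Hx.
    rewrite EY by exact Hx; unfold wave; rewrite Hp.
    replace (x - (PI / 2 + (nu - 1 / 2) * (PI / 2))) with (x - nu * (PI / 2) - PI / 4) by field.
    ring.
Qed.

(** * Continuous arguments of plane curves *)
Lemma is_derive_ext_near (f g : R -> R) (x d l : R) : 0 < d ->
  (forall y, Rabs (y - x) < d -> f y = g y) -> is_derive f x l -> is_derive g x l.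
Proof.
  intros Hd E; apply is_derive_ext_loc; exists (mkposreal d Hd); intros y Hy; now apply E.
Qed.

(** A continuous argument of a differentiable non-vanishing curve is
    differentiable, being locally an arctangent. *)
Lemma is_derive_phase (c s rho h : R -> R) (x c' s' d : R) : 0 < d ->
  (forall y, Rabs (y - x) < d -> 0 < rho y /\ c y = rho y * cos (h y) /\ s y = rho y * sin (h y)) ->
  continuity_pt h x -> is_derive c x c' -> is_derive s x s' ->
  is_derive h x ((c x * s' - c' * s x) / (c x ^ 2 + s x ^ 2)).
Proof.
  intros Hd E Hh Dc Ds.
  assert (HPI := PI_RGT_0).
  destruct (Hh (PI / 2) ltac:(lra)) as [d' [Hd' Hlim]].
  assert (Hm : 0 < Rmin d d') by (apply Rmin_case; assumption).
  assert (Hxd : Rabs (x - x) < d) by (rewrite Rminus_diag_eq, Rabs_R0; auto).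
  destruct (E x Hxd) as [Px [Ecx Esx]].
  set (N := fun y => s y * c x - c y * s x).
  set (M := fun y => c y * c x + s y * s x).
  assert (Mx : M x = rho x ^ 2).
  { unfold M; rewrite Ecx, Esx; assert (T := sin_cos_sq (h x)).
    transitivity (rho x ^ 2 * (sin (h x) * sin (h x) + cos (h x) * cos (h x))); [ring|rewrite T; ring]. }
  assert (Nx : N x = 0) by (unfold N; ring).
  apply (is_derive_ext_near (fun y => h x + atan (N y / M y)) h x (Rmin d d')); [exact Hm| |].
  - intros y Hy.
    assert (Hy1 := Rlt_le_trans _ _ _ Hy (Rmin_l d d')).
    assert (Hy2 := Rlt_le_trans _ _ _ Hy (Rmin_r d d')).
    destruct (E y Hy1) as [Py [Ecy Esy]].
    assert (B : Rabs (h y - h x) < PI / 2).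
    { destruct (Req_dec y x) as [->|Hne];
        [rewrite Rminus_diag_eq, Rabs_R0; auto; lra|].
      apply Hlim; split; [split; [exact I|auto]|exact Hy2]. }
    apply Rabs_lt_between in B.
    assert (Hcos : 0 < cos (h y - h x)) by (apply cos_gt_0; lra).
    assert (EN : N y = rho y * rho x * sin (h y - h x))
      by (unfold N; rewrite Ecy, Esy, Ecx, Esx, sin_minus; ring).
    assert (EM : M y = rho y * rho x * cos (h y - h x))
      by (unfold M; rewrite Ecy, Esy, Ecx, Esx, cos_minus; ring).
    replace (N y / M y) with (tan (h y - h x))
      by (rewrite EN, EM; unfold tan; field; repeat split; lra).
    rewrite atan_tan by lra. ring.
  - assert (PM : 0 < M x) by (rewrite Mx; apply pow_lt; exact Px).
    assert (DN : is_derive N x (s' * c x - c' * s x)).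
    { eapply is_derive_eq.
      - apply der_minus; apply der_mult;
          [exact Ds|apply @is_derive_const|exact Dc|apply @is_derive_const].
      - unfold zero; simpl; ring. }
    assert (DM : is_derive M x (c' * c x + s' * s x)).
    { eapply is_derive_eq.
      - apply der_plus; apply der_mult;
          [exact Dc|apply @is_derive_const|exact Ds|apply @is_derive_const].
      - unfold zero; simpl; ring. }
    eapply is_derive_eq.
    + apply der_plus; [apply @is_derive_const|].
      apply der_comp; [apply der_div; [exact DN|exact DM|lra]|].
      apply is_derive_Reals, derivable_pt_lim_atan.
    + cbv beta; rewrite Nx. unfold zero; simpl.
      replace (c x * (c x * 1) + s x * (s x * 1)) with (M x) by (unfold M; ring).
      field; lra.
Qed.

(** The principal argument of [p + i r], away from the negative half-axis. *)
Definition arg2 (p r : R) : R := 2 * atan (r / (p + sqrt (p ^ 2 + r ^ 2))).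

Lemma arg2_0 (p : R) : arg2 p 0 = 0.
Proof. unfold arg2, Rdiv; rewrite Rmult_0_l, atan_0; ring. Qed.

Lemma abs_arg2_lt (p r : R) : Rabs (arg2 p r) < PI.
Proof.
  unfold arg2; assert (B := atan_bound (r / (p + sqrt (p ^ 2 + r ^ 2)))).
  apply Rabs_def1; lra.
Qed.

Lemma abs_atan_le (t : R) : Rabs (atan t) <= Rabs t.
Proof.
  assert (H : Rabs (atan t - atan 0) <= Rabs (t - 0)).
  { apply (lipschitz_of_derive atan (fun z => / (1 + z ^ 2)));
      [intros z; apply is_derive_Reals, derivable_pt_lim_atan|intros z].
    assert (P := pow2_ge_0 z).
    rewrite Rabs_pos_eq by (left; apply Rinv_0_lt_compat; lra).
    rewrite <- Rinv_1; apply Rinv_le_contravar; lra. }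
  now rewrite atan_0, !Rminus_0_r in H.
Qed.

Lemma abs_arg2_le (p r : R) : 0 < p -> Rabs (arg2 p r) <= 2 * (Rabs r / p).
Proof.
  intros Hp; unfold arg2; rewrite Rabs_mult, (Rabs_pos_eq 2) by lra.
  apply Rmult_le_compat_l; [lra|].
  eapply Rle_trans; [apply abs_atan_le|].
  assert (Hs := sqrt_pos (p ^ 2 + r ^ 2)).
  unfold Rdiv; rewrite Rabs_mult, Rabs_inv, (Rabs_pos_eq (p + _)) by lra.
  apply Rmult_le_compat_l; [apply Rabs_pos|apply Rinv_le_contravar; lra].
Qed.

(** The half-angle form of the argument has one smooth formula on the whole slit
    plane. *)
Lemma is_derive_arg2 (P Q : R -> R) (x P' Q' : R) :
  is_derive P x P' -> is_derive Q x Q' -> 0 < P x + sqrt (P x ^ 2 + Q x ^ 2) ->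
  0 < P x ^ 2 + Q x ^ 2 ->
  is_derive (fun y => arg2 (P y) (Q y)) x ((P x * Q' - P' * Q x) / (P x ^ 2 + Q x ^ 2)).
Proof.
  intros DP DQ Hpos Hn.
  assert (DS : is_derive (fun y => sqrt (P y ^ 2 + Q y ^ 2)) x
            ((P x * P' + Q x * Q') / sqrt (P x ^ 2 + Q x ^ 2))).
  { eapply is_derive_eq.
    - apply (der_comp sqrt).
      + apply is_derive_ext with (fun y => P y * P y + Q y * Q y); [intros; simpl; ring|].
        apply der_plus; apply der_mult; eassumption.
      + apply is_derive_Reals, derivable_pt_lim_sqrt, Hn.
    - assert (Hs := sqrt_lt_R0 _ Hn). field. lra. }
  set (r := sqrt (P x ^ 2 + Q x ^ 2)) in *.
  assert (Hr : 0 < r) by now apply sqrt_lt_R0.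
  assert (Er : r * r = P x ^ 2 + Q x ^ 2) by (apply sqrt_sqrt; lra).
  unfold arg2; eapply is_derive_eq.
  - apply der_scal, der_comp.
    + apply der_div; [exact DQ|apply der_plus; [exact DP|exact DS]|fold r; lra].
    + apply is_derive_Reals, derivable_pt_lim_atan.
  - cbv beta; fold r.
    assert (E1 : 1 + (Q x / (P x + r)) ^ 2 = 2 * r / (P x + r)).
    { field_simplify_eq; [|lra]. nra. }
    rewrite E1, <- Er.
    assert (E2 : Q x ^ 2 = r * r - P x ^ 2) by lra.
    field_simplify_eq; [|repeat split; lra].
    replace (Q x ^ 2) with (r * r - P x ^ 2) by lra. ring.
Qed.

(** * Comparison of phases *)

(** [d] is half the logarithmic derivative of [g']; with it the Schwarzian
    term of [potential] needs no third derivatives. *)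
Record is_phase (x0 : R) (g g1 d d1 : R -> R) : Prop := {
  phase_pos : forall y, x0 < y -> 0 < g1 y;
  phase_der : forall y, x0 < y -> is_derive g y (g1 y);
  phase_der1 : forall y, x0 < y -> is_derive g1 y (2 * d y * g1 y);
  phase_der2 : forall y, x0 < y -> is_derive d y (d1 y) }.

(** [v = g' ^ (-1/2) sin g] solves [v'' + potential v = 0]. *)
Definition potential (g1 d d1 : R -> R) (y : R) : R := g1 y ^ 2 + d1 y - d y ^ 2.

Section Comparison.

Variables (x0 x1 : R) (f f1 df df1 g g1 dg dg1 : R -> R).
Hypothesis (Hf : is_phase x0 f f1 df df1) (Hg : is_phase x0 g g1 dg dg1).
Hypothesis (H01 : x0 < x1).

Let phi (y : R) : R := g y - g x1.
Let D (y : R) : R := df y - dg y.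
Let X (y : R) : R := g1 y * cos (phi y) + D y * sin (phi y).
Let Y (y : R) : R := f1 y * sin (phi y).
Let P (y : R) : R := X y * cos (phi y) + Y y * sin (phi y).
Let Q (y : R) : R := Y y * cos (phi y) - X y * sin (phi y).

(** With [v = g' ^ (-1/2) sin (g - g x1)], the vector [X + i Y] is proportional
    to [(v' + df v) + i f' v], the Pruefer vector of [v] in the frame of [f].
    [pruefer_gap] is its argument minus [g - g x1]; the vector rotated
    by [- (g - g x1)] never meets the negative half-axis, so the principal
    argument is continuous. *)
Definition pruefer_gap (y : R) : R := arg2 (P y) (Q y).

Lemma rotated_norm (y : R) : P y ^ 2 + Q y ^ 2 = X y ^ 2 + Y y ^ 2.
Proof.
  unfold P, Q; assert (T := sin_cos_sq (phi y)).
  transitivity ((X y ^ 2 + Y y ^ 2) * (sin (phi y) * sin (phi y) + cos (phi y) * cos (phi y)));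
    [ring|rewrite T; ring].
Qed.

Lemma rotated_norm_pos (y : R) : x0 < y -> 0 < P y ^ 2 + Q y ^ 2.
Proof.
  intros Hy; rewrite rotated_norm.
  assert (Pf := phase_pos _ _ _ _ _ Hf y Hy). assert (Pg := phase_pos _ _ _ _ _ Hg y Hy).
  assert (T := sin_cos_sq (phi y)).
  assert (A := pow2_ge_0 (X y)). assert (B := pow2_ge_0 (Y y)).
  destruct (Req_dec (sin (phi y)) 0) as [E|E].
  - assert (EX : X y ^ 2 = g1 y ^ 2).
    { unfold X; rewrite E in *. transitivity (g1 y ^ 2 * (0 * 0 + cos (phi y) * cos (phi y)));
        [ring|rewrite T; ring]. }
    assert (0 < g1 y ^ 2) by (apply pow_lt; exact Pg). lra.
  - assert (0 < Y y ^ 2).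
    { unfold Y; rewrite Rpow_mult_distr; apply Rmult_lt_0_compat; [now apply pow_lt|].
      assert (S := pow2_gt_0 _ E). exact S. }
    lra.
Qed.

(** When [Q] vanishes the vector is parallel to [exp (i phi)], and [P] is [g1 > 0]
    if [sin (phi y) = 0] and [f1 > 0] otherwise. *)
Lemma rotated_off_axis (y : R) : x0 < y -> 0 < P y + sqrt (P y ^ 2 + Q y ^ 2).
Proof.
  intros Hy.
  assert (Pf := phase_pos _ _ _ _ _ Hf y Hy). assert (Pg := phase_pos _ _ _ _ _ Hg y Hy).
  assert (Hn := rotated_norm_pos y Hy).
  destruct (Req_dec (Q y) 0) as [E|E].
  - assert (Hp : 0 < P y).
    { assert (T := sin_cos_sq (phi y)).
      set (s := sin (phi y)) in *; set (c := cos (phi y)) in *.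
      assert (EX : X y = P y * c).
      { transitivity (P y * c - Q y * s); [|rewrite E; ring].
        unfold P, Q; fold s c. transitivity (X y * (s * s + c * c)); [rewrite T|]; ring. }
      assert (EY : f1 y * s = P y * s).
      { transitivity (P y * s + Q y * c); [|rewrite E; ring].
        unfold P, Q; fold s c.
        transitivity (Y y * (s * s + c * c)); [rewrite T; unfold Y; fold s|]; ring. }
      destruct (Req_dec s 0) as [Es|Es].
      - unfold X in EX; fold s c in EX; rewrite Es in EX, T.
        assert (c <> 0) by nra.
        assert (g1 y = P y) by (apply (Rmult_eq_reg_r c); [lra|assumption]). lra.
      - assert (f1 y = P y) by (apply (Rmult_eq_reg_r s); assumption). lra. }
    assert (Hs := sqrt_pos (P y ^ 2 + Q y ^ 2)). lra.
  - assert (H : Rabs (P y) < sqrt (P y ^ 2 + Q y ^ 2)).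
    { assert (S := pow2_gt_0 _ E).
      rewrite <- sqrt_Rsqr_abs; apply sqrt_lt_1; unfold Rsqr; nra. }
    assert (A := Rabs_maj2 (P y)). lra.
Qed.

(** The Pruefer equation: the angle of [v] in the frame of [f] turns with velocity
    [f'] plus a term with the sign of the difference of the potentials. *)
Lemma is_derive_comparison (y : R) : x0 < y ->
  is_derive (fun z => g z - f z + pruefer_gap z) y
    (f1 y * (potential g1 dg dg1 y - potential f1 df df1 y) * sin (phi y) ^ 2
     / (P y ^ 2 + Q y ^ 2)).
Proof.
  intros Hy.
  assert (Hn := rotated_norm_pos y Hy). assert (Ho := rotated_off_axis y Hy).
  assert (Df := phase_der _ _ _ _ _ Hf y Hy). assert (Dg := phase_der _ _ _ _ _ Hg y Hy).
  assert (Df1 := phase_der1 _ _ _ _ _ Hf y Hy). assert (Dg1 := phase_der1 _ _ _ _ _ Hg y Hy).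
  assert (Df2 := phase_der2 _ _ _ _ _ Hf y Hy). assert (Dg2 := phase_der2 _ _ _ _ _ Hg y Hy).
  assert (Dphi : is_derive phi y (g1 y)).
  { eapply is_derive_eq; [apply der_minus; [exact Dg|apply @is_derive_const]|].
    unfold zero; simpl; ring. }
  assert (Dc : is_derive (fun z => cos (phi z)) y (- sin (phi y) * g1 y))
    by (apply der_comp; [exact Dphi|apply is_derive_cos]).
  assert (Ds : is_derive (fun z => sin (phi z)) y (cos (phi y) * g1 y))
    by (apply der_comp; [exact Dphi|apply is_derive_sin]).
  assert (DX : is_derive X y (2 * dg y * g1 y * cos (phi y) + g1 y * (- sin (phi y) * g1 y)
     + ((df1 y - dg1 y) * sin (phi y) + D y * (cos (phi y) * g1 y)))).
  { apply (der_plus (fun z => g1 z * cos (phi z)) (fun z => D z * sin (phi z)));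
      [exact (der_mult _ _ _ _ _ Dg1 Dc)
      |exact (der_mult D _ _ _ _ (der_minus _ _ _ _ _ Df2 Dg2) Ds)]. }
  assert (DY : is_derive Y y (2 * df y * f1 y * sin (phi y) + f1 y * (cos (phi y) * g1 y)))
    by exact (der_mult _ _ _ _ _ Df1 Ds).
  set (X' := 2 * dg y * g1 y * cos (phi y) + _ + _) in DX.
  set (Y' := 2 * df y * f1 y * sin (phi y) + _) in DY.
  assert (DP : is_derive P y (X' * cos (phi y) + X y * (- sin (phi y) * g1 y)
     + (Y' * sin (phi y) + Y y * (cos (phi y) * g1 y))))
    by exact (der_plus _ _ _ _ _ (der_mult _ _ _ _ _ DX Dc) (der_mult _ _ _ _ _ DY Ds)).
  assert (DQ : is_derive Q y (Y' * cos (phi y) + Y y * (- sin (phi y) * g1 y)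
     - (X' * sin (phi y) + X y * (cos (phi y) * g1 y))))
    by exact (der_minus _ _ _ _ _ (der_mult _ _ _ _ _ DY Dc) (der_mult _ _ _ _ _ DX Ds)).
  eapply is_derive_eq.
  - apply der_plus; [apply der_minus; [exact Dg|exact Df]|].
    apply (is_derive_arg2 P Q y _ _ DP DQ Ho Hn).
  - assert (T := sin_cos_sq (phi y)).
    set (s := sin (phi y)) in *. set (c := cos (phi y)) in *.
    assert (E1 : P y * (Y' * c + Y y * (- s * g1 y) - (X' * s + X y * (c * g1 y)))
      - (X' * c + X y * (- s * g1 y) + (Y' * s + Y y * (c * g1 y))) * Q y
      = X y * Y' - X' * Y y - g1 y * (P y ^ 2 + Q y ^ 2)).
    { rewrite rotated_norm; unfold P, Q; fold s c.
      transitivity ((X y * Y' - X' * Y y - g1 y * (X y ^ 2 + Y y ^ 2)) * (s * s + c * c));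
        [ring|rewrite T; ring]. }
    assert (E2 : X y * Y' - X' * Y y
      = f1 y * (P y ^ 2 + Q y ^ 2 + (potential g1 dg dg1 y - potential f1 df df1 y) * s ^ 2)).
    { rewrite rotated_norm; unfold potential, X', Y', X, Y, D; fold s c.
      assert (c2 : c * c = 1 - s * s) by lra.
      set (G := g1 y). set (f_ := f1 y). set (a := df y). set (b := dg y).
      transitivity (f_ * (G ^ 2 * (c * c) + G ^ 2 * (s * s) + 2 * (a - b) * G * (s * c)
         + (2 * a * (a - b) - (df1 y - dg1 y)) * (s * s))); [ring|].
      transitivity (f_ * (G ^ 2 * (c * c) + 2 * (a - b) * G * (s * c) + (a - b) ^ 2 * (s * s)
         + f_ ^ 2 * (s * s) + (G ^ 2 + dg1 y - b ^ 2 - (f_ ^ 2 + df1 y - a ^ 2)) * (s * s))); ring. }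
    rewrite E1, E2. field; lra.
Qed.

Lemma pruefer_gap_start : pruefer_gap x1 = 0.
Proof.
  unfold pruefer_gap.
  assert (E : Q x1 = 0).
  { unfold Q, Y, X, phi; replace (g x1 - g x1) with 0 by ring; rewrite sin_0; ring. }
  rewrite E; apply arg2_0.
Qed.

Lemma comparison_le (a b : R) :
  (forall y, x0 < y -> potential f1 df df1 y <= potential g1 dg dg1 y) ->
  x0 < a -> a <= b ->
  g a - f a + pruefer_gap a <= g b - f b + pruefer_gap b.
Proof.
  intros H Ha Hab.
  destruct (mvt _ _ a b Hab (fun y Hy => is_derive_comparison y (Rlt_le_trans _ _ _ Ha (proj1 Hy))))
    as [z [Hz E]].
  - assert (Pf := phase_pos _ _ _ _ _ Hf z ltac:(lra)).
    assert (Hz' := H z ltac:(lra)). assert (Hn := rotated_norm_pos z ltac:(lra)).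
    assert (S := pow2_ge_0 (sin (phi z))).
    assert (Nn : 0 <= f1 z * (potential g1 dg dg1 z - potential f1 df df1 z) * sin (phi z) ^ 2
      / (P z ^ 2 + Q z ^ 2)).
    { apply Rdiv_le_0_compat; [|exact Hn]. apply Rmult_le_pos; [apply Rmult_le_pos|]; lra. }
    assert (0 <= b - a) by lra.
    assert (M := Rmult_le_pos _ _ Nn H0). lra.
Qed.

(** Just after [x1] the angle [g - g x1] lies in [(0, PI)], so the inequality
    becomes strict at once. *)
Lemma comparison_lt :
  (forall y, x0 < y -> potential f1 df df1 y < potential g1 dg dg1 y) ->
  exists x2 e, x1 < x2 /\ 0 < e /\
    forall y, x2 <= y -> g x1 - f x1 + e <= g y - f y + pruefer_gap y.
Proof.
  intros H.
  assert (Hle : forall y, x0 < y -> potential f1 df df1 y <= potential g1 dg dg1 y)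
    by (intros y Hy; left; now apply H).
  assert (HPI := PI_RGT_0).
  assert (Cg : continuity_pt g x1)
    by (eapply continuity_pt_of_is_derive, (phase_der _ _ _ _ _ Hg), H01).
  destruct (Cg PI HPI) as [d [Hd Hlim]].
  set (x2 := x1 + d / 2).
  assert (incr : forall z, x1 < z -> 0 < phi z).
  { intros z Hz.
    destruct (mvt g g1 x1 z) as [w [Hw E]]; [lra| |].
    - intros w Hw; apply (phase_der _ _ _ _ _ Hg); lra.
    - assert (Pg := phase_pos _ _ _ _ _ Hg w ltac:(lra)). unfold phi; nra. }
  assert (small : forall z, x1 < z <= x2 -> phi z < PI).
  { intros z Hz.
    assert (B : R_dist (g z) (g x1) < PI).
    { apply Hlim; split; [split; [exact I|lra]|].
      simpl; unfold R_dist, x2 in *; rewrite Rabs_pos_eq; lra. }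
    unfold R_dist in B; apply Rabs_lt_between in B; unfold phi; lra. }
  set (x3 := x1 + d / 4).
  assert (H32 : x1 < x3 < x2) by (unfold x3, x2; lra).
  destruct (mvt _ _ x3 x2 ltac:(lra) (fun y Hy => is_derive_comparison y ltac:(lra))) as [z [Hz E]].
  - cbv beta in E.
    assert (Pf := phase_pos _ _ _ _ _ Hf z ltac:(lra)).
    assert (Hz' := H z ltac:(lra)). assert (Hn := rotated_norm_pos z ltac:(lra)).
    assert (S : 0 < sin (phi z))
      by (apply sin_gt_0; [apply incr; lra|apply small; lra]).
    assert (Np : 0 < f1 z * (potential g1 dg dg1 z - potential f1 df df1 z) * sin (phi z) ^ 2
      / (P z ^ 2 + Q z ^ 2)).
    { apply Rdiv_lt_0_compat; [|exact Hn].
      apply Rmult_lt_0_compat; [apply Rmult_lt_0_compat; lra|now apply pow_lt]. }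
    set (e := g x2 - f x2 + pruefer_gap x2 - (g x3 - f x3 + pruefer_gap x3)) in E.
    exists x2, e; split; [lra|]; split.
    { rewrite E; apply Rmult_lt_0_compat; [exact Np|lra]. }
    intros y Hy.
    assert (C1 := comparison_le x1 x3 Hle H01 ltac:(lra)).
    assert (C2 := comparison_le x2 y Hle ltac:(lra) Hy).
    rewrite pruefer_gap_start in C1. unfold e; lra.
Qed.

Lemma abs_pruefer_gap_lt (y : R) : Rabs (pruefer_gap y) < PI.
Proof. apply abs_arg2_lt. Qed.

(** Where the two phases have nearly the same velocity and small logarithmic
    accelerations, the vector is nearly the unit vector of argument [g - g x1]. *)
Lemma abs_pruefer_gap_le (y e : R) : 0 <= e <= 1 / 8 ->
  Rabs (f1 y - 1) <= e -> Rabs (g1 y - 1) <= e -> Rabs (df y) <= e -> Rabs (dg y) <= e ->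
  Rabs (pruefer_gap y) <= 16 * e.
Proof.
  intros He B1 B2 B3 B4.
  between.
  assert (T := sin_cos_sq (phi y)).
  assert (S1 := SIN_bound (phi y)). assert (S2 := COS_bound (phi y)).
  set (s := sin (phi y)) in *. set (c := cos (phi y)) in *.
  assert (sc : -1 <= s * c <= 1) by (split; nra).
  assert (ss : 0 <= s * s <= 1) by (split; nra).
  assert (cc : 0 <= c * c <= 1) by (split; nra).
  assert (D1 : - (2 * e) <= D y <= 2 * e) by (unfold D; lra).
  assert (EP : P y = (s * s + c * c) + (g1 y - 1) * (c * c) + (f1 y - 1) * (s * s) + D y * (s * c))
    by (unfold P, X, Y; fold s c; ring).
  assert (EQ : Q y = (f1 y - g1 y) * (s * c) - D y * (s * s))
    by (unfold Q, X, Y; fold s c; ring).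
  assert (HP : 1 / 2 <= P y) by (rewrite EP, T; nra).
  assert (HQ : Rabs (Q y) <= 4 * e) by (rewrite EQ; apply Rabs_le; split; nra).
  eapply Rle_trans; [apply abs_arg2_le; lra|].
  assert (Rabs (Q y) / P y <= 8 * e) by (apply Rle_div_l; [lra|]; nra). lra.
Qed.

End Comparison.

(** * Phases and potentials of the functions at hand *)

(** Two solutions of [v'' + a v' + b v = 0]: by Abel's identity the phase of
    [v1 + i v2] has velocity [W / (v1 ^ 2 + v2 ^ 2)] with [W' = - a W]. *)
Lemma is_phase_of_solutions (x0 : R) (a b a1 v1 v2 w1 w2 h rho : R -> R) :
  (forall y, x0 < y -> is_derive a y (a1 y)) ->
  (forall y, x0 < y -> is_derive v1 y (w1 y) /\ is_derive v2 y (w2 y)) ->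
  (forall y, x0 < y -> is_derive w1 y (- a y * w1 y - b y * v1 y) /\
                       is_derive w2 y (- a y * w2 y - b y * v2 y)) ->
  (forall y, x0 < y -> 0 < v1 y * w2 y - w1 y * v2 y) ->
  (forall y, x0 < y -> 0 < rho y /\ v1 y = rho y * cos (h y) /\ v2 y = rho y * sin (h y)) ->
  (forall y, x0 < y -> continuity_pt h y) ->
  exists d1,
    is_phase x0 h (fun y => (v1 y * w2 y - w1 y * v2 y) / (v1 y ^ 2 + v2 y ^ 2))
      (fun y => - a y / 2 - (v1 y * w1 y + v2 y * w2 y) / (v1 y ^ 2 + v2 y ^ 2)) d1 /\
    forall y, x0 < y ->
      potential (fun y => (v1 y * w2 y - w1 y * v2 y) / (v1 y ^ 2 + v2 y ^ 2))
        (fun y => - a y / 2 - (v1 y * w1 y + v2 y * w2 y) / (v1 y ^ 2 + v2 y ^ 2)) d1 y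
      = b y - a y ^ 2 / 4 - a1 y / 2.
Proof.
  intros Da Dv Dw HW Hpol Hc.
  set (N := fun y => v1 y ^ 2 + v2 y ^ 2).
  set (M := fun y => v1 y * w1 y + v2 y * w2 y).
  set (M' := fun y => w1 y ^ 2 + w2 y ^ 2 - a y * M y - b y * N y).
  assert (PN : forall y, x0 < y -> 0 < N y).
  { intros y Hy; destruct (Hpol y Hy) as [P [E1 E2]]; unfold N; rewrite E1, E2.
    assert (T := sin_cos_sq (h y)).
    assert (Q : 0 < rho y ^ 2) by now apply pow_lt.
    replace ((rho y * cos (h y)) ^ 2 + (rho y * sin (h y)) ^ 2)
      with (rho y ^ 2 * (sin (h y) * sin (h y) + cos (h y) * cos (h y))) by ring.
    rewrite T; lra. }
  assert (DN : forall y, x0 < y -> is_derive N y (2 * M y)).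
  { intros y Hy; destruct (Dv y Hy) as [D1 D2].
    apply is_derive_ext with (fun z => v1 z * v1 z + v2 z * v2 z);
      [intros z; unfold N; simpl; ring|].
    eapply is_derive_eq; [apply der_plus; apply der_mult; eassumption|unfold M; ring]. }
  assert (DM : forall y, x0 < y -> is_derive M y (M' y)).
  { intros y Hy; destruct (Dv y Hy) as [D1 D2]; destruct (Dw y Hy) as [E1 E2].
    eapply is_derive_eq; [apply der_plus; apply der_mult; eassumption|].
    unfold M', M, N; ring. }
  exists (fun y => - a1 y / 2 - (M' y * N y - 2 * M y * M y) / N y ^ 2).
  split; [constructor|].
  - intros y Hy; apply Rdiv_lt_0_compat; [now apply HW|now apply PN].
  - intros y Hy; destruct (Dv y Hy) as [D1 D2].
    apply (is_derive_phase v1 v2 rho h y (w1 y) (w2 y) (y - x0)); auto; [lra|].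
    intros z Hz; apply Hpol; apply Rabs_lt_between in Hz; lra.
  - intros y Hy; destruct (Dv y Hy) as [D1 D2]; destruct (Dw y Hy) as [E1 E2].
    eapply is_derive_eq.
    + apply der_div; [apply der_minus; apply der_mult; eassumption|exact (DN y Hy)|].
      assert (P := PN y Hy); unfold N in P; lra.
    + assert (P := PN y Hy). cbv beta. fold (N y) (M y). unfold M, N in *. field; lra.
  - intros y Hy.
    assert (P := PN y Hy).
    apply is_derive_ext with (fun z => (- / 2) * a z - M z / N z);
      [intros z; unfold M, N; simpl; unfold Rdiv; ring|].
    eapply is_derive_eq.
    + apply der_minus; [apply der_scal, Da, Hy|].
      apply der_div; [apply DM, Hy|apply DN, Hy|lra].
    + cbv beta; field; lra.
  - intros y Hy; assert (P := PN y Hy); unfold potential.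
    fold (N y) (M y).
    assert (L : (v1 y * w2 y - w1 y * v2 y) ^ 2 = N y * (w1 y ^ 2 + w2 y ^ 2) - M y ^ 2)
      by (unfold M, N; ring).
    replace (((v1 y * w2 y - w1 y * v2 y) / N y) ^ 2)
      with ((N y * (w1 y ^ 2 + w2 y ^ 2) - M y ^ 2) / N y ^ 2) by (rewrite <- L; field; lra).
    unfold M'; field; lra.
Qed.

Lemma is_phase_weaken (x0 x1 : R) (g g1 d d1 : R -> R) :
  x0 <= x1 -> is_phase x0 g g1 d d1 -> is_phase x1 g g1 d d1.
Proof. intros H [H1 H2 H3 H4]; constructor; intros y Hy; [apply H1|apply H2|apply H3|apply H4]; lra. Qed.

Definition cylinder_slope (C : R -> R -> R) (nu y : R) : R := nu / y * C nu y - C (nu + 1) y.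

Lemma is_derive_cylinder_slope (C : R -> R -> R) (nu y : R) : cylinder C -> 0 < y ->
  is_derive (cylinder_slope C nu) y
    (- (1 / y) * cylinder_slope C nu y - (1 - nu ^ 2 / y ^ 2) * C nu y).
Proof.
  intros HC Hy.
  assert (D0 := cylinder_derive_up C nu y HC Hy).
  assert (D1 := cylinder_derive_down C nu y HC Hy).
  assert (Dq : is_derive (fun z => nu / z) y (- nu / y ^ 2)) by (auto_derive; [lra|field; lra]).
  eapply is_derive_eq; [exact (der_minus _ _ _ _ _ (der_mult _ _ _ _ _ Dq D0) D1)|].
  unfold cylinder_slope; field; lra.
Qed.

Lemma is_derive_acos_div (m y : R) : 0 < m < y ->
  is_derive (fun z => acos (m / z)) y (m / (y * sqrt (y ^ 2 - m ^ 2))).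
Proof.
  intros H.
  assert (Hr : -1 < m / y < 1).
  { split; [|apply Rlt_div_l; lra]. assert (0 < m / y) by (apply Rdiv_lt_0_compat; lra). lra. }
  assert (HT : 0 < y ^ 2 - m ^ 2) by nra.
  assert (Hs := sqrt_lt_R0 _ HT).
  assert (D : is_derive acos (m / y) (-1 / sqrt (1 - (m / y)²))).
  { apply is_derive_Reals; rewrite <- (derive_pt_acos _ Hr). apply derive_pt_eq_1 with (derivable_pt_acos _ Hr).
    reflexivity. }
  assert (Es : sqrt (1 - (m / y)²) = sqrt (y ^ 2 - m ^ 2) / y).
  { replace (1 - (m / y)²) with ((y ^ 2 - m ^ 2) / y ^ 2) by (unfold Rsqr; field; lra).
    rewrite sqrt_div by nra. f_equal. apply sqrt_pow2; lra. }
  rewrite Es in D.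
  assert (Dq : is_derive (fun z => m / z) y (- m / y ^ 2)) by (auto_derive; [lra|field; lra]).
  eapply is_derive_eq; [exact (der_comp _ _ _ _ _ Dq D)|]. field; lra.
Qed.

Lemma is_derive_sqrt_sub (m y : R) : 0 < y ^ 2 - m ^ 2 ->
  is_derive (fun z => sqrt (z ^ 2 - m ^ 2)) y (y / sqrt (y ^ 2 - m ^ 2)).
Proof.
  intros H; assert (Hs := sqrt_lt_R0 _ H).
  auto_derive; [simpl in *; lra|].
  replace (y * (y * 1) + - (m * (m * 1))) with (y ^ 2 - m ^ 2) by ring. field; lra.
Qed.

(** The Liouville-Green phase of Bessel's equation. *)
Definition wkb (nu y : R) : R := sqrt (y ^ 2 - nu ^ 2) - nu * acos (nu / y).

Lemma is_phase_wkb (nu : R) : 0 < nu ->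
  is_phase nu (wkb nu) (fun y => sqrt (y ^ 2 - nu ^ 2) / y)
    (fun y => (y / (y ^ 2 - nu ^ 2) - 1 / y) / 2)
    (fun y => (1 / y ^ 2 - (y ^ 2 + nu ^ 2) / (y ^ 2 - nu ^ 2) ^ 2) / 2).
Proof.
  intros Hnu.
  assert (HT : forall y, nu < y -> 0 < y ^ 2 - nu ^ 2) by (intros; nra).
  constructor; intros y Hy; assert (T := HT y Hy); assert (Hs := sqrt_lt_R0 _ T);
    assert (Ess := sqrt_sqrt _ (Rlt_le _ _ T)).
  - apply Rdiv_lt_0_compat; lra.
  - assert (D1 := is_derive_sqrt_sub nu y T).
    assert (D2 := is_derive_acos_div nu y (conj Hnu Hy)).
    eapply is_derive_eq; [exact (der_minus _ _ _ _ _ D1 (der_scal _ nu _ _ D2))|].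
    set (s := sqrt (y ^ 2 - nu ^ 2)) in *. field_simplify_eq; [|lra].
    replace (s ^ 2) with (y ^ 2 - nu ^ 2) by lra. ring.
  - assert (D1 := is_derive_sqrt_sub nu y T).
    eapply is_derive_eq; [exact (der_div _ _ _ _ _ D1 (der_id y) ltac:(lra))|].
    cbv beta. set (s := sqrt (y ^ 2 - nu ^ 2)) in *.
    rewrite <- Ess. field_simplify_eq; [|split; nra].
    replace (s ^ 2) with (y ^ 2 - nu ^ 2) by lra. ring.
  - auto_derive; [simpl in *; lra|]. simpl in T; field; split; [simpl; lra|lra].
Qed.

(** The right-hand side is the potential of the phase of [J + i Y]. *)
Lemma potential_wkb_lt (nu y : R) : 0 < nu -> nu < y ->
  potential (fun y => sqrt (y ^ 2 - nu ^ 2) / y)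
    (fun y => (y / (y ^ 2 - nu ^ 2) - 1 / y) / 2)
    (fun y => (1 / y ^ 2 - (y ^ 2 + nu ^ 2) / (y ^ 2 - nu ^ 2) ^ 2) / 2) y
  < 1 - nu ^ 2 / y ^ 2 + 1 / (4 * y ^ 2).
Proof.
  intros Hnu Hy; assert (T : 0 < y ^ 2 - nu ^ 2) by nra.
  assert (Ess := sqrt_sqrt _ (Rlt_le _ _ T)).
  unfold potential.
  replace ((sqrt (y ^ 2 - nu ^ 2) / y) ^ 2) with ((y ^ 2 - nu ^ 2) / y ^ 2)
    by (rewrite <- Ess at 1; field; lra).
  apply Rminus_lt_0.
  set (T0 := y ^ 2 - nu ^ 2) in *.
  assert (E : 1 - nu ^ 2 / y ^ 2 + 1 / (4 * y ^ 2)
     - (T0 / y ^ 2 + (1 / y ^ 2 - (y ^ 2 + nu ^ 2) / T0 ^ 2) / 2 - ((y / T0 - 1 / y) / 2) ^ 2)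
     = (T0 ^ 2 + 6 * y ^ 2 * nu ^ 2 - nu ^ 4) / (4 * y ^ 2 * T0 ^ 2)).
  { unfold T0 in *; field; lra. }
  rewrite E; apply Rdiv_lt_0_compat; [|repeat apply Rmult_lt_0_compat; try apply pow_lt; lra].
  assert (0 < T0 ^ 2) by now apply pow_lt.
  assert (0 < y ^ 2 * nu ^ 2) by (apply Rmult_lt_0_compat; apply pow_lt; lra).
  assert (nu ^ 4 = nu ^ 2 * nu ^ 2) by ring.
  assert (nu ^ 2 * nu ^ 2 <= y ^ 2 * nu ^ 2) by (apply Rmult_le_compat_r; nra).
  lra.
Qed.

(** The numerator of the velocity of [psi_lower]. *)
Definition qnum (m eta y : R) : R :=
  (y ^ 2 - m ^ 2 - eta ^ 2 / 2) * (y ^ 2 - m ^ 2) - eta * y ^ 2.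

Definition qnum1 (m eta y : R) : R := 2 * y * (2 * (y ^ 2 - m ^ 2) - eta ^ 2 / 2 - eta).

Definition qnum2 (m eta y : R) : R := 12 * y ^ 2 - 4 * m ^ 2 - eta ^ 2 - 2 * eta.

(** [low1], [dlow] and [dlow1] are the derivative of [psi_lower], half its
    logarithmic derivative, and the derivative of the latter. *)
Definition low1 (m eta y : R) : R :=
  qnum m eta y / (y * (y ^ 2 - m ^ 2) * sqrt (y ^ 2 - m ^ 2)).

Definition dlow (m eta y : R) : R :=
  (qnum1 m eta y / qnum m eta y - 1 / y - 3 * y / (y ^ 2 - m ^ 2)) / 2.

Definition dlow1 (m eta y : R) : R :=
  ((qnum2 m eta y * qnum m eta y - qnum1 m eta y ^ 2) / qnum m eta y ^ 2 + 1 / y ^ 2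
   + 3 * (y ^ 2 + m ^ 2) / (y ^ 2 - m ^ 2) ^ 2) / 2.

Lemma is_phase_psi_lower (nu eta x0 : R) :
  0 < mu_of nu eta -> mu_of nu eta <= x0 ->
  (forall y, x0 < y -> 0 < qnum (mu_of nu eta) eta y) ->
  is_phase x0 (psi_lower nu eta) (low1 (mu_of nu eta) eta)
    (dlow (mu_of nu eta) eta) (dlow1 (mu_of nu eta) eta).
Proof.
  unfold psi_lower; set (m := mu_of nu eta); intros Hm Hx0 Hq.
  assert (HT : forall y, x0 < y -> 0 < y ^ 2 - m ^ 2) by (intros; nra).
  assert (Dq : forall y, is_derive (qnum m eta) y (qnum1 m eta y))
    by (intros y; unfold qnum, qnum1; auto_derive; [trivial|field]).
  assert (Dq1 : forall y, is_derive (qnum1 m eta) y (qnum2 m eta y))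
    by (intros y; unfold qnum1, qnum2; auto_derive; [trivial|field]).
  constructor; intros y Hy; assert (T := HT y Hy); assert (Q := Hq y Hy);
    assert (Hs := sqrt_lt_R0 _ T); assert (Ess := sqrt_sqrt _ (Rlt_le _ _ T)).
  - unfold low1; apply Rdiv_lt_0_compat; [exact Q|].
    repeat apply Rmult_lt_0_compat; lra.
  - assert (D1 := is_derive_sqrt_sub m y T).
    assert (D2 := is_derive_acos_div m y ltac:(lra)).
    assert (D3 := der_div _ _ _ _ _ (@is_derive_const R_AbsRing R_NormedModule eta y) D1 ltac:(lra)).
    assert (D4 := @is_derive_const R_AbsRing R_NormedModule
       (PI / 4 * (eta ^ 2 / m + 2 * (m - nu) + 1)) y).
    eapply is_derive_eq;
      [exact (der_plus _ _ _ _ _ (der_plus _ _ _ _ _ (der_minus _ _ _ _ _ D1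
          (der_scal _ (eta ^ 2 / (2 * m) + m) _ _ D2)) D3) D4)|].
    unfold low1, qnum, zero; simpl (AbelianMonoid.zero _ _).
    set (s := sqrt (y ^ 2 - m ^ 2)) in *.
    replace (y ^ 2 - m ^ 2) with (s * s) by lra.
    unfold zero; simpl.
    replace (s * s - eta * (eta * 1) / 2) with (s * s - eta ^ 2 / 2) by field.
    field_simplify_eq; [|repeat split; lra].
    replace (m ^ 2) with (y ^ 2 - s ^ 2) by lra. ring.
  - assert (D1 := is_derive_sqrt_sub m y T).
    assert (D5 : is_derive (fun z => z * (z ^ 2 - m ^ 2)) y (3 * y ^ 2 - m ^ 2))
      by (auto_derive; [trivial|ring]).
    eapply is_derive_eq.
    + exact (der_div _ _ _ _ _ (Dq y) (der_mult _ _ _ _ _ D5 D1)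
        ltac:(apply Rgt_not_eq; repeat apply Rmult_lt_0_compat; lra)).
    + unfold low1, dlow; cbv beta.
      set (s := sqrt (y ^ 2 - m ^ 2)) in *.
      set (q := qnum m eta y) in *. set (q1 := qnum1 m eta y).
      assert (Em : m ^ 2 = y ^ 2 - s * s) by lra. rewrite Em.
      assert (Hss : 0 < s * s) by now apply Rmult_lt_0_compat.
      field; repeat split; lra.
  - unfold dlow.
    assert (D6 := der_div _ _ _ _ _ (Dq1 y) (Dq y) ltac:(lra)).
    assert (D7 : is_derive (fun z => 1 / z + 3 * z / (z ^ 2 - m ^ 2)) y
       (- (1 / y ^ 2) - 3 * (y ^ 2 + m ^ 2) / (y ^ 2 - m ^ 2) ^ 2)).
    { auto_derive; [split; [lra|simpl in *; lra]|]. simpl in T; field; split; [simpl; lra|lra]. }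
    apply is_derive_ext with (fun z => / 2 * (qnum1 m eta z / qnum m eta z
       - (1 / z + 3 * z / (z ^ 2 - m ^ 2)))).
    { intros z; simpl; unfold Rdiv; ring. }
    eapply is_derive_eq; [exact (der_scal _ (/ 2) _ _ (der_minus _ _ _ _ _ D6 D7))|].
    cbv beta; unfold dlow1; field; repeat split; lra.
Qed.

(** The coefficients of the equation [v'' + a v' + b v = 0] satisfied by [U'] and
    [W'] beyond [m], with [ultra_a1] the derivative of [ultra_a]. *)
Definition ultra_a (m eta y : R) : R := (2 * eta + 1) / y - 2 * m ^ 2 / (y * (y ^ 2 - m ^ 2)).

Definition ultra_a1 (m eta y : R) : R :=
  - ((2 * eta + 1) / y ^ 2) + 2 * m ^ 2 * (3 * y ^ 2 - m ^ 2) / (y ^ 2 * (y ^ 2 - m ^ 2) ^ 2).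

Definition ultra_b (m eta y : R) : R :=
  1 - m ^ 2 / y ^ 2 - (2 * eta + 1) / y ^ 2
  - 2 * m ^ 2 * (2 * eta + 1) / (y ^ 2 * (y ^ 2 - m ^ 2)).

(** This identity is where the polynomial comes from. *)
Lemma potential_low_sub (m eta y : R) :
  0 < y -> 0 < y ^ 2 - m ^ 2 -> qnum m eta y <> 0 ->
  potential (low1 m eta) (dlow m eta) (dlow1 m eta) y
  - (ultra_b m eta y - ultra_a m eta y ^ 2 / 4 - ultra_a1 m eta y / 2)
  = r_poly m eta y / (16 * qnum m eta y ^ 2 * y ^ 2 * (y ^ 2 - m ^ 2) ^ 3).
Proof.
  intros Hy T Hq.
  assert (Ess := sqrt_sqrt _ (Rlt_le _ _ T)). assert (Hs := sqrt_lt_R0 _ T).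
  unfold potential.
  replace (low1 m eta y ^ 2) with (qnum m eta y ^ 2 / (y ^ 2 * (y ^ 2 - m ^ 2) ^ 3)).
  2: { unfold low1.
       replace ((y ^ 2 - m ^ 2) ^ 3) with ((y ^ 2 - m ^ 2) ^ 2 * (sqrt (y ^ 2 - m ^ 2) * sqrt (y ^ 2 - m ^ 2)))
         by (rewrite Ess; ring).
       field; repeat split; lra. }
  unfold dlow, dlow1, ultra_a, ultra_a1, ultra_b, r_poly.
  set (T0 := y ^ 2 - m ^ 2) in *.
  assert (Eq : qnum m eta y = (T0 - eta ^ 2 / 2) * T0 - eta * y ^ 2) by reflexivity.
  set (q := qnum m eta y) in *.
  unfold qnum1, qnum2. fold T0.
  field_simplify_eq; [|repeat split; try lra; nra].
  rewrite Eq; unfold T0; field.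
Qed.

(** Where the velocity of [psi_lower] vanishes, the squared logarithmic derivative
    dominates the potential and makes [r_poly] nonpositive.  Hence [r_poly] has a
    root at or beyond that point. *)
Lemma r_poly_at_qnum_root (m eta y : R) :
  0 < y -> 0 < y ^ 2 - m ^ 2 -> qnum m eta y = 0 ->
  r_poly m eta y = - 12 * qnum1 m eta y ^ 2 * y ^ 2 * (y ^ 2 - m ^ 2) ^ 3.
Proof.
  intros Hy T Hq.
  assert (E : r_poly m eta y + 12 * qnum1 m eta y ^ 2 * y ^ 2 * (y ^ 2 - m ^ 2) ^ 3
    = qnum m eta y *
      (8 * qnum2 m eta y * y ^ 2 * (y ^ 2 - m ^ 2) ^ 3
       + 8 * (y * (y ^ 2 - m ^ 2) ^ 3 + 3 * y ^ 3 * (y ^ 2 - m ^ 2) ^ 2) * qnum1 m eta y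
       + qnum m eta y *
         (16 * qnum m eta y ^ 2
          - (8 * (- (1 / y ^ 2) - 3 * (y ^ 2 + m ^ 2) / (y ^ 2 - m ^ 2) ^ 2)
             + 4 * (1 / y + 3 * y / (y ^ 2 - m ^ 2)) ^ 2
             + 16 * (ultra_b m eta y - ultra_a m eta y ^ 2 / 4 - ultra_a1 m eta y / 2))
            * (y ^ 2 * (y ^ 2 - m ^ 2) ^ 3)))).
  { unfold r_poly, qnum, qnum1, qnum2, ultra_a, ultra_a1, ultra_b; field; lra. }
  rewrite Hq in E; lra.
Qed.

Lemma ex_qnum_root (m eta : R) : 0 < m -> 0 < eta ->
  exists y0, m < y0 /\ qnum m eta y0 = 0 /\ forall y, y0 < y -> 0 < qnum m eta y.
Proof.
  intros Hm He.
  set (B := (eta ^ 2 / 2 + eta) / 2).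
  (* the roots of [qnum] in the variable [T = y ^ 2 - m ^ 2] are [B +- sqrt (B ^ 2 + eta m ^ 2)] *)
  set (D := B ^ 2 + eta * m ^ 2).
  assert (Pem : 0 < eta * m ^ 2) by (apply Rmult_lt_0_compat; [lra|apply pow_lt; lra]).
  assert (PD : 0 < D) by (unfold D; assert (H := pow2_ge_0 B); lra).
  assert (PB : 0 < B) by (unfold B; nra).
  assert (Hs := sqrt_lt_R0 D PD). assert (Es := sqrt_sqrt D (Rlt_le _ _ PD)).
  set (s := sqrt D) in *.
  set (T0 := B + s).
  assert (fact : forall y, qnum m eta y = (y ^ 2 - m ^ 2 - T0) * (y ^ 2 - m ^ 2 + (s - B))).
  { intros y; unfold T0.
    transitivity ((y ^ 2 - m ^ 2) ^ 2 - 2 * B * (y ^ 2 - m ^ 2) + B ^ 2 - s * s); [|ring].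
    rewrite Es; unfold D, qnum, B; field. }
  assert (HsB : B < s).
  { destruct (Rlt_dec B s) as [H|H]; [exact H|exfalso].
    assert (s * s <= B * B) by (apply Rmult_le_compat; lra).
    unfold D in Es; simpl in Es; lra. }
  set (y0 := sqrt (m ^ 2 + T0)).
  assert (PT : 0 < T0) by (unfold T0; lra).
  assert (Pm2 : 0 < m ^ 2) by (apply pow_lt; lra).
  assert (E0 : y0 ^ 2 = m ^ 2 + T0) by (unfold y0; apply pow2_sqrt; lra).
  assert (P0 : 0 < y0) by (apply sqrt_lt_R0; lra).
  exists y0; split; [|split].
  - destruct (Rlt_dec m y0) as [H|H]; [exact H|exfalso].
    assert (y0 ^ 2 <= m ^ 2) by (apply pow_incr; lra). lra.
  - rewrite fact, E0; ring.
  - intros y Hy; rewrite fact.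
    assert (y0 ^ 2 < y ^ 2) by nra. apply Rmult_lt_0_compat; lra.
Qed.

(** [r_poly] is a polynomial in [y ^ 2] with leading coefficient [12]. *)
Lemma r_poly_eventually_pos (m eta : R) : exists X, 0 < X /\ forall y, X <= y -> 0 < r_poly m eta y.
Proof.
  assert (dom : forall c6 c5 c4 c3 c2 c1 c0 : R, exists X, 1 <= X /\ forall z, X <= z ->
    0 < 12 * z ^ 7 + z ^ 6 * c6 + z ^ 5 * c5 + z ^ 4 * c4 + z ^ 3 * c3 + z ^ 2 * c2 + z * c1 + c0).
  { intros c6 c5 c4 c3 c2 c1 c0.
    set (Phi := fun u => 12 + u * c6 + u ^ 2 * c5 + u ^ 3 * c4 + u ^ 4 * c3 + u ^ 5 * c2
                         + u ^ 6 * c1 + u ^ 7 * c0).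
    assert (H : is_lim (fun z => Phi (/ z)) p_infty (Phi 0)).
    { apply is_lim_of_inv with 0; [|reflexivity].
      eapply continuity_pt_of_is_derive; unfold Phi; auto_derive; [trivial|reflexivity]. }
    destruct (is_lim_eventually _ _ 12 H ltac:(lra)) as [X HX].
    assert (M1 := Rmax_l X 0). assert (M2 := Rmax_r X 0).
    exists (Rmax X 0 + 1); split; [lra|]; intros z Hz.
    assert (B := HX z ltac:(lra)).
    replace (Phi 0) with 12 in B by (unfold Phi; ring).
    between.
    replace (12 * z ^ 7 + _ + _ + _ + _ + _ + _ + _) with (z ^ 7 * Phi (/ z))
      by (unfold Phi; field; lra).
    apply Rmult_lt_0_compat; [apply pow_lt|]; lra. }
  edestruct dom as [X [HX HXz]].
  exists X; split; [lra|]; intros y Hy.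
  assert (Hy2 : X <= y ^ 2) by nra.
  assert (B := HXz (y ^ 2) Hy2).
  rewrite <- !pow_mult in B. simpl Nat.mul in B. unfold r_poly.
  exact B.
Qed.

Lemma r_poly_pos_beyond (m eta z y : R) :
  is_greatest_positive_root (r_poly m eta) z -> z < y -> 0 < r_poly m eta y.
Proof.
  intros [Hz [_ Hmax]] Hy.
  destruct (Rlt_dec 0 (r_poly m eta y)) as [H|H]; [exact H|exfalso].
  destruct (r_poly_eventually_pos m eta) as [X [HX HXp]].
  set (b := Rmax X (y + 1)).
  assert (B1 := Rmax_l X (y + 1)). assert (B2 := Rmax_r X (y + 1)). fold b in B1, B2.
  assert (Hb := HXp b B1).
  destruct (IVT_gen (r_poly m eta) y b 0) as [w [Hw Ew]].
  - intros t; eapply continuity_pt_of_is_derive.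
    unfold r_poly; auto_derive; [trivial|reflexivity].
  - rewrite Rmin_left, Rmax_right by lra; lra.
  - rewrite Rmin_left in Hw by lra.
    assert (L := Hmax w ltac:(lra) Ew). lra.
Qed.

Lemma qnum_pos_beyond (m eta z : R) : 0 < m -> 0 < eta ->
  is_greatest_positive_root (r_poly m eta) z ->
  m < z /\ forall y, z < y -> 0 < qnum m eta y.
Proof.
  intros Hm He Hz.
  destruct (ex_qnum_root m eta Hm He) as [y0 [H0 [Eq Hq]]].
  assert (HT : 0 < y0 ^ 2 - m ^ 2) by nra.
  assert (L : y0 <= z).
  { destruct (Rle_dec y0 z) as [H|H]; [exact H|exfalso].
    assert (P := r_poly_pos_beyond m eta z y0 Hz ltac:(lra)).
    rewrite (r_poly_at_qnum_root m eta y0) in P by (auto; lra).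
    assert (0 <= qnum1 m eta y0 ^ 2 * y0 ^ 2 * (y0 ^ 2 - m ^ 2) ^ 3).
    { apply Rmult_le_pos; [apply Rmult_le_pos; apply pow2_ge_0|apply pow_le; lra]. }
    lra. }
  split; [lra|intros y Hy; apply Hq; lra].
Qed.

(** * The derivatives of [U] and [W] *)

(** The derivative of [x ^ (- eta) * C nu x], and below its second derivative. *)
Definition ultra_slope (C : R -> R -> R) (nu eta y : R) : R :=
  Rpower y (- eta) * (cylinder_slope C nu y - eta / y * C nu y).

Definition ultra_slope1 (C : R -> R -> R) (nu eta y : R) : R :=
  - ((2 * eta + 1) / y) * ultra_slope C nu eta y
  - (1 - (nu ^ 2 - eta ^ 2) / y ^ 2) * (Rpower y (- eta) * C nu y).

Lemma is_derive_Rpower_neg (eta y : R) : 0 < y ->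
  is_derive (fun z => Rpower z (- eta)) y (- eta / y * Rpower y (- eta)).
Proof.
  intros Hy; unfold Rpower; auto_derive; [exact Hy|]. field; lra.
Qed.

Lemma is_derive_ultra (C : R -> R -> R) (nu eta y : R) : cylinder C -> 0 < y ->
  is_derive (fun z => Rpower z (- eta) * C nu z) y (ultra_slope C nu eta y).
Proof.
  intros HC Hy; eapply is_derive_eq;
    [exact (der_mult _ _ _ _ _ (is_derive_Rpower_neg eta y Hy) (cylinder_derive_up C nu y HC Hy))|].
  unfold ultra_slope, cylinder_slope; field; lra.
Qed.

Lemma is_derive_ultra_slope (C : R -> R -> R) (nu eta y : R) : cylinder C -> 0 < y ->
  is_derive (ultra_slope C nu eta) y (ultra_slope1 C nu eta y).
Proof.
  intros HC Hy.
  assert (D0 := cylinder_derive_up C nu y HC Hy).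
  assert (D1 := is_derive_cylinder_slope C nu y HC Hy).
  assert (Dq : is_derive (fun z => eta / z) y (- eta / y ^ 2)) by (auto_derive; [lra|field; lra]).
  eapply is_derive_eq;
    [exact (der_mult _ _ _ _ _ (is_derive_Rpower_neg eta y Hy)
       (der_minus _ _ _ _ _ D1 (der_mult _ _ _ _ _ Dq D0)))|].
  cbv beta; unfold ultra_slope1, ultra_slope, cylinder_slope; field; lra.
Qed.

(** Eliminating [C nu] between the first two derivatives makes the equation singular
    where [y ^ 2 = nu ^ 2 - eta ^ 2]. *)
Lemma is_derive_ultra_slope1 (C : R -> R -> R) (nu eta m y : R) :
  cylinder C -> 0 < y -> m ^ 2 = nu ^ 2 - eta ^ 2 -> 0 < y ^ 2 - m ^ 2 ->
  is_derive (ultra_slope1 C nu eta) y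
    (- ultra_a m eta y * ultra_slope1 C nu eta y - ultra_b m eta y * ultra_slope C nu eta y).
Proof.
  intros HC Hy Hm T.
  assert (D0 := is_derive_ultra C nu eta y HC Hy).
  assert (D1 := is_derive_ultra_slope C nu eta y HC Hy).
  assert (Dq : is_derive (fun z => - ((2 * eta + 1) / z)) y ((2 * eta + 1) / y ^ 2))
    by (auto_derive; [lra|field; lra]).
  assert (Dr : is_derive (fun z => 1 - (nu ^ 2 - eta ^ 2) / z ^ 2) y (2 * (nu ^ 2 - eta ^ 2) / y ^ 3))
    by (auto_derive; [simpl; nra|field; lra]).
  eapply is_derive_eq;
    [exact (der_minus _ _ _ _ _ (der_mult _ _ _ _ _ Dq D1) (der_mult _ _ _ _ _ Dr D0))|].
  cbv beta. unfold ultra_slope1 at 2. unfold ultra_a, ultra_b. rewrite <- Hm.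
  replace (ultra_slope1 C nu eta y) with
    (- ((2 * eta + 1) / y) * ultra_slope C nu eta y - (1 - m ^ 2 / y ^ 2) * (Rpower y (- eta) * C nu y))
    by (unfold ultra_slope1; now rewrite <- Hm).
  field; lra.
Qed.

Lemma wronskian_JY (A nu y : R) : hankel_pair A -> 0 < y ->
  BesselJ nu y * cylinder_slope BesselY nu y - cylinder_slope BesselJ nu y * BesselY nu y = A ^ 2 / y.
Proof.
  intros HA Hy; assert (E := hankel_wronskian A HA nu y Hy); unfold casoratian in E.
  unfold cylinder_slope; rewrite <- E; field; lra.
Qed.

Lemma wronskian_ultra (A nu eta y : R) : hankel_pair A -> 0 < y ->
  Rpower y (- eta) * BesselJ nu y * ultra_slope BesselY nu eta y
  - ultra_slope BesselJ nu eta y * (Rpower y (- eta) * BesselY nu y)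
  = Rpower y (- eta) ^ 2 * (A ^ 2 / y).
Proof.
  intros HA Hy; rewrite <- (wronskian_JY A nu y HA Hy); unfold ultra_slope; ring.
Qed.

Lemma wronskian_ultra_slope (A nu eta y : R) : hankel_pair A -> 0 < y ->
  ultra_slope BesselJ nu eta y * ultra_slope1 BesselY nu eta y
  - ultra_slope1 BesselJ nu eta y * ultra_slope BesselY nu eta y
  = (1 - (nu ^ 2 - eta ^ 2) / y ^ 2) * (Rpower y (- eta) ^ 2 * (A ^ 2 / y)).
Proof.
  intros HA Hy; rewrite <- (wronskian_ultra A nu eta y HA Hy); unfold ultra_slope1; ring.
Qed.

Lemma sqrt_sub_of_inv (m y : R) : 0 < y -> m ^ 2 < y ^ 2 ->
  sqrt (y ^ 2 - m ^ 2) = y * sqrt (1 - m ^ 2 * (/ y) ^ 2).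
Proof.
  intros Hy H.
  replace (y ^ 2 - m ^ 2) with (y ^ 2 * (1 - m ^ 2 * (/ y) ^ 2)) by (field; lra).
  rewrite sqrt_mult_alt by apply pow2_ge_0. now rewrite sqrt_pow2 by lra.
Qed.

Lemma one_sub_sq_pos (m y : R) : 0 < y -> m ^ 2 < y ^ 2 -> 0 < 1 - m ^ 2 * (/ y) ^ 2.
Proof.
  intros Hy H; replace (1 - m ^ 2 * (/ y) ^ 2) with ((y ^ 2 - m ^ 2) / y ^ 2) by (field; lra).
  apply Rdiv_lt_0_compat; [lra|apply pow_lt; lra].
Qed.

Lemma is_derive_acos_mul (m : R) : is_derive (fun u => acos (m * u)) 0 (- m).
Proof.
  assert (Hr : -1 < 0 < 1) by lra.
  assert (D : is_derive acos (m * 0) (-1)).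
  { rewrite Rmult_0_r; apply is_derive_Reals.
    replace (-1) with (-1 / sqrt (1 - 0²)).
    - rewrite <- (derive_pt_acos 0 Hr); apply derive_pt_eq_1 with (derivable_pt_acos 0 Hr); reflexivity.
    - unfold Rsqr; rewrite Rmult_0_r, Rminus_0_r, sqrt_1; field. }
  assert (Dm : is_derive (fun u => m * u) 0 m) by (auto_derive; [trivial|ring]).
  eapply is_derive_eq; [exact (der_comp _ _ _ _ _ Dm D)|ring].
Qed.

(** The common asymptotic form of [wkb] and [psi_lower]. *)
Lemma is_lim_phase_shape (m k e : R) : 0 < m ->
  is_lim (fun y => sqrt (y ^ 2 - m ^ 2) - k * acos (m / y) + e / sqrt (y ^ 2 - m ^ 2)
                   - (y - k * (PI / 2))) p_infty 0.
Proof.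
  intros Hm.
  set (S := fun u => sqrt (1 - m ^ 2 * u ^ 2)).
  set (Phi := fun u => - (m ^ 2 * u) / (S u + 1) - k * (acos (m * u) - PI / 2) + e * u / S u).
  assert (S0 : S 0 = 1) by (unfold S; rewrite pow_i, Rmult_0_r, Rminus_0_r, sqrt_1 by lia; reflexivity).
  replace (Finite 0) with (Finite (Phi 0)).
  2: { unfold Phi; rewrite S0, !Rmult_0_r, acos_0; f_equal; field. }
  apply is_lim_of_inv with m.
  - assert (DS : is_derive S 0 0).
    { unfold S; auto_derive; [simpl; lra|]. field.
      replace (1 + - (m * (m * 1) * (0 * (0 * 1)))) with 1 by ring. rewrite sqrt_1; lra. }
    eapply continuity_pt_of_is_derive; unfold Phi.
    apply der_plus; [apply der_minus|].
    + apply der_div; [|apply der_plus; [exact DS|apply @is_derive_const]|rewrite S0; lra].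
      apply (is_derive_ext (fun u => (- m ^ 2) * u)); [intros; simpl; ring|].
      apply der_scal, der_id.
    + apply der_scal, der_minus; [apply is_derive_acos_mul|apply @is_derive_const].
    + apply der_div; [apply der_scal, der_id|exact DS|rewrite S0; lra].
  - intros y Hy.
    assert (Hy2 : m ^ 2 < y ^ 2) by nra.
    assert (P := one_sub_sq_pos m y ltac:(lra) Hy2).
    rewrite sqrt_sub_of_inv by lra. unfold Phi. fold (S (/ y)).
    assert (PS : 0 < S (/ y)) by (now apply sqrt_lt_R0).
    assert (ES : S (/ y) * S (/ y) = 1 - m ^ 2 * (/ y) ^ 2) by (apply sqrt_sqrt; lra).
    change (m * / y) with (m / y).
    set (s := S (/ y)) in *.
    assert (E1 : - (m ^ 2 * / y) / (s + 1) = y * s - y).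
    { assert (E2 : m ^ 2 = y ^ 2 * (1 - s * s)) by (rewrite ES; field; lra).
      rewrite E2; field; lra. }
    rewrite E1; field; lra.
Qed.

Lemma is_lim_low1 (m eta : R) : 0 < m -> is_lim (low1 m eta) p_infty 1.
Proof.
  intros Hm.
  set (S := fun u => 1 - m ^ 2 * u ^ 2).
  set (Phi := fun u => ((S u - eta ^ 2 / 2 * u ^ 2) * S u - eta * u ^ 2) / (S u * sqrt (S u))).
  assert (S0 : S 0 = 1) by (unfold S; ring).
  replace (Finite 1) with (Finite (Phi 0)) by (unfold Phi; rewrite S0, sqrt_1; f_equal; field).
  apply is_lim_of_inv with m.
  - eapply continuity_pt_of_is_derive; unfold Phi, S; auto_derive; [|reflexivity].
    replace (1 + - (m * (m * 1) * (0 * (0 * 1)))) with 1 by ring. rewrite sqrt_1.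
    simpl; repeat split; lra.
  - intros y Hy.
    assert (Hy2 : m ^ 2 < y ^ 2) by nra.
    assert (P := one_sub_sq_pos m y ltac:(lra) Hy2).
    unfold low1; rewrite sqrt_sub_of_inv by lra. unfold Phi.
    fold (S (/ y)) in P |- *.
    assert (PS := sqrt_lt_R0 _ P).
    assert (E : y ^ 2 - m ^ 2 = y ^ 2 * S (/ y)) by (unfold S; field; lra).
    unfold qnum; rewrite E. set (s := S (/ y)) in *. field; repeat split; lra.
Qed.

Lemma is_lim_dlow (m eta : R) : 0 < m -> 
  (exists X, forall y, X < y -> 0 < qnum m eta y) -> is_lim (dlow m eta) p_infty 0.
Proof.
  intros Hm [X HX].
  set (S := fun u => 1 - m ^ 2 * u ^ 2).
  set (q := fun u => (S u - eta ^ 2 / 2 * u ^ 2) * S u - eta * u ^ 2).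
  set (Phi := fun u => (2 * u * (2 * S u - (eta ^ 2 / 2 + eta) * u ^ 2) / q u - u - 3 * u / S u) / 2).
  assert (S0 : S 0 = 1) by (unfold S; ring).
  assert (q0 : q 0 = 1) by (unfold q; rewrite S0; ring).
  replace (Finite 0) with (Finite (Phi 0)) by (unfold Phi; rewrite S0, q0; f_equal; field).
  apply is_lim_of_inv with (Rmax m X).
  - eapply continuity_pt_of_is_derive; unfold Phi, q, S; auto_derive; [|reflexivity].
    repeat split; simpl; lra.
  - intros y Hy.
    assert (H1 := Rmax_l m X). assert (H2 := Rmax_r m X).
    assert (Hy2 : m ^ 2 < y ^ 2) by nra.
    assert (P := one_sub_sq_pos m y ltac:(lra) Hy2).
    fold (S (/ y)) in P. assert (Q := HX y ltac:(lra)).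
    assert (E : y ^ 2 - m ^ 2 = y ^ 2 * S (/ y)) by (unfold S; field; lra).
    assert (Eq : qnum m eta y = y ^ 4 * q (/ y)) by (unfold qnum, q; rewrite E; field; lra).
    assert (Pq : 0 < q (/ y)).
    { rewrite Eq in Q. assert (0 < y ^ 4) by (apply pow_lt; lra).
      apply (Rmult_lt_reg_l (y ^ 4)); lra. }
    unfold dlow, Phi; rewrite Eq, E; unfold qnum1; rewrite E.
    set (s := S (/ y)) in *. set (p := q (/ y)) in *. field; repeat split; lra.
Qed.

(** * The branch of [psi] at infinity *)
Lemma Derive_U (A nu eta y : R) : hankel_pair A -> 0 < y ->
  Derive (U nu eta) y = ultra_slope BesselJ nu eta y.
Proof.
  intros HA Hy; apply is_derive_unique.
  exact (is_derive_ultra BesselJ nu eta y (hankel_J A HA) Hy).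
Qed.

Lemma Derive_W (A nu eta y : R) : hankel_pair A -> 0 < y ->
  Derive (W nu eta) y = ultra_slope BesselY nu eta y.
Proof.
  intros HA Hy; apply is_derive_unique.
  exact (is_derive_ultra BesselY nu eta y (hankel_Y A HA) Hy).
Qed.

Definition polar (c s rho h : R -> R) : Prop :=
  forall y, 0 < y -> 0 < rho y /\ c y = rho y * cos (h y) /\ s y = rho y * sin (h y).

(** [U'] and [W'] have no common zero because the Wronskian of [(U, W)] does not
    vanish. *)
Lemma polar_of_is_psi (A nu eta : R) (psi : R -> R) : hankel_pair A -> is_psi nu eta psi ->
  polar (ultra_slope BesselJ nu eta) (ultra_slope BesselY nu eta) (L nu eta) psi.
Proof.
  intros HA [Hpol _] y Hy; destruct (Hpol y Hy) as [E1 E2].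
  unfold L in *; rewrite !(Derive_U A), !(Derive_W A) in * by assumption.
  split; [|split; assumption].
  apply sqrt_lt_R0.
  assert (Wr := wronskian_ultra A nu eta y HA Hy).
  assert (Pos : 0 < Rpower y (- eta) ^ 2 * (A ^ 2 / y)).
  { assert (PA := hankel_amplitude A HA).
    apply Rmult_lt_0_compat; [apply pow_lt, Rpower_pos|].
    apply Rdiv_lt_0_compat; [now apply pow_lt|exact Hy]. }
  set (a := ultra_slope BesselJ nu eta y) in *. set (b := ultra_slope BesselY nu eta y) in *.
  assert (Ha := pow2_ge_0 a). assert (Hb := pow2_ge_0 b).
  destruct (Rlt_dec 0 (a ^ 2 + b ^ 2)) as [H|H]; [exact H|exfalso].
  assert (a = 0) by nra. assert (b = 0) by nra. nra.
Qed.

Lemma continuity_pt_of_is_psi (nu eta : R) (psi : R -> R) (y : R) :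
  is_psi nu eta psi -> 0 < y -> continuity_pt psi y.
Proof. intros [_ [Hc _]] Hy; apply continuity_pt_filterlim, Hc, Hy. Qed.

(** The Wronskian of [(U, W)] is positive, so a phase of [U + i W] runs
    between [psi - PI] and [psi]. *)
Lemma ex_theta (A nu eta : R) (psi ell : R -> R) : hankel_pair A ->
  polar (ultra_slope BesselJ nu eta) (ultra_slope BesselY nu eta) ell psi ->
  (forall y, 0 < y -> continuity_pt psi y) ->
  exists theta rho, polar (BesselJ nu) (BesselY nu) rho theta /\
    (forall y, 0 < y -> continuity_pt theta y) /\
    (forall y, 0 < y -> psi y - PI < theta y < psi y).
Proof.
  intros HA Hpol Hc.
  set (M := fun y => BesselJ nu y * cos (psi y) + BesselY nu y * sin (psi y)).
  set (N := fun y => BesselJ nu y * sin (psi y) - BesselY nu y * cos (psi y)).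
  assert (PN : forall y, 0 < y -> 0 < N y).
  { intros y Hy; destruct (Hpol y Hy) as [P [E1 E2]].
    assert (Wr := wronskian_ultra A nu eta y HA Hy). rewrite E1, E2 in Wr.
    assert (PA := hankel_amplitude A HA).
    assert (PR := Rpower_pos y (- eta)).
    assert (Pos : 0 < Rpower y (- eta) ^ 2 * (A ^ 2 / y)).
    { apply Rmult_lt_0_compat; [now apply pow_lt|].
      apply Rdiv_lt_0_compat; [now apply pow_lt|exact Hy]. }
    assert (E : Rpower y (- eta) * ell y * N y = Rpower y (- eta) ^ 2 * (A ^ 2 / y))
      by (rewrite <- Wr; unfold N; ring).
    apply (Rmult_lt_reg_l (Rpower y (- eta) * ell y)); [now apply Rmult_lt_0_compat|].
    rewrite E; lra. }
  assert (CJ : forall y, 0 < y -> continuity_pt (BesselJ nu) y)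
    by (intros y Hy; eapply continuity_pt_of_is_derive, (cylinder_derive_up _ _ _ (hankel_J A HA) Hy)).
  assert (CY : forall y, 0 < y -> continuity_pt (BesselY nu) y)
    by (intros y Hy; eapply continuity_pt_of_is_derive, (cylinder_derive_up _ _ _ (hankel_Y A HA) Hy)).
  assert (Cc : forall y, 0 < y -> continuity_pt (fun z => cos (psi z)) y)
    by (intros y Hy; apply (continuity_pt_comp psi cos); [now apply Hc|apply continuity_cos]).
  assert (Cs : forall y, 0 < y -> continuity_pt (fun z => sin (psi z)) y)
    by (intros y Hy; apply (continuity_pt_comp psi sin); [now apply Hc|apply continuity_sin]).
  set (theta := fun y => psi y - PI / 2 + atan (M y / N y)).
  exists theta, (fun y => sqrt (M y ^ 2 + N y ^ 2)).
  split; [|split].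
  - intros y Hy; assert (P := PN y Hy).
    assert (PMN : 0 < M y ^ 2 + N y ^ 2).
    { assert (H := pow2_ge_0 (M y)). assert (0 < N y ^ 2) by now apply pow_lt. lra. }
    assert (Hs := sqrt_lt_R0 _ PMN).
    assert (Es : sqrt (1 + (M y / N y)²) = sqrt (M y ^ 2 + N y ^ 2) / N y).
    { replace (1 + (M y / N y)²) with ((M y ^ 2 + N y ^ 2) / N y ^ 2) by (unfold Rsqr; field; lra).
      rewrite sqrt_div_alt by (apply pow_lt; exact P). now rewrite sqrt_pow2 by lra. }
    assert (T := sin_cos_sq (psi y)).
    assert (E1 : BesselJ nu y = N y * sin (psi y) + M y * cos (psi y)).
    { unfold M, N; transitivity (BesselJ nu y * (sin (psi y) * sin (psi y) + cos (psi y) * cos (psi y)));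
        [rewrite T|]; ring. }
    assert (E2 : BesselY nu y = M y * sin (psi y) - N y * cos (psi y)).
    { unfold M, N; transitivity (BesselY nu y * (sin (psi y) * sin (psi y) + cos (psi y) * cos (psi y)));
        [rewrite T|]; ring. }
    split; [exact Hs|].
    unfold theta. replace (psi y - PI / 2 + atan (M y / N y)) with (psi y + atan (M y / N y) - PI / 2) by ring.
    rewrite cos_minus, sin_minus, cos_PI2, sin_PI2, cos_plus, sin_plus, cos_atan, sin_atan, Es, E1, E2.
    set (r := sqrt (M y ^ 2 + N y ^ 2)) in *. split; field; lra.
  - intros y Hy; unfold theta.
    apply (continuity_pt_plus (fun y => psi y - PI / 2) (fun y => atan (M y / N y))).
    + apply (continuity_pt_minus psi (fun _ => PI / 2)); [now apply Hc|now apply continuity_pt_const].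
    + apply (continuity_pt_comp (fun y => M y / N y) atan);
        [|eapply continuity_pt_of_is_derive, is_derive_Reals, derivable_pt_lim_atan].
      apply (continuity_pt_div M N); [| |assert (P := PN y Hy); lra].
      * apply (continuity_pt_plus (fun z => BesselJ nu z * cos (psi z)) (fun z => BesselY nu z * sin (psi z)));
          apply continuity_pt_mult; auto.
      * apply (continuity_pt_minus (fun z => BesselJ nu z * sin (psi z)) (fun z => BesselY nu z * cos (psi z)));
          apply continuity_pt_mult; auto.
  - intros y Hy; unfold theta; assert (B := atan_bound (M y / N y)). lra.
Qed.

(** A bound with total error below [2 PI]: it selects, among the values
    compatible with the asymptotics of [cos psi] and [sin psi], the branch of
    [psi] at infinity. *)
Lemma psi_gt_wkb (A nu eta : R) (psi : R -> R) (y : R) :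
  hankel_pair A -> 0 < nu -> is_psi nu eta psi -> nu + 1 < y ->
  wkb nu y - 3 * (PI / 2) - 1 / 10 < psi y.
Proof.
  intros HA Hnu Hpsi Hy.
  assert (HPI := PI_RGT_0).
  destruct (ex_theta A nu eta psi (L nu eta) HA (polar_of_is_psi A nu eta psi HA Hpsi))
    as [theta [rho [Hpol [Hc Hth]]]].
  { intros z Hz; now apply (continuity_pt_of_is_psi nu eta). }
  set (wJ := cylinder_slope BesselJ nu). set (wY := cylinder_slope BesselY nu).
  destruct (is_phase_of_solutions 0 (fun y => 1 / y) (fun y => 1 - nu ^ 2 / y ^ 2)
    (fun y => - (1 / y ^ 2)) (BesselJ nu) (BesselY nu) wJ wY theta rho) as [d1 [Hph Hpot]].
  - intros z Hz; auto_derive; [lra|field; lra].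
  - intros z Hz; split; apply cylinder_derive_up; try exact Hz;
      [exact (hankel_J A HA)|exact (hankel_Y A HA)].
  - intros z Hz; split; apply is_derive_cylinder_slope; try exact Hz;
      [exact (hankel_J A HA)|exact (hankel_Y A HA)].
  - intros z Hz; unfold wJ, wY; rewrite (wronskian_JY A) by assumption.
    assert (PA := hankel_amplitude A HA).
    apply Rdiv_lt_0_compat; [now apply pow_lt|exact Hz].
  - exact Hpol.
  - exact Hc.
  - (* [theta] increases and is bounded below by [psi - PI], which tends to [- PI / 2] at [0] *)
    assert (low : forall t, 0 < t -> - (PI / 2) <= theta t).
    { intros t Ht; destruct (Rle_dec (- (PI / 2)) (theta t)) as [H|H]; [exact H|exfalso].
      destruct Hpsi as [_ [_ Hlim]].
      set (e := - (PI / 2) - theta t).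
      assert (He : 0 < e) by (unfold e; lra).
      destruct (Hlim (fun v => Rabs (v - PI / 2) < e)) as [d Hd].
      { exists (mkposreal e He); intros v Hv; exact Hv. }
      assert (Pd := cond_pos d).
      assert (Hm : 0 < Rmin (d / 2) (t / 2)) by (apply Rmin_case; lra).
      assert (M1 := Rmin_l (d / 2) (t / 2)). assert (M2 := Rmin_r (d / 2) (t / 2)).
      set (z := Rmin (d / 2) (t / 2)) in *.
      assert (B : Rabs (psi z - PI / 2) < e).
      { apply Hd; [|exact Hm]. change (Rabs (z - 0) < d). rewrite Rminus_0_r, Rabs_pos_eq; lra. }
      apply Rabs_lt_between in B.
      destruct (mvt theta _ z t ltac:(lra) (fun w Hw => phase_der _ _ _ _ _ Hph w ltac:(lra)))
        as [w [Hw E]].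
      - cbv beta in E.
        assert (P := phase_pos _ _ _ _ _ Hph w ltac:(lra)). cbv beta in P.
        assert (Hz := Hth z Hm). unfold e in B. nra. }
    set (t1 := sqrt (nu ^ 2 + 1 / 100)).
    assert (Pn2 : 0 < nu ^ 2) by (apply pow_lt; exact Hnu).
    assert (E1 : t1 ^ 2 = nu ^ 2 + 1 / 100) by (unfold t1; apply pow2_sqrt; lra).
    assert (P1 : 0 < t1) by (apply sqrt_lt_R0; lra).
    assert (H1 : nu < t1).
    { destruct (Rlt_dec nu t1) as [H|H]; [exact H|exfalso].
      assert (t1 ^ 2 <= nu ^ 2) by (apply pow_incr; lra). lra. }
    assert (H2 : t1 < nu + 1).
    { destruct (Rlt_dec t1 (nu + 1)) as [H|H]; [exact H|exfalso].
      assert ((nu + 1) ^ 2 <= t1 ^ 2) by (apply pow_incr; lra). nra. }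
    assert (Hw : wkb nu t1 <= 1 / 10).
    { unfold wkb; rewrite E1. replace (nu ^ 2 + 1 / 100 - nu ^ 2) with ((1 / 10) ^ 2) by field.
      rewrite sqrt_pow2 by lra.
      assert (B := acos_bound (nu / t1)). nra. }
    assert (C := comparison_le nu t1 (wkb nu) _ _ _ theta _ _ d1 (is_phase_wkb nu Hnu)
       (is_phase_weaken 0 nu theta _ _ _ (Rlt_le _ _ Hnu) Hph) t1 y).
    rewrite pruefer_gap_start in C.
    match type of C with _ -> _ -> _ -> _ <= _ + ?G => assert (Gb : Rabs G < PI) by apply abs_pruefer_gap_lt end.
    apply Rabs_lt_between in Gb.
    assert (C' := C ltac:(intros z Hz; rewrite Hpot by lra;
       eapply Rle_trans; [left; apply potential_wkb_lt; assumption|right; field; lra]) H1 ltac:(lra)).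
    assert (Ht1 := low t1 P1). assert (Hty := Hth y ltac:(lra)). lra.
Qed.

(** * Asymptotics of [psi] *)
Section Asymptotics.

Variables (A nu eta : R) (psi : R -> R).
Hypothesis (HA : hankel_pair A) (He : 0 < eta) (Hen : eta < nu).
Hypothesis (Hpsi : is_psi nu eta psi).

Let m : R := mu_of nu eta.
Let t (y : R) : R := y - nu * (PI / 2) - PI / 4.
(* [aJ] and [aY] are [sqrt y * y ^ eta] times [U'] and [W']; they approach
   [- A sin t] and [A cos t]. *)
Let aJ (y : R) : R := (nu - eta) * (/ y * (sqrt y * BesselJ nu y)) - sqrt y * BesselJ (nu + 1) y.
Let aY (y : R) : R := (nu - eta) * (/ y * (sqrt y * BesselY nu y)) - sqrt y * BesselY (nu + 1) y.
Let nrm (y : R) : R := aJ y ^ 2 + aY y ^ 2.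
Let dot (y : R) : R := aJ y * (sqrt y * BesselJ nu y) + aY y * (sqrt y * BesselY nu y).

Let A_pos : 0 < A := hankel_amplitude A HA.

Lemma mu_of_pos : 0 < m.
Proof. apply sqrt_lt_R0; nra. Qed.

Lemma mu_of_sq : m ^ 2 = nu ^ 2 - eta ^ 2.
Proof. apply pow2_sqrt; nra. Qed.

Lemma abs_Acos_le (s : R) : Rabs (A * cos s) <= A.
Proof.
  rewrite Rabs_mult, (Rabs_pos_eq A) by lra.
  assert (B := abs_cos_le_1 s). nra.
Qed.

Lemma abs_Asin_le (s : R) : Rabs (A * sin s) <= A.
Proof.
  rewrite Rabs_mult, (Rabs_pos_eq A) by lra.
  assert (B := abs_sin_le_1 s). nra.
Qed.

Let eJ (y : R) : R := aJ y + A * sin (t y).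
Let eY (y : R) : R := aY y - A * cos (t y).
Let oJ (y : R) : R := sqrt y * BesselJ nu y - A * cos (t y).
Let oY (y : R) : R := sqrt y * BesselY nu y - A * sin (t y).

Lemma is_lim_oJ : is_lim oJ p_infty 0.
Proof. exact (hankel_limJ A HA nu). Qed.

Lemma is_lim_oY : is_lim oY p_infty 0.
Proof. exact (hankel_limY A HA nu). Qed.

Lemma is_lim_eJ : is_lim eJ p_infty 0.
Proof.
  assert (L1 := hankel_limJ A HA (nu + 1)).
  assert (L : is_lim (fun y => (nu - eta) * (/ y * oJ y + A * cos (t y) * / y)
     + -1 * (sqrt y * BesselJ (nu + 1) y - A * cos (y - (nu + 1) * (PI / 2) - PI / 4))) p_infty 0).
  { apply is_lim_0_plus; [|apply is_lim_0_scal, L1].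
    apply is_lim_0_scal, is_lim_0_plus.
    - apply is_lim_0_mult; [apply is_lim_inv_infty|apply is_lim_oJ].
    - apply (is_lim_bounded_mult (fun y => A * cos (t y)) Rinv A); [intros; apply abs_Acos_le|].
      apply is_lim_inv_infty. }
  refine (is_lim_ext _ _ _ _ _ L); intros y; unfold eJ, aJ, oJ.
  replace (y - (nu + 1) * (PI / 2) - PI / 4) with (t y - PI / 2) by (unfold t; field).
  rewrite (cos_minus (t y) (PI / 2)), cos_PI2, sin_PI2; ring.
Qed.

Lemma is_lim_eY : is_lim eY p_infty 0.
Proof.
  assert (L1 := hankel_limY A HA (nu + 1)).
  assert (L : is_lim (fun y => (nu - eta) * (/ y * oY y + A * sin (t y) * / y)
     + -1 * (sqrt y * BesselY (nu + 1) y - A * sin (y - (nu + 1) * (PI / 2) - PI / 4))) p_infty 0).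
  { apply is_lim_0_plus; [|apply is_lim_0_scal, L1].
    apply is_lim_0_scal, is_lim_0_plus.
    - apply is_lim_0_mult; [apply is_lim_inv_infty|apply is_lim_oY].
    - apply (is_lim_bounded_mult (fun y => A * sin (t y)) Rinv A); [intros; apply abs_Asin_le|].
      apply is_lim_inv_infty. }
  refine (is_lim_ext _ _ _ _ _ L); intros y; unfold eY, aY, oY.
  replace (y - (nu + 1) * (PI / 2) - PI / 4) with (t y - PI / 2) by (unfold t; field).
  rewrite (sin_minus (t y) (PI / 2)), cos_PI2, sin_PI2; ring.
Qed.

Lemma is_lim_nrm : is_lim nrm p_infty (A ^ 2).
Proof.
  assert (L : is_lim (fun y => eJ y * eJ y + (-2) * (A * sin (t y) * eJ y)
     + (eY y * eY y + 2 * (A * cos (t y) * eY y)) ) p_infty 0).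
  { apply is_lim_0_plus; apply is_lim_0_plus.
    - apply is_lim_0_mult; apply is_lim_eJ.
    - apply is_lim_0_scal, (is_lim_bounded_mult (fun y => A * sin (t y)) _ A);
        [intros; apply abs_Asin_le|apply is_lim_eJ].
    - apply is_lim_0_mult; apply is_lim_eY.
    - apply is_lim_0_scal, (is_lim_bounded_mult (fun y => A * cos (t y)) _ A);
        [intros; apply abs_Acos_le|apply is_lim_eY]. }
  assert (L' := is_lim_plus' _ _ _ _ _ L (is_lim_const (A ^ 2) p_infty)).
  rewrite Rplus_0_l in L'.
  refine (is_lim_ext _ _ _ _ _ L'); intros y; unfold nrm, eJ, eY.
  assert (T := sin_cos_sq (t y)).
  transitivity (aJ y ^ 2 + aY y ^ 2 + A ^ 2 * (1 - (sin (t y) * sin (t y) + cos (t y) * cos (t y))));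
    [|rewrite T]; ring.
Qed.

Lemma is_lim_dot : is_lim dot p_infty 0.
Proof.
  assert (Bc : forall f, is_lim f p_infty 0 -> is_lim (fun y => A * cos (t y) * f y) p_infty 0)
    by (intros f Hf; apply (is_lim_bounded_mult (fun y => A * cos (t y)) f A);
        [intros; apply abs_Acos_le|exact Hf]).
  assert (Bs : forall f, is_lim f p_infty 0 -> is_lim (fun y => A * sin (t y) * f y) p_infty 0)
    by (intros f Hf; apply (is_lim_bounded_mult (fun y => A * sin (t y)) f A);
        [intros; apply abs_Asin_le|exact Hf]).
  assert (L : is_lim (fun y => (A * cos (t y) * eJ y + eJ y * oJ y + -1 * (A * sin (t y) * oJ y))
     + (A * sin (t y) * eY y + eY y * oY y + A * cos (t y) * oY y)) p_infty 0).
  { apply is_lim_0_plus; (apply is_lim_0_plus; [apply is_lim_0_plus|]).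
    - apply Bc, is_lim_eJ.
    - apply is_lim_0_mult; [apply is_lim_eJ|apply is_lim_oJ].
    - apply is_lim_0_scal, Bs, is_lim_oJ.
    - apply Bs, is_lim_eY.
    - apply is_lim_0_mult; [apply is_lim_eY|apply is_lim_oY].
    - apply Bc, is_lim_oY. }
  refine (is_lim_ext _ _ _ _ _ L); intros y; unfold dot, eJ, eY, oJ, oY; ring.
Qed.

Lemma ultra_slope_aJ (y : R) : 0 < y ->
  ultra_slope BesselJ nu eta y = Rpower y (- eta) / sqrt y * aJ y.
Proof.
  intros Hy; assert (Hs := sqrt_lt_R0 y Hy).
  unfold ultra_slope, cylinder_slope, aJ; field; lra.
Qed.

Lemma ultra_slope_aY (y : R) : 0 < y ->
  ultra_slope BesselY nu eta y = Rpower y (- eta) / sqrt y * aY y.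
Proof.
  intros Hy; assert (Hs := sqrt_lt_R0 y Hy).
  unfold ultra_slope, cylinder_slope, aY; field; lra.
Qed.

Lemma nrm_pos (y : R) : 0 < y -> 0 < nrm y.
Proof.
  intros Hy; destruct (polar_of_is_psi A nu eta psi HA Hpsi y Hy) as [P [E1 E2]].
  rewrite ultra_slope_aJ in E1 by exact Hy. rewrite ultra_slope_aY in E2 by exact Hy.
  unfold nrm; assert (H1 := pow2_ge_0 (aJ y)); assert (H2 := pow2_ge_0 (aY y)).
  destruct (Rlt_dec 0 (aJ y ^ 2 + aY y ^ 2)) as [H|H]; [exact H|exfalso].
  assert (Z1 : aJ y = 0) by nra. assert (Z2 : aY y = 0) by nra.
  rewrite Z1, Rmult_0_r in E1. rewrite Z2, Rmult_0_r in E2.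
  assert (T := sin_cos_sq (psi y)).
  assert (cos (psi y) = 0) by (apply (Rmult_eq_reg_l (L nu eta y)); lra).
  assert (sin (psi y) = 0) by (apply (Rmult_eq_reg_l (L nu eta y)); lra). nra.
Qed.

Lemma is_lim_one_sub : is_lim (fun y => 1 - m ^ 2 / y ^ 2) p_infty 1.
Proof.
  set (Phi := fun u => 1 - m ^ 2 * u ^ 2).
  replace (Finite 1) with (Finite (Phi 0)) by (unfold Phi; f_equal; ring).
  apply is_lim_of_inv with 0.
  - eapply continuity_pt_of_is_derive; unfold Phi; auto_derive; [trivial|reflexivity].
  - intros y Hy; unfold Phi; field; lra.
Qed.

Lemma is_lim_ultra_a : is_lim (ultra_a m eta) p_infty 0.
Proof.
  set (Phi := fun u => (2 * eta + 1) * u - 2 * m ^ 2 * u ^ 3 / (1 - m ^ 2 * u ^ 2)).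
  replace (Finite 0) with (Finite (Phi 0)) by (unfold Phi; f_equal; field).
  assert (Hm := mu_of_pos).
  apply is_lim_of_inv with m.
  - eapply continuity_pt_of_is_derive; unfold Phi; auto_derive; [simpl; lra|reflexivity].
  - intros y Hy; assert (Hy2 : 0 < y ^ 2 - m ^ 2) by nra.
    assert (P := one_sub_sq_pos m y ltac:(lra) ltac:(lra)).
    unfold ultra_a, Phi. replace (1 - m ^ 2 * (/ y) ^ 2) with ((y ^ 2 - m ^ 2) / y ^ 2) by (field; lra).
    field; lra.
Qed.

(** [psi1] and [dpsi] are quotients of quadratic forms in [U], [W] and their
    derivatives, so their limits follow from the asymptotics of [J] and [Y]. *)
Lemma ex_psi_phase : exists psi1 dpsi d1,
  is_phase m psi psi1 dpsi d1 /\
  (forall y, m < y -> potential psi1 dpsi d1 y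
     = ultra_b m eta y - ultra_a m eta y ^ 2 / 4 - ultra_a1 m eta y / 2) /\
  is_lim psi1 p_infty 1 /\ is_lim dpsi p_infty 0.
Proof.
  assert (Hm := mu_of_pos). assert (Hm2 := mu_of_sq).
  assert (HJ := hankel_J A HA). assert (HY := hankel_Y A HA).
  destruct (is_phase_of_solutions m (ultra_a m eta) (ultra_b m eta) (ultra_a1 m eta)
    (ultra_slope BesselJ nu eta) (ultra_slope BesselY nu eta)
    (ultra_slope1 BesselJ nu eta) (ultra_slope1 BesselY nu eta) psi (L nu eta)) as [d1 [Hph Hpot]].
  - intros y Hy; assert (T : 0 < y ^ 2 - m ^ 2) by nra.
    unfold ultra_a, ultra_a1; auto_derive.
    + simpl in T; repeat split; try lra. apply Rmult_integral_contrapositive_currified; lra.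
    + simpl in T; field; simpl; repeat split; lra.
  - intros y Hy; split; apply is_derive_ultra_slope; auto; lra.
  - intros y Hy; assert (T : 0 < y ^ 2 - m ^ 2) by nra.
    split; apply is_derive_ultra_slope1; auto; lra.
  - intros y Hy; assert (T : 0 < y ^ 2 - m ^ 2) by nra.
    rewrite (wronskian_ultra_slope A) by (auto; lra). rewrite <- Hm2.
    replace (1 - m ^ 2 / y ^ 2) with ((y ^ 2 - m ^ 2) / y ^ 2) by (field; lra).
    apply Rmult_lt_0_compat; [apply Rdiv_lt_0_compat; [exact T|apply pow_lt; lra]|].
    apply Rmult_lt_0_compat; [apply pow_lt, Rpower_pos|].
    apply Rdiv_lt_0_compat; [now apply pow_lt|lra].
  - intros y Hy; apply (polar_of_is_psi A nu eta psi HA Hpsi); lra.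
  - intros y Hy; apply (continuity_pt_of_is_psi nu eta psi); auto; lra.
  - eexists _, _, d1; split; [exact Hph|]; split; [exact Hpot|]; split.
    + assert (Lim1 := is_lim_mult_fin _ _ _ _ is_lim_one_sub
        (is_lim_div_fin (fun _ => A ^ 2) nrm (A ^ 2) (A ^ 2) ltac:(apply pow_nonzero; lra)
           (is_lim_const _ _) is_lim_nrm)).
      replace (1 * (A ^ 2 / A ^ 2)) with 1 in Lim1 by (field; lra).
      refine (is_lim_ext_loc _ _ _ _ _ Lim1). exists m; intros y Hy.
      assert (Py : 0 < y) by lra. assert (Pn := nrm_pos y Py).
      assert (Hs := sqrt_lt_R0 y Py). assert (Es := sqrt_sqrt y (Rlt_le _ _ Py)).
      rewrite (wronskian_ultra_slope A) by assumption. rewrite <- Hm2.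
      rewrite ultra_slope_aJ, ultra_slope_aY by exact Py.
      assert (PE := Rpower_pos y (- eta)). set (E := Rpower y (- eta)) in *.
      replace ((E / sqrt y * aJ y) ^ 2 + (E / sqrt y * aY y) ^ 2) with (E ^ 2 * nrm y / y)
        by (unfold nrm; set (a := aJ y); set (b := aY y); set (r := sqrt y) in *;
            clearbody a b r E; rewrite <- Es; field; lra).
      field; repeat split; lra.
    + assert (Lim2 : is_lim (fun y => (- / 2) * ultra_a m eta y + ((2 * eta + 1) * / y
          + (1 - m ^ 2 / y ^ 2) * (dot y / nrm y))) p_infty 0).
      { apply is_lim_0_plus; [apply is_lim_0_scal, is_lim_ultra_a|].
        apply is_lim_0_plus; [apply is_lim_0_scal, is_lim_inv_infty|].
        assert (Lim3 := is_lim_mult_fin _ _ _ _ is_lim_one_sub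
          (is_lim_div_fin dot nrm 0 (A ^ 2) ltac:(apply pow_nonzero; lra) is_lim_dot is_lim_nrm)).
        replace (1 * (0 / A ^ 2)) with 0 in Lim3 by (field; lra). exact Lim3. }
      refine (is_lim_ext_loc _ _ _ _ _ Lim2). exists m; intros y Hy.
      assert (Py : 0 < y) by lra. assert (Pn := nrm_pos y Py).
      assert (Hs := sqrt_lt_R0 y Py). assert (Es := sqrt_sqrt y (Rlt_le _ _ Py)).
      unfold ultra_slope1; rewrite <- Hm2.
      rewrite ultra_slope_aJ, ultra_slope_aY by exact Py.
      assert (PE := Rpower_pos y (- eta)). set (E := Rpower y (- eta)) in *.
      replace ((E / sqrt y * aJ y) ^ 2 + (E / sqrt y * aY y) ^ 2) with (E ^ 2 * nrm y / y)
        by (unfold nrm; set (a := aJ y); set (b := aY y); set (r := sqrt y) in *;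
            clearbody a b r E; rewrite <- Es; field; lra).
      replace (E / sqrt y * aJ y * (- ((2 * eta + 1) / y) * (E / sqrt y * aJ y)
           - (1 - m ^ 2 / y ^ 2) * (E * BesselJ nu y))
         + E / sqrt y * aY y * (- ((2 * eta + 1) / y) * (E / sqrt y * aY y)
           - (1 - m ^ 2 / y ^ 2) * (E * BesselY nu y)))
        with (- ((2 * eta + 1) / y) * (E ^ 2 * nrm y / y) - (1 - m ^ 2 / y ^ 2) * (E ^ 2 * dot y / y))
        by (unfold nrm, dot; set (a := aJ y); set (b := aY y); set (j := BesselJ nu y);
            set (k := BesselY nu y); set (r := sqrt y) in *;
            clearbody a b j k r E; rewrite <- Es; field; lra).
      field; repeat split; lra.
Qed.

(** [psi] is asymptotically the argument [t + PI / 2] of [- sin t + i cos t], up to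
    a multiple of [2 PI], and so is [psi_lower]. *)
Lemma is_lim_cos_gap : is_lim (fun y => cos (psi_lower nu eta y - psi y)) p_infty 1.
Proof.
  assert (Hm := mu_of_pos).
  set (w := fun y => psi_lower nu eta y - (t y + PI / 2)).
  assert (Lw : is_lim w p_infty 0).
  { assert (S := is_lim_phase_shape m (eta ^ 2 / (2 * m) + m) eta Hm).
    refine (is_lim_ext_loc _ _ _ _ _ S); exists m; intros y Hy.
    assert (Hs : 0 < sqrt (y ^ 2 - m ^ 2)) by (apply sqrt_lt_R0; nra).
    unfold w, psi_lower, t; fold m. field; lra. }
  assert (Lc : is_lim (fun y => cos (w y)) p_infty 1).
  { rewrite <- cos_0; apply (is_lim_comp_continuous w cos p_infty 0); [exact Lw|].
    apply continuity_pt_filterlim, continuity_cos. }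
  assert (Ln : is_lim (fun y => A * cos (w y) + (- sin (t y + w y) * eJ y + cos (t y + w y) * eY y))
                p_infty (A * 1 + 0)).
  { apply is_lim_plus'; [apply (is_lim_scal_l _ A p_infty (Finite 1)), Lc|].
    apply is_lim_0_plus.
    - apply (is_lim_bounded_mult (fun y => - sin (t y + w y)) eJ 1); [|apply is_lim_eJ].
      intros y; rewrite Rabs_Ropp; apply Rabs_le, SIN_bound.
    - apply (is_lim_bounded_mult (fun y => cos (t y + w y)) eY 1); [|apply is_lim_eY].
      intros y; apply Rabs_le, COS_bound. }
  assert (Ls : is_lim (fun y => sqrt (nrm y)) p_infty A).
  { replace A with (sqrt (A ^ 2)) at 1 by (apply sqrt_pow2; lra).
    apply (is_lim_comp_continuous nrm sqrt p_infty (A ^ 2)); [apply is_lim_nrm|].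
    apply continuity_pt_filterlim, continuity_pt_sqrt, pow2_ge_0. }
  assert (Lq := is_lim_div_fin _ _ _ A ltac:(lra) Ln Ls).
  replace ((A * 1 + 0) / A) with 1 in Lq by (field; lra).
  refine (is_lim_ext_loc _ _ _ _ _ Lq). exists 0; intros y Hy.
  assert (Pn := nrm_pos y Hy). assert (Psn := sqrt_lt_R0 _ Pn).
  assert (Hs := sqrt_lt_R0 y Hy). assert (PE := Rpower_pos y (- eta)).
  destruct (polar_of_is_psi A nu eta psi HA Hpsi y Hy) as [PL [E1 E2]].
  rewrite ultra_slope_aJ in E1 by exact Hy. rewrite ultra_slope_aY in E2 by exact Hy.
  set (k := Rpower y (- eta) / sqrt y) in *.
  assert (Pk : 0 < k) by (now apply Rdiv_lt_0_compat).
  assert (EL : L nu eta y = k * sqrt (nrm y)).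
  { assert (T := sin_cos_sq (psi y)).
    assert (Q : L nu eta y ^ 2 = k ^ 2 * nrm y).
    { transitivity (L nu eta y ^ 2 * (sin (psi y) * sin (psi y) + cos (psi y) * cos (psi y)));
        [rewrite T; ring|].
      transitivity ((L nu eta y * cos (psi y)) ^ 2 + (L nu eta y * sin (psi y)) ^ 2); [ring|].
      rewrite <- E1, <- E2; unfold nrm; ring. }
    rewrite <- (sqrt_pow2 (L nu eta y)), Q by lra.
    rewrite sqrt_mult_alt by apply pow2_ge_0. now rewrite sqrt_pow2 by lra. }
  assert (Ec : cos (psi y) = aJ y / sqrt (nrm y)).
  { apply (Rmult_eq_reg_l (L nu eta y)); [|lra]. rewrite <- E1, EL; field; lra. }
  assert (Ed : sin (psi y) = aY y / sqrt (nrm y)).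
  { apply (Rmult_eq_reg_l (L nu eta y)); [|lra]. rewrite <- E2, EL; field; lra. }
  replace (psi_lower nu eta y) with (t y + w y + PI / 2) by (unfold w; ring).
  rewrite cos_minus, Ec, Ed, (cos_plus _ (PI / 2)), (sin_plus _ (PI / 2)), cos_PI2, sin_PI2.
  assert (Ew : A * cos (w y) = A * (sin (t y) * sin (t y + w y) + cos (t y) * cos (t y + w y))).
  { replace (cos (w y)) with (cos (t y + w y - t y)) by (f_equal; ring). rewrite cos_minus; ring. }
  rewrite Ew; unfold eJ, eY; field; lra.
Qed.

Lemma is_lim_low_sub_wkb :
  is_lim (fun y => psi_lower nu eta y - wkb nu y) p_infty (PI / 4).
Proof.
  assert (Hm := mu_of_pos).
  assert (S1 := is_lim_phase_shape m (eta ^ 2 / (2 * m) + m) eta Hm).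
  assert (S2 := is_lim_phase_shape nu nu 0 ltac:(lra)).
  assert (S := is_lim_plus' _ _ _ _ _ (is_lim_minus' _ _ _ _ _ S1 S2) (is_lim_const (PI / 4) p_infty)).
  replace (0 - 0 + PI / 4) with (PI / 4) in S by ring.
  refine (is_lim_ext_loc _ _ _ _ _ S); exists nu; intros y Hy.
  assert (T : 0 < y ^ 2 - nu ^ 2) by nra. assert (Hs := sqrt_lt_R0 _ T).
  assert (Hm2 := mu_of_sq). assert (T' : 0 < y ^ 2 - m ^ 2) by nra.
  assert (Hs' := sqrt_lt_R0 _ T').
  unfold psi_lower, wkb; fold m. field; lra.
Qed.

End Asymptotics.

(** * The lower bound *)
Theorem theorem3p5 (nu eta : R) (psi : R -> R) (x_at x : R)
  (eta_pos : 0 < eta) (eta_lt_nu : eta < nu)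
  (psi_phase : is_psi nu eta psi)
  (x_at_root : is_greatest_positive_root (r_poly (mu_of nu eta) eta) x_at)
  (x_gt : x_at < x) :
  psi_lower nu eta x < psi x.
Proof.
  destruct ex_hankel_pair as [A HA].
  assert (Hm := mu_of_pos nu eta eta_pos eta_lt_nu).
  destruct (qnum_pos_beyond (mu_of nu eta) eta x_at Hm eta_pos x_at_root) as [Hmx Hq].
  destruct (Rlt_dec (psi_lower nu eta x) (psi x)) as [H|Hle]; [exact H|exfalso].
  assert (HPI := PI_RGT_0). assert (HPI2 := PI2_3_2).
  destruct (ex_psi_phase A nu eta psi HA eta_pos eta_lt_nu psi_phase)
    as [psi1 [dpsi [d1 [Hpsi [Hpot [Lpsi1 Ldpsi]]]]]].
  assert (Hlow := is_phase_psi_lower nu eta x_at Hm (Rlt_le _ _ Hmx) Hq).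
  set (m := mu_of nu eta) in *.
  (* the contrary assumption makes [psi_lower - psi] exceed [e] at infinity, up to the gap *)
  destruct (comparison_lt x_at x psi psi1 dpsi d1 (psi_lower nu eta) (low1 m eta)
    (dlow m eta) (dlow1 m eta) (is_phase_weaken m x_at _ _ _ _ (Rlt_le _ _ Hmx) Hpsi) Hlow x_gt)
    as [x2 [e [_ [He Hgap]]]].
  { intros y Hy; rewrite Hpot by lra.
    apply Rminus_lt_0; rewrite potential_low_sub by (try nra; assert (Q := Hq y Hy); lra).
    assert (P := r_poly_pos_beyond m eta x_at y x_at_root Hy). assert (Q := Hq y Hy).
    assert (T : 0 < y ^ 2 - m ^ 2) by nra.
    apply Rdiv_lt_0_compat; [exact P|].
    repeat apply Rmult_lt_0_compat; try apply pow_lt; lra. }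
  set (e' := Rmin (e / 2) (1 / 2)).
  assert (He' : 0 < e') by (apply Rmin_case; lra).
  assert (M1 := Rmin_l (e / 2) (1 / 2)). assert (M2 := Rmin_r (e / 2) (1 / 2)).
  fold e' in M1, M2.
  set (d := Rmin (e / 32) (1 / 8)).
  assert (Hd : 0 < d) by (apply Rmin_case; lra).
  assert (M3 := Rmin_l (e / 32) (1 / 8)). assert (M4 := Rmin_r (e / 32) (1 / 8)).
  fold d in M3, M4.
  assert (Hcos : cos e' < 1).
  { rewrite <- cos_0; apply cos_decreasing_1; lra. }
  destruct (is_lim_eventually _ _ d Lpsi1 Hd) as [X1 H1].
  destruct (is_lim_eventually _ _ d Ldpsi Hd) as [X2 H2].
  destruct (is_lim_eventually _ _ d (is_lim_low1 m eta Hm) Hd) as [X3 H3].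
  destruct (is_lim_eventually _ _ d (is_lim_dlow m eta Hm (ex_intro _ x_at Hq)) Hd) as [X4 H4].
  destruct (is_lim_eventually _ _ (1 / 10)
    (is_lim_low_sub_wkb nu eta eta_pos eta_lt_nu) ltac:(lra)) as [X5 H5].
  destruct (is_lim_eventually _ _ (1 - cos e')
    (is_lim_cos_gap A nu eta psi HA eta_pos eta_lt_nu psi_phase) ltac:(lra)) as [X6 H6].
  set (y := Rabs X1 + Rabs X2 + Rabs X3 + Rabs X4 + Rabs X5 + Rabs X6 + Rabs x2 + nu + 2).
  assert (B : X1 < y /\ X2 < y /\ X3 < y /\ X4 < y /\ X5 < y /\ X6 < y /\ x2 < y /\ nu + 1 < y).
  { assert (Q1 := Rle_abs X1). assert (Q2 := Rle_abs X2). assert (Q3 := Rle_abs X3).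
    assert (Q4 := Rle_abs X4). assert (Q5 := Rle_abs X5). assert (Q6 := Rle_abs X6).
    assert (Q7 := Rle_abs x2).
    assert (R1 := Rabs_pos X1). assert (R2 := Rabs_pos X2). assert (R3 := Rabs_pos X3).
    assert (R4 := Rabs_pos X4). assert (R5 := Rabs_pos X5). assert (R6 := Rabs_pos X6).
    assert (R7 := Rabs_pos x2).
    unfold y; repeat split; lra. }
  destruct B as [B1 [B2 [B3 [B4 [B5 [B6 [B7 B8]]]]]]].
  specialize (H1 y B1). specialize (H2 y B2). specialize (H3 y B3). specialize (H4 y B4).
  specialize (H5 y B5). specialize (H6 y B6).
  rewrite Rminus_0_r in H2, H4.
  assert (G := abs_pruefer_gap_le x psi1 dpsi (psi_lower nu eta) (low1 m eta) (dlow m eta) y d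
    ltac:(lra) ltac:(lra) ltac:(lra) ltac:(lra) ltac:(lra)).
  assert (C := Hgap y ltac:(lra)).
  between.
  assert (P := psi_gt_wkb A nu eta psi y HA ltac:(lra) psi_phase B8).
  set (D := psi_lower nu eta y - psi y) in *.
  (* [D] is trapped in [[e', 2 PI - e']], where [cos] does not exceed [cos e'] *)
  assert (D1 : e' <= D) by lra.
  assert (D2 : D <= 2 * PI - e') by (unfold D; lra).
  assert (Hc : cos D <= cos e').
  { destruct (Rle_dec D PI) as [HD|HD].
    - apply cos_decr_1; lra.
    - replace (cos D) with (cos (2 * PI - D))
        by (rewrite cos_minus, cos_2PI, sin_2PI; ring).
      apply cos_decr_1; lra. }
  lra.
Qed.
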